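(* Let $q\in[-1,1]$ be fixed, let $Q$ be a real polynomial in one variable, and for each $N$ let $\mathbf W\in\mathcal W_q\left(\frac1N I_N,I_M\right)$, where $M=M(N)$ satisfies $M/N\to\lambda\in[0,\infty)$ as $N\to\infty$. Then $$X_N:=\mathrm{tr}(Q(\mathbf W))-\tau\big(\mathrm{tr}(Q(\mathbf W))\big)$$ converges in distribution as $N\to\infty$. Furthermore, if $q=1$ then the limit law of $X_N$ is normal, and if $q=0$ then the limit law of $X_N$ is a semicircle law.
   Context: A noncommutative probability space is a unital complex $*$-algebra $\mathcal A$ with a tracial state $\tau:\mathcal A\to\mathbb C$ (it may depend on $N$). Fix $q\in[-1,1]$. Elements $\mathbf X_1,\mathbf X_2,\dots\in\mathcal A$ are (jointly) $q$-Gaussian if $\mathbf X_j=\mathbf X_j^*$ and for any $\mathbf Y_1,\dots,\mathbf Y_n\in\{\mathbf X_1,\mathbf X_2,\dots\}$, $$\tau(\mathbf Y_1\cdots\mathbf Y_n)=\sum_{\mathcal V}q^{\mathrm{cr}(\mathcal V)}\prod_{\{i,j\}\in\mathcal V,\ i<j}\tau(\mathbf Y_i\mathbf Y_j),$$ where the sum is over all pair partitions $\mathcal V$ of $\{1,\dots,n\}$ (so it is $0$ for odd $n$), $\mathrm{cr}(\mathcal V)=\#\{(i_1,i_2):\{i_1,j_1\},\{i_2,j_2\}\in\mathcal V,\ i_1<i_2<j_1<j_2\}$, and $0^0=1$. For real positive definite matrices $\Sigma$ ($N\times N$) and $B$ ($M\times M$), $\mathbf W\in\mathcal W_q(\Sigma,B)$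 means that $\mathbf W=\mathbf X^*\mathbf X$ is the $N\times N$ matrix over $\mathcal A$ obtained from an $M\times N$ matrix $\mathbf X=[\mathbf X_{i,j}]$ of jointly $q$-Gaussian elements of $\mathcal A$ with $\tau(\mathbf X_{i,j}\mathbf X_{k,m})=[B]_{i,k}[\Sigma]_{j,m}$; here $*$ on matrices is transposition combined with entrywise $*$. Thus $[\mathbf W]_{i,j}=\sum_k\mathbf X_{k,i}\mathbf X_{k,j}$. $\mathrm{tr}$ is the unnormalized trace, $\mathrm{tr}(\mathbf Z)=\sum_{i=1}^N[\mathbf Z]_{i,i}\in\mathcal A$. The number $\tau(\cdot)$ subtracted in $X_N$ is understood as that multiple of the unit of $\mathcal A$. Convergence in distribution of self-adjoint $X_N$ to a probability measure $\mu$ on $\mathbb R$ is understood in the sense of moments: $\mu$ has all moments, is uniquely determined by them, and $\tau(X_N^m)\to\int x^m\,d\mu$ for all $m\ge1$. Normal and semicircle laws are allowed to have variance $0$ (point mass at $0$). *)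

(* Defs.v *)
From HB Require Import structures.
From mathcomp Require Import all_boot all_order all_algebra.
From mathcomp Require Import complex.
From mathcomp Require Import all_classical all_reals all_analysis.
Set Implicit Arguments.
Unset Strict Implicit.
Unset Printing Implicit Defensive.
Import Order.TTheory GRing.Theory Num.Theory.
Import numFieldNormedType.Exports.
Local Open Scope classical_set_scope.
Local Open Scope complex_scope.
Local Open Scope ring_scope.

(* [algType] requires 1 != 0; this is no restriction, as [tau] maps 1 to 1.   *)
Record ncProbSpace (R : realType) := NcProbSpace {
  ncAlg :> algType R[i];
  star : ncAlg -> ncAlg;
  tau : {scalar ncAlg};
  starD : {morph star : x y / x + y >-> x + y};
  starZ : forall (c : R[i]) (x : ncAlg), star (c *: x) = c^* *: star x;
  starM : forall x y : ncAlg, star (x * y) = star y * star x;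
  starK : involutive star;
  tau1 : tau 1 = 1;
  tau_ge0 : forall x : ncAlg, 0 <= tau (star x * x);
  tau_tracial : forall x y : ncAlg, tau (x * y) = tau (y * x)
}.

Definition pair_partition (n : nat) (V : {set {set 'I_n}}) : bool :=
  finset.partition V [set: 'I_n]%SET && [forall B in V, #|B| == 2].

Definition crossings (n : nat) (V : {set {set 'I_n}}) : nat :=
  #|[set i : 'I_n * 'I_n | [exists j : 'I_n * 'I_n,
      [&& ([set i.1; j.1] \in V)%SET, ([set i.2; j.2] \in V)%SET,
          (i.1 < i.2)%N, (i.2 < j.1)%N & (j.1 < j.2)%N]]]%SET|.

Section qGaussian.
Context {R : realType} {A : ncProbSpace R}.

Definition q_gaussian (q : R) (I : Type) (X : I -> A) : Prop :=
  (forall i, star (X i) = X i) /\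
  forall (n : nat) (Y : 'I_n -> I),
    tau A (\prod_(k < n) X (Y k)) =
    \sum_(V : {set {set 'I_n}} | pair_partition V)
      (q%:C) ^+ crossings V *
      \prod_(p : 'I_n * 'I_n | (p.1 < p.2)%N && ([set p.1; p.2] \in V)%SET)
        tau A (X (Y p.1) * X (Y p.2)).

Definition posdef (n : nat) (S : 'M[R]_n) : Prop :=
  S^T = S /\ forall v : 'rV[R]_n, v != 0 -> 0 < (v *m S *m v^T) 0 0.

Definition q_wishart (q : R) (N M : nat) (Sigma : 'M[R]_N) (B : 'M[R]_M)
    (W : 'M[A]_N) : Prop :=
  posdef Sigma /\ posdef B /\
  exists X : 'M[A]_(M, N),
    [/\ q_gaussian q (fun ij : 'I_M * 'I_N => X ij.1 ij.2),
        forall (i k : 'I_M) (j m : 'I_N),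
          tau A (X i j * X k m) = (B i k * Sigma j m)%:C
      & W = map_mx (@star R A) X^T *m X].

(* [horner_mx] is not available since the entries of [W] do not commute; the  *)
(* real coefficients of [Q] act through R -> R[i] -> A.                       *)
Definition poly_mx (N : nat) (Q : {poly R}) (W : 'M[A]_N) : 'M[A]_N :=
  \sum_(k < size Q) map_mx (fun a : A => (Q`_k)%:C *: a) (W ^+ k).

Definition centered_trace (N : nat) (Q : {poly R}) (W : 'M[A]_N) : A :=
  \tr (poly_mx Q W) - (tau A (\tr (poly_mx Q W)))%:A.

End qGaussian.

Section Laws.
Context {R : realType}.
Implicit Types mu nu : probability (measurableTypeR R) R.

Definition has_moments mu : Prop :=
  forall m : nat, mu.-integrable setT (fun x : R => (x ^+ m)%:E).

Definition moment mu (m : nat) : R := Rintegral mu setT (fun x : R => x ^+ m).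

Definition moment_determined mu : Prop :=
  forall nu, has_moments nu -> (forall m, moment nu m = moment mu m) ->
    forall D : set (measurableTypeR R), measurable D -> nu D = mu D.

Definition cvg_in_distribution (A : nat -> ncProbSpace R)
    (X : forall N, A N) mu : Prop :=
  [/\ has_moments mu, moment_determined mu
    & forall m : nat, (0 < m)%N ->
        (fun N => tau (A N) (X N ^+ m) : R[i]^o) @ \oo
          --> ((moment mu m)%:C : R[i]^o)].

(* Centered normal law of variance [v]; the degenerate case is separate since *)
(* [normal_prob 0 0] is the uniform law on [0, 1].                            *)
Definition normal_law (v : R) mu : Prop :=
  forall D : set (measurableTypeR R), measurable D ->
    mu D = if v == 0 then dirac (0 : measurableTypeR R) D
           else normal_prob 0 (Num.sqrt v) D.

(* Vanishes for x ^+ 2 > 4 v, as [Num.sqrt] is 0 on negative numbers.         *)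
Definition semicircle_pdf (v x : R) : R :=
  Num.sqrt (4 * v - x ^+ 2) / (2 * pi * v).

Definition semicircle_law (v : R) mu : Prop :=
  forall D : set (measurableTypeR R), measurable D ->
    mu D = if v == 0 then dirac (0 : measurableTypeR R) D
           else (\int[lebesgue_measure]_(x in D) (semicircle_pdf v x)%:E)%E.

End Laws.

(* Main.v *)
Require Import Defs.
From HB Require Import structures.
From mathcomp Require Import all_boot all_order all_algebra.
From mathcomp Require Import zify.
Set Implicit Arguments.
Unset Strict Implicit.
Unset Printing Implicit Defensive.

(** Write [X_N] for the centred trace of [Q (W)]. It is a real combination of
    the centred traces [ctrace k] of the powers of [W], so everything rests on
    the mixed moments of these, and on the passage from moments to laws.

    Expanding a trace over labellings, the moments of a product of [m] centred
    traces become a sum over the pairings of the letters of [m] necklaces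
    (blocks). Centring removes exactly the pairings that match some block with
    itself ([tau_centered]): such a block crosses nothing, so its weight
    factors out. The weight of a pairing is [q] to its number of crossings,
    times [N] to the minus number of pairs, times the number of labellings
    compatible with it; the latter is [N ^ w * M ^ b], where [w] and [b] count
    the components of two glued graphs. Counting labellings over F_2 compares
    [w + b] with the number of components of the adjacency graph of the blocks
    ([gluing_bound]) and shows that the weight is bounded ([gluing_le]), so that
    it converges as [M / N] does, and that it vanishes in the limit as soon as
    some block is not matched with exactly one other block ([gluing_lt]). In the limit the blocks are thus matched two by
    two; counting such matchings bounds the moments of order [2n] of [X_N] by
    [B ^ n (2n)! / n!].

    These limits are moments of a law because the Hankel forms are limits of
    [tau (p* p)], with [X_N] self-adjoint. Existence ([hamburger]) is proved by
    Gaussian quadrature followed by a cluster point of the distribution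
    functions. The growth of the moments makes the Taylor series of cosine
    integrable term by term, so that integrals of trigonometric polynomials,
    hence of indicators of rays, are determined
    ([moment_determined_growth]).

    When [q = 1] crossings are free and the partner of the first block may be
    removed: the limit moments satisfy [mo (m + 2) = (m + 1) v mo m]. When
    [q = 0] a pairing of the first block with the block [j] survives only if it
    separates the blocks in between from those after, and
    [mo (m + 2) = v (sum of mo j * mo (m - j))]. The normal law and the
    semicircle law of variance [v] satisfy these recursions, by integration by
    parts, and determinacy concludes. *)

Import GRing.Theory.

(** * Pairings of a finite set and their crossings *)

Section Pairings.
Variable T : finType.
Implicit Types (V : {set {set T}}) (S : {set T}) (P : {set T}).

Definition pairing S V : bool := partition V S && [forall P in V, #|P| == 2].

Definition splits V S : bool :=
  [forall P in V, (P \subset S) || [disjoint P & S]].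

Definition restr V S : {set {set T}} := [set P in V | P \subset S].

Lemma splitsP V S :
  reflect (forall P, P \in V -> (P \subset S) \/ [disjoint P & S]) (splits V S).
Proof.
apply: (iffP forall_inP) => h P PV; first by apply/orP/h.
exact/orP/h.
Qed.

Lemma pairingP S V :
  reflect [/\ partition V S & forall P, P \in V -> #|P| = 2] (pairing S V).
Proof.
apply: (iffP andP) => -[pV h]; split=> //; first by move=> P PV; exact/eqP/(forall_inP h).
by apply/forall_inP => P /h ->.
Qed.

Lemma pairing_sub S V P : pairing S V -> P \in V -> P \subset S.
Proof.
case/pairingP => /and3P[/eqP <- _ _] _ PV.
by apply/subsetP => x xP; apply/bigcupP; exists P.
Qed.

Lemma pairing_pair S V P x : pairing S V -> P \in V -> x \in P ->
  exists2 y, x != y & P = [set x; y].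
Proof.
case/pairingP => _ h /h /eqP /cards2P[a [b [ab ->]]].
rewrite !inE => /orP[] /eqP ->; first by exists b.
by exists a; rewrite 1?eq_sym // setUC.
Qed.

Lemma pairing_ex S V x : pairing S V -> x \in S -> exists2 P, P \in V & x \in P.
Proof.
case/pairingP => /and3P[/eqP <- _ _] _ /bigcupP[P PV xP].
by exists P.
Qed.

Lemma pairing_uniq S V P Q x : pairing S V ->
  P \in V -> Q \in V -> x \in P -> x \in Q -> P = Q.
Proof.
case/pairingP => /and3P[_ tV _] _ PV QV xP xQ.
by apply: contraTeq xQ => PQ; rewrite (disjointFr (trivIsetP tV _ _ PV QV PQ)).
Qed.

Lemma pairing_set0 S V : pairing S V -> set0 \notin V.
Proof. by case/pairingP => /and3P[]. Qed.

Lemma pairingI S V :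
  (forall P, P \in V -> P \subset S /\ #|P| = 2) ->
  (forall x, x \in S -> exists2 P, P \in V & x \in P) ->
  (forall P Q x, P \in V -> Q \in V -> x \in P -> x \in Q -> P = Q) ->
  pairing S V.
Proof.
move=> h1 h2 h3; apply/pairingP; split=> [|P /h1[] //].
apply/and3P; split.
- apply/eqP/setP => x; apply/bigcupP/idP => [[P /h1[/subsetP + _]]|/h2[P PV xP]].
    by apply.
  by exists P.
- apply/trivIsetP => P Q PV QV; apply: contraNT => /pred0Pn[x /andP[xP xQ]].
  by rewrite (h3 P Q x).
- by apply/negP => /h1[_]; rewrite cards0.
Qed.

Lemma card_pairing S V : pairing S V -> (#|V| * 2)%N = #|S|.
Proof.
by case/pairingP => pV h; rewrite -(@card_uniform_partition _ 2 V S).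
Qed.

Lemma pairingU S1 S2 V1 V2 : [disjoint S1 & S2] ->
  pairing S1 V1 -> pairing S2 V2 -> pairing (S1 :|: S2) (V1 :|: V2).
Proof.
move=> dS p1 p2; apply: pairingI.
- move=> P; rewrite inE => /orP[] PV.
    split; last by case/pairingP: p1 => _; apply.
    exact: subset_trans (pairing_sub p1 PV) (subsetUl _ _).
  split; last by case/pairingP: p2 => _; apply.
  exact: subset_trans (pairing_sub p2 PV) (subsetUr _ _).
- move=> x; rewrite inE => /orP[/(pairing_ex p1)|/(pairing_ex p2)] [P PV xP];
  by exists P; rewrite // inE PV ?orbT.
- have aux P Q x : P \in V1 -> Q \in V2 -> x \in P -> x \in Q -> P = Q.
    move=> PV QV /(subsetP (pairing_sub p1 PV)) xS1.
    by move=> /(subsetP (pairing_sub p2 QV)); rewrite (disjointFr dS xS1).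
  move=> P Q x; rewrite !inE => /orP[] PV /orP[] QV xP xQ.
  + exact: pairing_uniq p1 PV QV xP xQ.
  + exact: aux PV QV xP xQ.
  + by apply/esym; apply: aux QV PV xQ xP.
  + exact: pairing_uniq p2 PV QV xP xQ.
Qed.

Lemma pairing_restr S S1 V : pairing S V -> S1 \subset S -> splits V S1 ->
  pairing S1 (restr V S1).
Proof.
move=> pV S1S /splitsP sV; apply: pairingI.
- move=> P; rewrite inE => /andP[PV ->]; split=> //.
  by case/pairingP: pV => _; apply.
- move=> x xS1; have [P PV xP] := pairing_ex pV (subsetP S1S _ xS1).
  exists P; rewrite // inE PV; case: (sV P PV) => // dP.
  by rewrite (disjointFr dP xP) in xS1.
- move=> P Q x; rewrite !inE => /andP[PV _] /andP[QV _].
  exact: pairing_uniq pV PV QV.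
Qed.

Lemma splitsD S S1 V : pairing S V -> splits V S1 -> splits V (S :\: S1).
Proof.
move=> pV /splitsP sV; apply/splitsP => P PV.
case: (sV P PV) => [sP|dP]; [right|left].
  rewrite -setI_eq0; apply/eqP/setP => x; rewrite !inE.
  by apply/negP => /and3P[/(subsetP sP) ->].
apply/subsetP => x xP; rewrite inE (disjointFr dP xP) /=.
exact: (subsetP (pairing_sub pV PV)).
Qed.

Lemma restrU S S1 V : pairing S V -> splits V S1 ->
  restr V S1 :|: restr V (S :\: S1) = V.
Proof.
move=> pV /splitsP sV; apply/setP => P; rewrite !inE -andb_orr.
apply/andP/idP => [[]//|PV]; split=> //.
case: (sV P PV) => [->//|dP]; apply/orP; right; apply/subsetP => x xP.
by rewrite inE (disjointFr dP xP) (subsetP (pairing_sub pV PV)).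
Qed.

Lemma restr_pairingU S1 S2 V1 V2 : [disjoint S1 & S2] ->
  pairing S1 V1 -> pairing S2 V2 -> restr (V1 :|: V2) S1 = V1.
Proof.
move=> dS p1 p2; apply/setP => P; rewrite !inE.
apply/andP/idP => [[/orP[//|PV2] PS1]|PV1]; last by rewrite PV1 (pairing_sub p1).
have [y yP] : exists y, y \in P.
  by apply/set0Pn; apply: contraTneq PV2 => ->; rewrite (pairing_set0 p2).
by have := subsetP PS1 y yP; rewrite (disjointFl dS (subsetP (pairing_sub p2 PV2) y yP)).
Qed.

Lemma splits_pairingU S1 S2 V1 V2 : [disjoint S1 & S2] ->
  pairing S1 V1 -> pairing S2 V2 -> splits (V1 :|: V2) S1.
Proof.
move=> dS p1 p2; apply/splitsP => P; rewrite inE => /orP[/(pairing_sub p1)|]; first by left.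
move/(pairing_sub p2) => PS2; right; rewrite disjoint_sym.
exact: disjointWr PS2 dS.
Qed.

(** A pairing that does not link [S1] to its complement is a pair of
    pairings; this is how every factorisation below is obtained. *)
Lemma sum_pairing_split (R : nmodType) S S1 (F : {set {set T}} -> R) :
  S1 \subset S ->
  (\sum_(V | pairing S V && splits V S1) F V =
   \sum_(V1 | pairing S1 V1) \sum_(V2 | pairing (S :\: S1) V2) F (V1 :|: V2))%R.
Proof.
move=> S1S; have dS : [disjoint S1 & S :\: S1].
  by rewrite -setI_eq0 setIDA setIC -setIDA setDv setI0.
have eS : S = S1 :|: (S :\: S1).
  by apply/setP => x; rewrite !inE; case: (boolP (x \in S1)) => // /(subsetP S1S).
rewrite pair_big /=.
rewrite (reindex_onto (fun p : {set {set T}} * {set {set T}} => p.1 :|: p.2)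
  (fun V => (restr V S1, restr V (S :\: S1)))) /=; last first.
  by move=> V /andP[pV sV]; apply: restrU pV sV.
apply: eq_bigl => -[V1 V2] /=; apply/idP/idP.
  move=> /andP[/andP[pV sV] /eqP[e1 e2]].
  have := pairing_restr pV S1S sV.
  by have := pairing_restr pV (subsetDl _ _) (splitsD pV sV); rewrite e1 e2 => -> ->.
move=> /andP[p1 p2].
rewrite {1}eS pairingU // (splits_pairingU dS p1 p2) /=.
rewrite (restr_pairingU dS p1 p2) setUC (restr_pairingU _ p2 p1) ?eqxx //.
by rewrite disjoint_sym.
Qed.

Section Crossings.
Variable rho : T -> nat.

Definition crossing_set V : {set T * T} :=
  [set i : T * T | [exists j : T * T,
      [&& [set i.1; j.1] \in V, [set i.2; j.2] \in V,
          rho i.1 < rho i.2, rho i.2 < rho j.1 & rho j.1 < rho j.2]]].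

(** Crossings are counted with respect to a rank [rho], since the points to be
    paired will be letters of several words and not integers. *)
Definition ncross V : nat := #|crossing_set V|.

Lemma ncrossP V :
  reflect (exists a b c d, [/\ [set a; c] \in V, [set b; d] \in V,
     rho a < rho b, rho b < rho c & rho c < rho d]) (0 < ncross V).
Proof.
apply: (iffP card_gt0P) => [[i]|[a [b [c [d [h1 h2 h3 h4 h5]]]]]].
  rewrite inE => /existsP[j /and5P[*]].
  by exists i.1, i.2, j.1, j.2; split.
by exists (a, b); rewrite inE; apply/existsP; exists (c, d); apply/and5P.
Qed.

(** Pairs on an interval do not cross pairs on the complement. *)
Lemma ncrossU S1 S2 V1 V2 : [disjoint S1 & S2] ->
  pairing S1 V1 -> pairing S2 V2 ->
  (forall x y z, x \in S1 -> y \in S1 -> z \in S2 -> ~ (rho x < rho z < rho y)) ->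
  ncross (V1 :|: V2) = ncross V1 + ncross V2.
Proof.
move=> dS p1 p2 h; rewrite /ncross -cardsUI.
have in1 a b : [set a; b] \in V1 -> (a \in S1) * (b \in S1).
  by move=> /(pairing_sub p1) /subsetP s; rewrite !s ?inE ?eqxx ?orbT.
have in2 a b : [set a; b] \in V2 -> (a \in S2) * (b \in S2).
  by move=> /(pairing_sub p2) /subsetP s; rewrite !s ?inE ?eqxx ?orbT.
rewrite (_ : crossing_set V1 :&: crossing_set V2 = set0) ?cards0 ?addn0; last first.
  apply/setP => i; rewrite !inE; apply/negP => /andP[].
  move=> /existsP[j /and5P[/in1 a _ _ _ _]] /existsP[k /and5P[/in2 b _ _ _ _]].
  by have := b.1; rewrite (disjointFr dS a.1).
congr #|pred_of_set _|; apply/setP => i; rewrite !inE; apply/existsP/orP.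
  move=> [j /and5P[]]; rewrite !inE => /orP[] a /orP[] b h1 h2 h3.
  - by left; apply/existsP; exists j; rewrite a b h1 h2 h3.
  - by case: (h _ _ _ (in1 _ _ a).1 (in1 _ _ a).2 (in2 _ _ b).1); rewrite h1 h2.
  - by case: (h _ _ _ (in1 _ _ b).1 (in1 _ _ b).2 (in2 _ _ a).2); rewrite h2 h3.
  - by right; apply/existsP; exists j; rewrite a b h1 h2 h3.
case=> /existsP[j /and5P[a b h1 h2 h3]]; exists j; rewrite !inE a b h1 h2 h3 ?orbT //.
Qed.

End Crossings.
End Pairings.

Section Transfer.
Variables (T : finType) (rho : T -> nat) (n : nat) (phi : 'I_n -> T).
Hypothesis phi_mono : forall x y : 'I_n, (x < y) = (rho (phi x) < rho (phi y)).

Let phi_inj : injective phi.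
Proof.
move=> x y e; apply: val_inj; case: (ltngtP x y) => //;
by rewrite phi_mono e ltnn.
Qed.

Let S := [set phi x | x : 'I_n].
Let im (V : {set {set 'I_n}}) : {set {set T}} := [set phi @: P | P : {set 'I_n} in V].
Let pre (V : {set {set T}}) : {set {set 'I_n}} := [set phi @^-1: P | P : {set T} in V].

Let imK : cancel im pre.
Proof.
move=> V; rewrite /pre /im -imset_comp -[RHS]imset_id; apply: eq_in_imset => P _ /=.
by apply/setP => x; rewrite inE mem_imset.
Qed.

Let preK V : pairing S V -> im (pre V) = V.
Proof.
move=> pV; rewrite /pre /im -imset_comp -[RHS]imset_id; apply: eq_in_imset => P PV /=.
apply/setP => x; apply/imsetP/idP => [[y]|xP]; first by rewrite inE => yP ->.
have /imsetP[y _ e] := subsetP (pairing_sub pV PV) x xP.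
by exists y; rewrite // inE -e.
Qed.

Let mem_im V (P : {set 'I_n}) : (phi @: P \in im V) = (P \in V).
Proof. by rewrite /im mem_imset //; exact: imset_inj. Qed.

Let pairing_im V : pairing S (im V) = pairing setT V.
Proof.
apply/idP/idP => pV; apply: pairingI.
- move=> P; rewrite -mem_im => PV; rewrite subsetT; split=> //.
  by rewrite -(card_imset _ phi_inj); case/pairingP: pV => _; apply.
- move=> x _; have xS : phi x \in S by apply/imsetP; exists x.
  have [P] := pairing_ex pV xS.
  by move=> /imsetP[Q QV ->]; rewrite mem_imset // => xQ; exists Q.
- move=> P Q x; rewrite -!mem_im => PV QV xP xQ.
  apply: (imset_inj phi_inj); apply: (pairing_uniq (x := phi x) pV PV QV);
  by rewrite mem_imset.
- move=> P /imsetP[Q QV ->]; rewrite card_imset //; split.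
    by apply/subsetP => y /imsetP[x _ ->]; apply/imsetP; exists x.
  by case/pairingP: pV => _; apply.
- move=> y /imsetP[x _ ->]; have [//|P PV xP] := pairing_ex (x := x) pV.
  by exists (phi @: P); rewrite ?mem_im ?mem_imset.
- move=> P Q y /imsetP[P' PV ->] /imsetP[Q' QV ->] /imsetP[x xP ->].
  by rewrite mem_imset // => xQ; rewrite (pairing_uniq pV PV QV xP xQ).
Qed.

Let im2 x y : phi @: [set x; y] = [set phi x; phi y].
Proof. by rewrite imsetU !imset_set1. Qed.

Let ncross_im V : pairing setT V -> ncross rho (im V) = ncross (@nat_of_ord n) V.
Proof.
move=> pV; have pV' : pairing S (im V) by rewrite pairing_im.
have inS a b : [set a; b] \in im V -> exists x y, [/\ phi x = a, phi y = b & [set x; y] \in V].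
  move=> h; have /subsetP s := pairing_sub pV' h.
  have /imsetP[x _ ex] : a \in S by apply: s; rewrite !inE eqxx.
  have /imsetP[y _ ey] : b \in S by apply: s; rewrite !inE eqxx orbT.
  by exists x, y; rewrite -mem_im im2 -ex -ey.
pose phi2 (p : 'I_n * 'I_n) := (phi p.1, phi p.2).
have phi2_inj : injective phi2 by move=> [a b] [c d] [/phi_inj -> /phi_inj ->].
rewrite /ncross -(card_imset _ phi2_inj); congr #|pred_of_set _|.
apply/setP => -[a b]; rewrite inE; apply/existsP/imsetP => /=.
  move=> [[c d] /= /and5P[/inS[x [z [<- <- h1]]] /inS[y [w [<- <- h2]]]]].
  rewrite -!phi_mono => h3 h4 h5; exists (x, y) => //; rewrite inE.
  by apply/existsP; exists (z, w); rewrite /= h1 h2 h3 h4 h5.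
move=> [[x y]]; rewrite inE => /existsP[[z w] /= /and5P[h1 h2 h3 h4 h5]] [-> ->].
by exists (phi z, phi w); rewrite /= -!phi_mono -!im2 !mem_im h1 h2 h3 h4 h5.
Qed.

(** The moment formula of the model is stated on [0, n): an increasing
    enumeration carries it to any ranked set, keeping the crossings. *)
Lemma sum_pairing_transfer (R : comPzSemiRingType) (g : nat -> R) (f : T -> T -> R)
    (kappa : {set T} -> R) :
  (forall x y, rho x < rho y -> f x y = kappa [set x; y]) ->
  (\sum_(V : {set {set 'I_n}} | pairing [set: 'I_n] V)
     g (ncross (@nat_of_ord n) V) *
     \prod_(p : 'I_n * 'I_n | (p.1 < p.2)%N && ([set p.1; p.2] \in V))
        f (phi p.1) (phi p.2) =
   \sum_(V | pairing S V) g (ncross rho V) * \prod_(P in V) kappa P)%R.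
Proof.
move=> fk; rewrite [RHS](reindex_onto im pre); last by move=> V pV; exact: preK.
apply: eq_big => [V|V pV]; first by rewrite imK eqxx andbT pairing_im.
rewrite ncross_im //; congr (_ * _)%R.
rewrite [RHS]big_imset /=; last by move=> P Q _ _; exact: imset_inj.
rewrite (partition_big (fun p : 'I_n * 'I_n => [set p.1; p.2]) (mem V)) /=; last first.
  by move=> p /andP[].
apply: eq_bigr => P PV; case/pairingP: (pV) => _ /(_ P PV) /eqP /cards2P[a [b [ab eP]]].
wlog ltab : a b ab eP / (a < b)%N.
  move=> hw; case: (ltngtP a b) => [|lt|/val_inj e]; first exact: hw.
    by apply: (hw b a); rewrite 1?eq_sym // setUC.
  by rewrite e eqxx in ab.
rewrite (big_pred1 (a, b)) /=; first by rewrite fk -?phi_mono // -im2 -eP.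
move=> [x y] /=; apply/andP/eqP => [[/andP[ltxy _] /eqP e]|[-> ->]]; last first.
  by rewrite ltab -eP PV eqxx.
have : x \in P by rewrite -e !inE eqxx.
have : y \in P by rewrite -e !inE eqxx orbT.
rewrite eP !inE => /orP[]/eqP ey /orP[]/eqP ex; move: ltxy; rewrite ex ey // ?ltnn //.
by rewrite ltnNge (ltnW ltab).
Qed.

End Transfer.

Lemma sum_pairing_seq (T : finType) (rho : T -> nat) (R : comPzSemiRingType)
    (t : seq T) (g : nat -> R) (f : T -> T -> R) (kappa : {set T} -> R) :
  pairwise (fun x y => rho x < rho y) t ->
  (forall x y, rho x < rho y -> f x y = kappa [set x; y]) ->
  (\sum_(V : {set {set 'I_(size t)}} | pairing [set: 'I_(size t)] V)
     g (ncross (@nat_of_ord _) V) *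
     \prod_(p : 'I_(size t) * 'I_(size t) | (p.1 < p.2)%N && ([set p.1; p.2] \in V))
        f (tnth (in_tuple t) p.1) (tnth (in_tuple t) p.2) =
   \sum_(V | pairing [set x in t] V) g (ncross rho V) * \prod_(P in V) kappa P)%R.
Proof.
move=> pt fk.
have mono (x y : 'I_(size t)) : (x < y) = (rho (tnth (in_tuple t) x) < rho (tnth (in_tuple t) y)).
  have h (a b : 'I_(size t)) : a < b -> rho (tnth (in_tuple t) a) < rho (tnth (in_tuple t) b).
    have x0 : T := tnth (in_tuple t) a.
    move=> ab; rewrite !(tnth_nth x0) /=.
    exact: (elimT (pairwiseP x0) pt a b (ltn_ord a) (ltn_ord b) ab).
  apply/idP/idP; first exact: h.
  case: (ltngtP x y) => // [/h|/val_inj ->]; last by rewrite ltnn.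
  by move=> lt1 lt2; have := ltn_trans lt1 lt2; rewrite ltnn.
rewrite (sum_pairing_transfer mono _ fk); apply: eq_bigl => V.
congr pairing; apply/setP => x; rewrite inE; apply/imsetP/idP => [[i _ ->]|xt].
  exact: mem_tnth.
have lt : index x t < size t by rewrite index_mem.
by exists (Ordinal lt) => //; rewrite (tnth_nth x) /= nth_index.
Qed.

(** * Gluing bounds: the genus expansion *)

Section LocallyConstant.
Variables (C : finType) (e : rel C).
Hypothesis e_sym : symmetric e.

Let csym : connect_sym e.
Proof. exact: sym_connect_sym. Qed.

Lemma connect_const (E : Type) (f : C -> E) :
  (forall c c', e c c' -> f c = f c') -> forall c c', connect e c c' -> f c = f c'.
Proof.
move=> h c c' /connectP[p pth ->].
by elim: p c pth => //= x p IH c /andP[/h -> /IH].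
Qed.

(** A function constant along the edges is a function on the components: send
    it to its values at the roots. *)
Lemma card_locally_constant (E : finType) :
  #|[set f : {ffun C -> E} | [forall c, forall c', e c c' ==> (f c == f c')]]|
  = #|E| ^ n_comp e predT.
Proof.
pose D := {r : C | roots e r}.
have cD : #|{: D}| = n_comp e predT by rewrite card_sig; apply: eq_card => x; rewrite !inE andbT.
rewrite -cD -card_ffun.
pose r c : D := Sub (fingraph.root e c) (roots_root csym c).
pose g (u : {ffun D -> E}) : {ffun C -> E} := [ffun c => u (r c)].
have g_inj : injective g.
  move=> u v /ffunP uv; apply/ffunP => d; have := uv (val d); rewrite !ffunE.
  suff -> : r (val d) = d by [].
  by apply: val_inj => /=; apply/eqP/(valP d).
rewrite -(card_imset predT g_inj); congr #|pred_of_set _|; apply/setP => f.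
rewrite inE; apply/forallP/imsetP => [h|[u _ ->] c].
  exists [ffun d => f (val d)] => //; apply/ffunP => c; rewrite !ffunE /=.
  apply: (connect_const _ (connect_root e c)) => a b eab.
  by have /forallP/(_ b)/implyP/(_ eab)/eqP := h a.
apply/forallP => c'; apply/implyP => ecc'; rewrite !ffunE; apply/eqP; congr (u _).
by apply: val_inj => /=; apply/eqP; rewrite (root_connect csym) connect1.
Qed.

(** The forest is given by a parent map that decreases a depth. *)
Lemma spanning_forest :
  exists (dep : C -> nat) (par : C -> C), forall j, fingraph.root e j != j ->
    [/\ e j (par j), fingraph.root e (par j) = fingraph.root e j & dep (par j) < dep j].
Proof.
have ex j : exists n, [exists p : n.-tuple C, path e j p && (last j p == fingraph.root e j)].
  have /connectP[p pth lst] := connect_root e j.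
  exists (size p); apply/existsP; exists (in_tuple p).
  by rewrite pth lst eqxx.
pose dep j := ex_minn (ex j).
have h j : exists k, fingraph.root e j != j ->
    [/\ e j k, fingraph.root e k = fingraph.root e j & dep k < dep j].
  rewrite /dep; case: (ex_minnP (ex j)) => n /existsP[p /andP[pth /eqP lst]] _.
  case: n p pth lst => [|n] p pth lst.
    by rewrite tuple0 /= in lst; exists j => /eqP; case; rewrite -lst.
  case/tupleP: p pth lst => k p /= /andP[ejk pth] lst; exists k => _.
  have rk : fingraph.root e k = fingraph.root e j.
    by apply/eqP; rewrite (root_connect csym) csym connect1.
  split=> //; case: ex_minnP => m _ /(_ n); rewrite ltnS; apply.
  by apply/existsP; exists p; rewrite pth lst rk eqxx.
by exists dep; apply: (fin_all_exists h).
Qed.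

Lemma n_comp2 : (forall c, 1 < #|connect e c|) -> n_comp e predT * 2 <= #|C|.
Proof.
move=> h; rewrite -[#|C|]sum1_card.
rewrite (partition_big (fingraph.root e) (mem (roots e))) /=; last by move=> c _; apply: roots_root.
rewrite /n_comp_mem -sum_nat_const [X in X <= _](eq_bigl (mem (roots e))); last first.
  by move=> c; rewrite !inE andbT.
apply: leq_sum => r rr; apply: leq_trans (h r) _.
rewrite -sum1_card; apply/eq_leq/eq_bigl => c.
by rewrite -topredE /= -(root_connect csym) (eqP rr) eq_sym.
Qed.

Lemma n_comp2_lt x : (forall c, 1 < #|connect e c|) -> 2 < #|connect e x| ->
  n_comp e predT * 2 < #|C|.
Proof.
move=> h hx; rewrite -[#|C|]sum1_card.
rewrite (partition_big (fingraph.root e) (mem (roots e))) /=; last by move=> c _; apply: roots_root.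
rewrite /n_comp_mem -sum_nat_const [X in X < _](eq_bigl (mem (roots e))); last first.
  by move=> c; rewrite !inE andbT.
have card_fiber r : roots e r -> \sum_(c | fingraph.root e c == r) 1 = #|connect e r|.
  move=> rr; rewrite -sum1_card; apply/esym/eq_bigl => c.
  by rewrite -topredE /= -(root_connect csym) (eqP rr) eq_sym.
rewrite (bigD1 (fingraph.root e x)) /=; last exact: roots_root.
rewrite [X in _ < X](bigD1 (fingraph.root e x)) /=; last exact: roots_root.
rewrite -addSn; apply: leq_add.
  rewrite card_fiber; last exact: roots_root.
  rewrite (eq_card (B := connect e x)) // => c.
  by rewrite -!topredE /= -!(root_connect csym) (eqP (roots_root csym x)).
by apply: leq_sum => r /andP[rr _]; rewrite card_fiber.
Qed.

End LocallyConstant.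

Section Gluing.
Variables (B C : finType) (blk : C -> B) (sg : C -> C).

(** A letter is a corner with a side. The two sides of a corner carry the same
    black label, and the white labels of the corner and of its successor. *)
Definition white (l : C * bool) : C := if l.2 then sg l.1 else l.1.
Definition letters (J : {set B}) : {set C * bool} := [set l | blk l.1 \in J].

Implicit Types (V : {set {set C * bool}}).

Definition consistent (E F : finType) V (i : {ffun C -> E}) (a : {ffun C -> F}) : bool :=
  [forall P in V, forall x in P, forall y in P,
     (i (white x) == i (white y)) && (a x.1 == a y.1)].

Lemma consistentP (E F : finType) V (i : {ffun C -> E}) (a : {ffun C -> F}) :
  reflect (forall P x y, P \in V -> x \in P -> y \in P ->
     i (white x) = i (white y) /\ a x.1 = a y.1) (consistent V i a).
Proof.
apply: (iffP forall_inP) => [h P x y PV xP yP|h P PV].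
  by have /forall_inP/(_ x xP)/forall_inP/(_ y yP)/andP[/eqP -> /eqP ->] := h P PV.
apply/forall_inP => x xP; apply/forall_inP => y yP.
by have [-> ->] := h P x y PV xP yP; rewrite !eqxx.
Qed.

Definition glue (f : C * bool -> C) V : rel C :=
  fun c c' => [exists P in V, [exists x in P, [exists y in P, (f x == c) && (f y == c')]]].

Lemma glueP f V c c' :
  reflect (exists P x y, [/\ P \in V, x \in P, y \in P, f x = c & f y = c'])
    (glue f V c c').
Proof.
apply: (iffP exists_inP) => [[P PV /exists_inP[x xP /exists_inP[y yP /andP[/eqP <- /eqP <-]]]]|].
  by exists P, x, y; split.
move=> [P [x [y [PV xP yP <- <-]]]]; exists P => //.
by apply/exists_inP; exists x => //; apply/exists_inP; exists y => //; rewrite !eqxx.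
Qed.

Lemma glue_sym f V : symmetric (glue f V).
Proof.
move=> c c'; apply/glueP/glueP => -[P [x [y [PV xP yP e e']]]];
by exists P, y, x; split.
Qed.

Definition nwhite V := n_comp (glue white V) predT.
Definition nblack V := n_comp (glue fst V) predT.

(** Compatible labellings are the functions that are constant on the components
    of the glued graphs. *)
Lemma card_consistent (E F : finType) V :
  #|[set ia : {ffun C -> E} * {ffun C -> F} | consistent V ia.1 ia.2]| =
  #|E| ^ nwhite V * #|F| ^ nblack V.
Proof.
rewrite /nwhite /nblack.
rewrite -(card_locally_constant (glue_sym white V)) -(card_locally_constant (glue_sym fst V)).
rewrite -cardsX; congr #|pred_of_set _|; apply/setP => -[i a]; rewrite !inE /=.
apply/consistentP/andP => [h|[/forallP hi /forallP ha] P x y PV xP yP].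
  by split; apply/forallP => c; apply/forallP => c'; apply/implyP => /glueP;
    move=> [P [x [y [PV xP yP <- <-]]]]; apply/eqP; case: (h P x y PV xP yP).
split; apply/eqP.
  have /forallP/(_ (white y))/implyP := hi (white x); apply.
  by apply/glueP; exists P, x, y.
have /forallP/(_ y.1)/implyP := ha x.1; apply.
by apply/glueP; exists P, x, y.
Qed.

Hypothesis sg_inj : injective sg.
Hypothesis blk_sg : forall c, blk (sg c) = blk c.
Hypothesis sg_trans : forall c c', blk c = blk c' -> fconnect sg c c'.
Hypothesis blk_surj : forall j, exists c, blk c = j.

Definition adjacent V : rel B :=
  fun j k => [exists P in V, [exists x in P, [exists y in P, (blk x.1 == j) && (blk y.1 == k)]]].

Lemma adjacentP V j k :
  reflect (exists P x y, [/\ P \in V, x \in P, y \in P, blk x.1 = j & blk y.1 = k])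
    (adjacent V j k).
Proof.
apply: (iffP exists_inP) => [[P PV /exists_inP[x xP /exists_inP[y yP /andP[/eqP <- /eqP <-]]]]|].
  by exists P, x, y; split.
move=> [P [x [y [PV xP yP <- <-]]]]; exists P => //.
by apply/exists_inP; exists x => //; apply/exists_inP; exists y => //; rewrite !eqxx.
Qed.

Lemma adjacent_sym V : symmetric (adjacent V).
Proof.
move=> c c'; apply/adjacentP/adjacentP => -[P [x [y [PV xP yP e e']]]];
by exists P, y, x; split.
Qed.

(** Going once around a block each corner is met twice, so the
    differences across its letters add up to zero. *)
Lemma block_xor (i a : C -> bool) j :
  \big[addb/false]_(l : C * bool | blk l.1 == j) (i (white l) (+) a l.1) = false.
Proof.
have -> : \big[addb/false]_(l : C * bool | blk l.1 == j) (i (white l) (+) a l.1) =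
          \big[addb/false]_(c | blk c == j) \big[addb/false]_(b : bool) (i (white (c, b)) (+) a c).
  rewrite pair_big_dep /=; apply: eq_big => [[c b]|[c b] _] //=; by rewrite andbT.
under eq_bigr => c _ do rewrite big_bool /= /white /= addbACA addbb addbF.
rewrite big_split /= [X in X (+) _](_ : _ = \big[addb/false]_(c | blk c == j) i c) ?addbb //.
rewrite [RHS](reindex_inj sg_inj); apply: eq_bigl => c; by rewrite blk_sg.
Qed.

Section Bound.
Variable V : {set {set C * bool}}.
Hypothesis pV : pairing setT V.

Let adj := adjacent V.

(** A count over F_2. A compatible labelling is recovered from its white label
    at one corner of each root block of a spanning forest, together with the
    differences between its white and black labels on the pairs outside the
    forest: by [block_xor] the differences on the pairs of the forest follow,
    from the leaves to the roots, and then the labels, from the roots to the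
    leaves. *)
Lemma gluing_bound :
  nwhite V + nblack V + #|B| <= #|C| + n_comp adj predT * 2.
Proof.
have [dep [par forest]] := spanning_forest (@adjacent_sym V).
have [corner cornerP] := fin_all_exists blk_surj.
have tp_ex j : exists P, fingraph.root adj j != j -> exists x y,
    [/\ P = [set x; y], P \in V, blk x.1 = j & blk y.1 = par j].
  case: (boolP (fingraph.root adj j != j)) => [nr|_]; last by exists set0.
  have [/adjacentP[P [x [y [PV xP yP ex ey]]]] rp dp] := forest j nr.
  have [z xz eP] := pairing_pair pV PV xP.
  exists P => _; exists x, y; split=> //.
  move: yP; rewrite eP !inE => /orP[] /eqP e; last by rewrite e.
  by move: dp; rewrite -ey e ex ltnn.
have [tp tpP] := fin_all_exists tp_ex.
pose nonroots := [set j | fingraph.root adj j != j].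
pose tree := [set tp j | j in nonroots].
have tree_sub : tree \subset V.
  by apply/subsetP => P /imsetP[j]; rewrite inE => /tpP[x [y [_ ? _ _]]] ->.
have tp_inj : {in nonroots &, injective tp}.
  move=> j k; rewrite !inE => nj nk e.
  have [x [y [eP _ xj yj]]] := tpP j nj; have [z [w [eQ _ zk wk]]] := tpP k nk.
  have [_ _ dj] := forest j nj; have [_ _ dk] := forest k nk.
  have zx : z \in [set x; y] by rewrite -eP e eQ !inE eqxx.
  have wx : w \in [set x; y] by rewrite -eP e eQ !inE eqxx orbT.
  move: zx wx; rewrite !inE => /orP[] /eqP ezx /orP[] /eqP ewx.
  - by rewrite -xj -zk ezx.
  - by rewrite -xj -zk ezx.
  - move: dj dk; rewrite -wk -yj ewx xj -zk ezx.
    by move=> h1 h2; have := ltn_trans h1 h2; rewrite ltnn.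
  - by move: dk; rewrite -wk ewx -ezx zk ltnn.
have card_nr : #|nonroots| + n_comp adj predT = #|B|.
  rewrite -(cardC nonroots); congr (_ + _); apply: eq_card => j.
  by rewrite !inE andbT negbK.
have card_tree : #|tree| = #|nonroots| by apply: card_in_imset.
have card_V : #|V| = #|C|.
  have := card_pairing pV; rewrite cardsT card_prod card_bool.
  by move/eqP; rewrite eqn_pmul2r // => /eqP.
pose roots := [set j | fingraph.root adj j == j].
have card_roots : #|roots| = n_comp adj predT.
  by apply: eq_card => j; rewrite !inE andbT.
pose H := [set ia : {ffun C -> bool} * {ffun C -> bool} | consistent V ia.1 ia.2].
pose d (ia : {ffun C -> bool} * {ffun C -> bool}) l := ia.1 (white l) (+) ia.2 l.1.
pose code (ia : {ffun C -> bool} * {ffun C -> bool}) :=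
  ([set j in roots | ia.1 (corner j)],
   [set P in V :\: tree | [exists l in P, d ia l]]).
have code_inj : {in H &, injective code}.
  move=> u v; rewrite !inE => /consistentP cu /consistentP cv [/setP e1 /setP e2].
  pose x c := u.1 c (+) v.1 c; pose y c := u.2 c (+) v.2 c.
  have dP ia P l : consistent V ia.1 ia.2 -> P \in V -> l \in P ->
      [exists k in P, d ia k] = d ia l.
    move=> /consistentP c PV lP; apply/exists_inP/idP => [[k kP]|dl]; last by exists l.
    by rewrite /d; have [-> ->] := c P k l PV kP lP.
  have cP P k l : P \in V -> k \in P -> l \in P -> x (white k) = x (white l) /\ y k.1 = y l.1.
    move=> PV kP lP; rewrite /x /y.
    by have [-> ->] := cu P k l PV kP lP; have [-> ->] := cv P k l PV kP lP.
  pose D l := x (white l) (+) y l.1.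
  have DE l : D l = d u l (+) d v l by rewrite /D /x /y /d addbACA.
  have D_nontree P l : P \in V -> P \notin tree -> l \in P -> D l = false.
    move=> PV Pt lP; have := e2 P; rewrite !inE PV Pt /=.
    rewrite (dP u P l (introT (consistentP _ _ _) cu) PV lP).
    by rewrite (dP v P l (introT (consistentP _ _ _) cv) PV lP) DE => ->; rewrite addbb.
  have D_step j : j \in nonroots ->
      (forall j', j' \in nonroots -> dep j < dep j' -> forall l, l \in tp j' -> D l = false) ->
      forall l, l \in tp j -> D l = false.
    move=> nj IH; have nj' := nj; rewrite inE in nj'.
    have [k [k' [eP PV kj k'j]]] := tpP j nj'.
    have [_ _ dj] := forest j nj'.
    have kP : k \in tp j by rewrite eP !inE eqxx.
    suff Dk : D k = false by move=> l lP; rewrite -Dk /D; have [-> ->] := cP _ l k PV lP kP.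
    have := block_xor x y j; rewrite (bigD1 k) /=; last exact/eqP.
    rewrite big1 ?addbF // => l /andP[/eqP lj lk].
    have [P PV' lP] := pairing_ex pV (in_setT l).
    case: (boolP (P \in tree)) => [/imsetP[j' nj2 eP']|Pt]; last exact: (D_nontree P).
    have nj2' := nj2; rewrite inE in nj2'.
    have [z [z' [eQ _ zj z'j]]] := tpP j' nj2'.
    have [_ _ dj'] := forest j' nj2'.
    apply: (IH j' nj2); last by rewrite -eP'.
    move: (lP); rewrite eP' eQ !inE => /orP[] /eqP e; last by rewrite -lj e z'j.
    have e' : j' = j by rewrite -zj -e lj.
    exfalso; move: lP; rewrite eP' e' eP !inE (negbTE lk) /= => /eqP e3.
    by move: dj; rewrite -k'j -e3 lj ltnn.
  have D_tree n j : \max_k dep k - dep j <= n -> j \in nonroots ->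
      forall l, l \in tp j -> D l = false.
    elim: n j => [|n IH] j hn nj; apply: (D_step j nj) => j' nj' jj'.
      have h2 : dep j' <= \max_k dep k by exact: leq_bigmax.
      by move: hn; rewrite leqn0 subn_eq0 leqNgt (leq_trans jj' h2).
    apply: (IH j') => //; have h2 : dep j' <= \max_k dep k by exact: leq_bigmax.
    rewrite -ltnS; apply: leq_trans hn.
    by apply: ltn_sub2l => //; apply: leq_trans jj' h2.
  have D0 l : D l = false.
    have [P PV lP] := pairing_ex pV (in_setT l).
    case: (boolP (P \in tree)) => [/imsetP[j nj eP]|Pt]; last exact: (D_nontree P).
    by apply: (D_tree _ j (leqnn _) nj); rewrite -eP.
  have xy c : x c = y c by apply/eqP; rewrite -negb_add; exact: negbT (D0 (c, false)).
  have xsg c : x (sg c) = x c.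
    by rewrite [RHS]xy; apply/eqP; rewrite -negb_add; exact: negbT (D0 (c, true)).
  have xblk c c' : blk c = blk c' -> x c = x c'.
    move=> /sg_trans /(connect_const (f := x)); apply => a b /= /eqP <-.
    by rewrite xsg.
  have xwh l : x (white l) = x l.1.
    by apply: xblk; rewrite /white; case: l.2; rewrite ?blk_sg.
  have x_root j : fingraph.root adj j = j -> x (corner j) = false.
    by move=> rj; have := e1 j; rewrite !inE rj eqxx /= /x => ->; rewrite addbb.
  have x0 n j : dep j <= n -> x (corner j) = false.
    elim: n j => [|n IH] j hn; case: (eqVneq (fingraph.root adj j) j) => [/x_root //|nr];
      have [_ _ dj] := forest j nr; first by have := leq_trans dj hn.
    have [k [k' [eP PV kj k'j]]] := tpP j nr.
    rewrite -(IH (par j)); last by rewrite -ltnS; apply: leq_trans dj hn.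
    rewrite (xblk _ k.1) ?kj ?(cornerP j) //.
    rewrite [RHS](xblk _ k'.1) ?k'j ?(cornerP (par j)) //.
    by rewrite -!xwh; case: (cP _ k k' PV); rewrite ?eP ?inE ?eqxx ?orbT.
  have x00 c : x c = false.
    by rewrite (xblk _ _ (esym (cornerP (blk c)))) (x0 _ _ (leqnn _)).
  rewrite [u]surjective_pairing [v]surjective_pairing; congr (_, _); apply/ffunP => c.
    by apply/eqP; rewrite -negb_add; apply/negbT/x00.
  by apply/eqP; rewrite -negb_add; apply/negbT; rewrite -[LHS]/(y c) -xy.
have : #|H| <= #|setX (powerset roots) (powerset (V :\: tree))|.
  rewrite -(card_in_imset code_inj); apply/subset_leq_card/subsetP => p /imsetP[u _ ->].
  rewrite !inE /=; apply/andP; split; apply/subsetP => z; rewrite inE => /andP[] //.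
rewrite card_consistent cardsX !card_powerset card_bool -!expnD leq_exp2l //.
rewrite cardsD (setIidPr tree_sub) card_roots card_V card_tree -card_nr => h.
have nrC : #|nonroots| <= #|C| by rewrite -card_tree -card_V subset_leq_card.
by lia.
Qed.

Definition unlinked_block j := splits V (letters [set j]).

Lemma unlinked_blockPn j : reflect (exists2 k, k != j & adj j k) (~~ unlinked_block j).
Proof.
rewrite /unlinked_block; apply: (iffP idP) => [|[k kj /adjacentP[P [x [y [PV xP yP ex ey]]]]]].
  move=> /forall_inPn[P PV]; rewrite negb_or => /andP[/subsetPn[y yP yj] /pred0Pn[x /andP[xP xj]]].
  rewrite !inE in xj yj; exists (blk y.1) => //; apply/adjacentP.
  by exists P, x, y; split=> //; exact/eqP.
apply/splitsP => /(_ P PV)[/subsetP/(_ y yP)|/pred0P/(_ x)]; rewrite /= !inE.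
  by rewrite ey (negbTE kj).
by rewrite xP ex eqxx.
Qed.

Let connect2 j : ~~ unlinked_block j -> 1 < #|connect adj j|.
Proof.
move=> /unlinked_blockPn[k kj /connect1 jk]; rewrite (cardD1 j) -topredE /= connect0 ltnS.
by apply/card_gt0P; exists k; rewrite !inE kj.
Qed.

(** When no block is matched with itself, every component of the adjacency
    graph has at least two blocks. *)
Lemma gluing_le : (forall j, ~~ unlinked_block j) -> nwhite V + nblack V <= #|C|.
Proof.
move=> h; have := n_comp2 (@adjacent_sym V) (fun j => connect2 (h j)).
by have := gluing_bound; rewrite /adj; lia.
Qed.

(** The component of the block [j] has at least three blocks. *)
Lemma gluing_lt j : (forall j, ~~ unlinked_block j) ->
  (forall k, k != j -> ~~ splits V (letters [set j; k])) ->
  nwhite V + nblack V < #|C|.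
Proof.
move=> h hj.
have h3 : 2 < #|connect adj j|.
  have /unlinked_blockPn[k kj ajk] := h j; have := hj k kj.
  move=> /forall_inPn[P PV]; rewrite negb_or => /andP[/subsetPn[y yP yj] /pred0Pn[x /andP[xP xj]]].
  rewrite !inE negb_or in yj; case/andP: yj => yj yk.
  have axy : adj (blk x.1) (blk y.1) by apply/adjacentP; exists P, x, y; split.
  have jx : connect adj j (blk x.1).
    by move: xj; rewrite !inE => /orP[] /eqP ->; rewrite ?connect0 ?connect1.
  rewrite (cardD1 j) -topredE /= connect0 ltnS (cardD1 k) !inE kj connect1 //= ltnS.
  by apply/card_gt0P; exists (blk y.1); rewrite !inE yk yj; apply: connect_trans jx (connect1 axy).
have := n_comp2_lt (@adjacent_sym V) (fun j => connect2 (h j)) h3.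
by have := gluing_bound; rewrite /adj; lia.
Qed.

End Bound.
End Gluing.

(** * Expanding traces over labellings of corners *)

Import Order.TTheory GRing.Theory Num.Theory.
Local Open Scope ring_scope.

Section TraceExpansion.
Variables (A : pzRingType) (N : nat).
Implicit Types W : 'M[A]_N.

Fixpoint path_prod W (x : 'I_N) (t : seq 'I_N) (y : 'I_N) : A :=
  if t is z :: t' then W x z * path_prod W z t' y else W x y.

Lemma sum_tuple (I : finType) (V : nmodType) n (F : seq I -> V) :
  \sum_(t : n.+1.-tuple I) F t = \sum_x \sum_(t : n.-tuple I) F (x :: t).
Proof.
rewrite pair_big /= (reindex (fun p : I * n.-tuple I => cons_tuple p.1 p.2)) //=.
exists (fun t : n.+1.-tuple I => (thead t, behead_tuple t)) => [[x t] _|t _] /=.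
  by congr (_, _); apply: val_inj.
by rewrite [RHS]tuple_eta; apply: val_inj.
Qed.

Lemma expmx_path W n x y :
  (W ^+ n.+1) x y = \sum_(t : n.-tuple 'I_N) path_prod W x t y.
Proof.
elim: n x => [|n IH] x.
  rewrite expr1 (big_pred1 [tuple]) // => t; by rewrite [t]tuple0 /= eqxx.
rewrite exprS mxE (sum_tuple n (fun t => path_prod W x t y)); apply: eq_bigr => z _.
by rewrite IH mulr_sumr.
Qed.

Lemma path_prodE W x t y : path_prod W x t y =
  \prod_(r < (size t).+1) W (nth y (x :: t) r) (nth y (rcons t y) r).
Proof.
elim: t x => [|z t IH] x /=; first by rewrite big_ord_recl big_ord0 mulr1.
by rewrite big_ord_recl /= IH.
Qed.

(** The entries of the matrix need not commute: the product follows the closed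
    path, whose vertices are indexed cyclically by [ordS]. *)
Lemma trace_expmx W n :
  \tr (W ^+ n.+1) =
  \sum_(i : {ffun 'I_n.+1 -> 'I_N}) \prod_(r < n.+1) W (i r) (i (ordS r)).
Proof.
rewrite /mxtrace; under eq_bigr do rewrite expmx_path.
rewrite -(sum_tuple n (fun t => if t is x :: t' then path_prod W x t' x else 0)).
rewrite (reindex (fun i : {ffun 'I_n.+1 -> 'I_N} => [tuple i r | r < n.+1])) /=; last first.
  exists (fun t : n.+1.-tuple 'I_N => [ffun r => tnth t r]) => [i _|t _].
    by apply/ffunP => r; rewrite ffunE tnth_mktuple.
  by apply: eq_from_tnth => r; rewrite tnth_mktuple ffunE.
apply: eq_bigr => i _.
have nthE r x : nth x [seq i r | r <- enum 'I_n.+1] (nat_of_ord r) = i r.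
  by rewrite (nth_map ord0) ?size_enum_ord // nth_ord_enum.
have sz : size [seq i r | r <- enum 'I_n.+1] = n.+1 by rewrite size_map size_enum_ord.
case e : [seq i r | r <- enum 'I_n.+1] sz nthE => [//|x t] /= -[sz] nthE.
rewrite path_prodE sz; apply: eq_bigr => r _; rewrite nthE; congr (W _ _).
rewrite -(nthE (ordS r) x) nth_rcons sz /=.
have := ltn_ord r; rewrite ltnS leq_eqVlt => /orP[/eqP ->|lt].
  by rewrite ltnn eqxx modnn.
by rewrite lt modn_small.
Qed.

End TraceExpansion.

Section Distribution.
Variables (A : pzRingType) (m : nat) (s : 'I_m -> nat) (E F : finType).

Definition corner : finType := {j : 'I_m & 'I_(s j)}.
Definition labels k : finType := ({ffun 'I_k -> E} * {ffun 'I_k -> F})%type.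
Definition labelling : finType := ({ffun corner -> E} * {ffun corner -> F})%type.
Definition label_restr (u : labelling) j : labels (s j) :=
  ([ffun r => u.1 (Tagged (fun j => 'I_(s j)) r)],
   [ffun r => u.2 (Tagged (fun j => 'I_(s j)) r)]).

Let glue_labels (t : fprod (fun j : 'I_m => labels (s j))) : labelling :=
  ([ffun c => (t (tag c)).1 (tagged c)], [ffun c => (t (tag c)).2 (tagged c)]).
Let split_labels (u : labelling) : fprod (fun j : 'I_m => labels (s j)) :=
  [fprod j => label_restr u j].

Let split_labelsK : cancel split_labels glue_labels.
Proof.
by move=> [i a]; congr (_, _); apply/ffunP => -[j r]; rewrite ffunE /= fprodE ffunE.
Qed.

Let glue_labelsK : cancel glue_labels split_labels.
Proof.
move=> t; apply/fprodP => j; rewrite fprodE.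
by rewrite [RHS]surjective_pairing; congr (_, _); apply/ffunP => r; rewrite !ffunE.
Qed.

Lemma distr_labels (G : forall j, labels (s j) -> A) :
  \prod_(j < m) \sum_g G j g = \sum_(u : labelling) \prod_(j < m) G j (label_restr u j).
Proof.
rewrite [RHS](reindex glue_labels) /=; last first.
  by exists split_labels => t _; [exact: glue_labelsK | exact: split_labelsK].
under [RHS]eq_bigr => t _.
  under eq_bigr => j _.
    rewrite (_ : label_restr _ j = t j); last by rewrite -[in RHS](glue_labelsK t) fprodE.
    rewrite (_ : G j (t j) = [ffun g => G j g] (t j)); last by rewrite ffunE.
    over.
  over.
rewrite big_fprod.
pose Gt (j : 'I_m) (x : {j : 'I_m & labels (s j)}) : A := untag 0 [ffun g => G j g] x.
transitivity (\prod_(j < m) \sum_(x in tagged_with (fun j : 'I_m => labels (s j)) j) Gt j x); last first.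
  by rewrite (bigA_distr_big_dep (fun j => mem (tagged_with (fun j : 'I_m => labels (s j)) j)) Gt).
apply: eq_bigr => j _.
rewrite (big_tag (fun j => G j)); apply: eq_bigr => g _; rewrite /Gt /untag.
by case: eqP => // e; rewrite ffunE.
Qed.

Lemma card_labelling : #|labelling| = (\prod_(j < m) #|labels (s j)|)%N.
Proof.
rewrite -(card_fprod (fun j => labels (s j))).
apply: bij_eq_card; exact: Bijective split_labelsK glue_labelsK.
Qed.

End Distribution.

(** * The Wick formula for products of centred monomials *)

From mathcomp Require Import complex reals.
From mathcomp Require Import ring lra.
Local Open Scope complex_scope.

Section SplitsExtra.
Variable T : finType.
Implicit Types (V : {set {set T}}) (S : {set T}).

Lemma splitsU V1 V2 S : splits (V1 :|: V2) S = splits V1 S && splits V2 S.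
Proof.
apply/splitsP/andP => [h|[/splitsP h1 /splitsP h2] P].
  by split; apply/splitsP => P PV; apply: h; rewrite inE PV ?orbT.
by rewrite inE => /orP[/h1|/h2].
Qed.

Lemma splits_disjoint V S S1 : pairing S1 V -> [disjoint S1 & S] -> splits V S.
Proof.
move=> pV d; apply/splitsP => P /(pairing_sub pV) h; right; exact: disjointWl h d.
Qed.

Lemma pairing_disjoint V1 V2 S1 S2 : [disjoint S1 & S2] ->
  pairing S1 V1 -> pairing S2 V2 -> [disjoint V1 & V2].
Proof.
move=> d p1 p2; rewrite -setI_eq0; apply/eqP/setP => P; rewrite !inE.
apply/negP => /andP[P1 P2]; have /set0Pn[x xP] : P != finset.set0.
  by apply: contraTneq P1 => ->; rewrite (pairing_set0 p1).
have := subsetP (pairing_sub p2 P2) x xP.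
by rewrite (disjointFr d (subsetP (pairing_sub p1 P1) x xP)).
Qed.

End SplitsExtra.

(** Expansion of one centred factor, the others being kept as they are. *)
Lemma prod_center_at (F : comPzRingType) (A : algType F) (I : eqType) (r : seq I)
    (Q Q' : pred I) (G G1 : I -> A) (j : I) (c : F) :
  uniq r -> j \in r -> Q j -> G j = G1 j - c%:A ->
  (forall i, i != j -> G i = G1 i) -> (forall i, Q' i = Q i && (i != j)) ->
  \prod_(i <- r | Q i) G i = \prod_(i <- r | Q i) G1 i - c *: \prod_(i <- r | Q' i) G i.
Proof.
move=> ur jr Qj Gj Gi QQ'.
elim: r ur jr => // k r IH /= /andP[kr ur]; rewrite inE !big_cons QQ'.
case: (eqVneq j k) => [ejk|jk] /= jr; last first.
  rewrite andbT IH //; case: ifP => // _.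
  by rewrite Gi 1?eq_sym // mulrBr scalerAr.
subst k; rewrite Qj /= Gj mulrBl mulr_algl.
have nj i : i \in r -> i != j.
  by move=> ir; apply: contraNneq kr => <-.
congr (_ * _ - _ *: _).
  by rewrite [LHS]big_seq_cond [RHS]big_seq_cond; apply: eq_bigr => i /andP[ir _]; rewrite Gi // nj.
rewrite [LHS]big_seq_cond [RHS]big_seq_cond; apply: eq_bigl => i; rewrite QQ'.
by case: (boolP (i \in r)) => //= ir; rewrite nj ?andbT.
Qed.

Section Wick.
Variables (R : realType) (A : ncProbSpace R) (q : R) (I : Type) (X : I -> A).
Hypothesis hX : q_gaussian q X.
Variables (m : nat) (T : finType) (rho : T -> nat) (bl : T -> 'I_m) (word : 'I_m -> seq T).
Hypothesis mem_word : forall j x, (x \in word j) = (bl x == j).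
Hypothesis pairwise_word : forall j, pairwise (fun x y => (rho x < rho y)%N) (word j).
Hypothesis rho_bl : forall x y, (bl x < bl y)%N -> (rho x < rho y)%N.

Definition span (J : {set 'I_m}) : {set T} := [set x | bl x \in J].

Variables (Y : T -> I) (kappa : {set T} -> R[i]).
Hypothesis kappaE : forall x y, (rho x < rho y)%N ->
  tau A (X (Y x) * X (Y y)) = kappa [set x; y].

Definition weight (V : {set {set T}}) : R[i] :=
  (q%:C) ^+ ncross rho V * \prod_(P in V) kappa P.

Definition monomial j : A := \prod_(x <- word j) X (Y x).

Implicit Types (J Z : {set 'I_m}) (V : {set {set T}}).

Let words (J : {set 'I_m}) := flatten [seq word j | j <- enum 'I_m & j \in J].

Let pairwise_words (J : {set 'I_m}) : pairwise (fun x y => (rho x < rho y)%N) (words J).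
Proof.
rewrite /words; have : pairwise (fun i j : 'I_m => (i < j)%N) [seq j <- enum 'I_m | j \in J].
  apply: pairwise_filter.
  rewrite -(pairwise_map val (fun i j : nat => (i < j)%N)) val_enum_ord.
  by rewrite -sorted_pairwise ?iota_ltn_sorted //; apply: ltn_trans.
elim: (filter _ _) => //= j r IH /andP[aj pr].
rewrite pairwise_cat pairwise_word IH // !andbT /=.
apply/allrelP => x y; rewrite mem_word => /eqP bx /flattenP[w /mapP[k kr ->]].
rewrite mem_word => /eqP by_; apply: rho_bl; rewrite bx by_.
exact: (allP aj).
Qed.

Let mem_words (J : {set 'I_m}) : [set x in words J] = span J.
Proof.
apply/setP => x; rewrite !inE; apply/flattenP/idP => [[w /mapP[k]]|bJ].
  by rewrite mem_filter => /andP[kJ _] ->; rewrite mem_word => /eqP ->.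
exists (word (bl x)); last by rewrite mem_word.
by apply/mapP; exists (bl x); rewrite // mem_filter bJ mem_enum.
Qed.

Lemma tau_monomials (J : {set 'I_m}) :
  tau A (\prod_(j < m | j \in J) monomial j) = \sum_(V | pairing (span J) V) weight V.
Proof.
have -> : \prod_(j < m | j \in J) monomial j = \prod_(x <- words J) X (Y x).
  by rewrite /words big_flatten big_map big_filter /= [index_enum _]unlock -enumT.
have [_ /(_ _ (fun k => Y (tnth (in_tuple (words J)) k))) hq] := hX.
rewrite (big_tnth _ _ (words J)) hq -mem_words.
exact: (sum_pairing_seq (fun n => q%:C ^+ n) (pairwise_words J) kappaE).
Qed.

Lemma span_disjoint J1 J2 : [disjoint J1 & J2] -> [disjoint span J1 & span J2].
Proof.
rewrite -!setI_eq0 => /eqP/setP h; apply/eqP/setP => x; rewrite !inE.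
by have := h (bl x); rewrite !inE.
Qed.

Lemma spanD J1 J2 : span J1 :\: span J2 = span (J1 :\: J2).
Proof. by apply/setP => x; rewrite !inE. Qed.

Lemma spanS J1 J2 : J1 \subset J2 -> span J1 \subset span J2.
Proof. by move=> /subsetP h; apply/subsetP => x; rewrite !inE => /h. Qed.

(** No block of [J2] lies between two blocks of [J1]; then pairs inside [J1]
    and pairs inside [J2] do not cross. *)
Definition convex_in (J1 J2 : {set 'I_m}) :=
  forall i j k, i \in J1 -> j \in J1 -> k \in J2 -> ~ (i < k < j)%N.

Lemma ncross_span J1 J2 V1 V2 : [disjoint J1 & J2] -> convex_in J1 J2 ->
  pairing (span J1) V1 -> pairing (span J2) V2 ->
  ncross rho (V1 :|: V2) = (ncross rho V1 + ncross rho V2)%N.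
Proof.
move=> d h p1 p2; apply: ncrossU (span_disjoint d) p1 p2 _ => x y z.
rewrite !inE => x1 y1 z2 /andP[xz zy]; apply: (h _ _ _ x1 y1 z2).
have ne u : bl u \in J1 -> bl u != bl z.
  by move=> u1; apply: contraTneq z2 => <-; rewrite (disjointFr d u1).
have lt u v : (rho u < rho v)%N -> bl u != bl v -> (bl u < bl v)%N.
  move=> ruv; case: (ltngtP (bl u) (bl v)) => // [/rho_bl|/val_inj ->]; last by rewrite eqxx.
  by move=> /(ltn_trans ruv); rewrite ltnn.
by rewrite (lt x z) ?ne // (lt z y) // eq_sym ne.
Qed.

Lemma weightU J1 J2 V1 V2 : [disjoint J1 & J2] -> convex_in J1 J2 ->
  pairing (span J1) V1 -> pairing (span J2) V2 ->
  weight (V1 :|: V2) = weight V1 * weight V2.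
Proof.
move=> d h p1 p2; rewrite /weight (ncross_span d h p1 p2) exprD.
rewrite mulrACA -bigU /=; last exact: pairing_disjoint (span_disjoint d) p1 p2.
by congr (_ * _); apply: eq_bigl => P; rewrite !inE.
Qed.

Definition alone V j : bool := splits V (span [set j]).

(** Induction on the set of centred blocks: centring one more block subtracts
    the pairings in which it is alone. *)
Lemma tau_centered_aux (Z J : {set 'I_m}) : Z \subset J ->
  tau A (\prod_(j < m | j \in J)
           (if j \in Z then monomial j - (tau A (monomial j))%:A else monomial j)) =
  \sum_(V | pairing (span J) V && [forall j in Z, ~~ alone V j]) weight V.
Proof.
move: {2}(#|Z|) (erefl #|Z|) => n; elim: n Z J => [|n IH] Z J cZ ZJ.
  move: cZ => /eqP; rewrite cards_eq0 => /eqP ->.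
  under eq_bigr do rewrite inE; rewrite tau_monomials; apply: eq_bigl => V.
  by rewrite [X in _ = _ && X](_ : _ = true) ?andbT //; apply/forall_inP => j; rewrite inE.
have [j jZ] : exists j, j \in Z by apply/set0Pn; rewrite -cards_eq0 cZ.
have jJ := subsetP ZJ j jZ.
pose Z' := Z :\ j; pose J' := J :\ j.
have cZ' : #|Z'| = n by move: cZ; rewrite (cardsD1 j) jZ => -[].
have Z'J' : Z' \subset J' by apply: setSD.
have Z'J : Z' \subset J by apply: subset_trans Z'J' (subsetDl _ _).
rewrite (prod_center_at (Q' := fun i => i \in J')
  (G1 := fun i => if i \in Z' then monomial i - (tau A (monomial i))%:A else monomial i)
  (j := j) (c := tau A (monomial j))) ?index_enum_uniq ?mem_index_enum //; last first.
- by move=> i; rewrite !inE andbC.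
- by move=> i ij; rewrite !inE ij.
- by rewrite !inE eqxx jZ.
rewrite linearB linearZ /= (IH _ _ cZ' Z'J).
rewrite [X in _ - _ * tau A X](eq_bigr (fun i => if i \in Z' then monomial i - (tau A (monomial i))%:A else monomial i)); last first.
  by move=> i; rewrite !inE => /andP[-> _].
rewrite (IH _ _ cZ' Z'J').
have -> : tau A (monomial j) = \sum_(V | pairing (span [set j]) V) weight V.
  by rewrite -tau_monomials big_set1.
rewrite (bigID (fun V => alone V j)) /=.
rewrite [X in X + _ - _](_ : _ = \sum_(V | pairing (span J) V && splits V (span [set j]))
   (if [forall j0 in Z', ~~ alone V j0] then weight V else 0)); last first.
  rewrite -big_mkcondr; apply: eq_bigl => V; by rewrite andbAC.
rewrite sum_pairing_split; last by apply: spanS; rewrite sub1set.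
rewrite [X in X + _ - _](_ : _ = (\sum_(V | pairing (span [set j]) V) weight V) *
  (\sum_(V | pairing (span J') V && [forall j0 in Z', ~~ alone V j0]) weight V)); last first.
  rewrite mulr_suml; apply: eq_bigr => V1 p1; rewrite mulr_sumr [RHS]big_mkcondr /=.
  have dj : [disjoint [set j] & J'] by rewrite disjoints1 !inE eqxx.
  rewrite spanD; apply: eq_bigr => V2 p2.
  have -> : [forall j0 in Z', ~~ alone (V1 :|: V2) j0] = [forall j0 in Z', ~~ alone V2 j0].
    apply: eq_forallb => i; rewrite /alone splitsU.
    case: (boolP (i \in Z')) => //= iZ.
    rewrite (splits_disjoint p1) //.
    apply: span_disjoint; rewrite disjoints1 inE; apply: contraTneq iZ => <-; by rewrite !inE eqxx.
  case: ifP => // _; apply: weightU dj _ p1 p2.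
  by move=> a b c; rewrite !inE => /eqP -> /eqP -> _ /andP[h1 h2]; have := ltn_trans h1 h2; rewrite ltnn.
rewrite addrAC subrr add0r; apply: eq_bigl => V.
rewrite -andbA; congr (_ && _); apply/andP/forall_inP => [[/forall_inP h nj] i iZ|h].
  by case: (eqVneq i j) => [->//|ij]; apply: h; rewrite !inE ij.
split; last exact: h.
by apply/forall_inP => i; rewrite !inE => /andP[_ /h].
Qed.

Definition linked (J : {set 'I_m}) V := pairing (span J) V && [forall j in J, ~~ alone V j].

(** Centring a block removes exactly the pairings in which it is matched
    with itself: such a block crosses nothing, so its weight factors out. *)
Lemma tau_centered (J : {set 'I_m}) :
  tau A (\prod_(j < m | j \in J) (monomial j - (tau A (monomial j))%:A)) =
  \sum_(V | linked J V) weight V.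
Proof.
rewrite -(tau_centered_aux (subxx J)); congr (tau A _).
by apply: eq_bigr => j ->.
Qed.

End Wick.

(** * Mixed moments of centred traces at finite N *)

Section Necklace.
Variables (m : nat) (s : 'I_m -> nat).
Let C := corner s.

Definition next (c : C) : C := Tagged (fun j => 'I_(s j)) (ordS (tagged c)).

Lemma next_inj : injective next.
Proof.
apply: (can_inj (g := fun c : C => Tagged (fun j => 'I_(s j)) (ord_pred (tagged c)))).
by move=> [j r]; rewrite /next /= ordSK.
Qed.

Lemma tag_next c : tag (next c) = tag c.
Proof. by []. Qed.

Lemma next_trans (c c' : C) : tag c = tag c' -> fconnect next c c'.
Proof.
case: c c' => [j r] [k t] /= e; subst k.
have itn n : iter n next (Tagged (fun j => 'I_(s j)) r) = Tagged (fun j => 'I_(s j)) (iter n (@ordS _) r).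
  by elim: n => //= n ->.
have ito n : iter n (@ordS _) r = ((r + n) %% s j)%N :> nat.
  elim: n => [|n IH]; first by rewrite addn0 modn_small.
  by rewrite iterS /= IH -addn1 modnDml addn1 addnS.
suff e : iter (t + (s j - r)) next (Tagged (fun j => 'I_(s j)) r) = Tagged (fun j => 'I_(s j)) t.
  by rewrite -[X in fconnect _ _ X]e; exact: fconnect_iter.
rewrite itn; congr Tagged; apply: val_inj; rewrite /= ito.
have lr := ltn_ord r; rewrite (_ : (r + (t + (s j - r)) = t + s j)%N); last by lia.
by rewrite modnDr modn_small.
Qed.

Lemma tag_surj : (forall j, (0 < s j)%N) -> forall j, exists c : C, tag c = j.
Proof. by move=> h j; exists (Tagged (fun j => 'I_(s j)) (Ordinal (h j))). Qed.

(** Position of a letter when the necklaces are read one after the other; the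
    total length bounds the length of each necklace. *)
Definition letter_rank (l : C * bool) : nat :=
  ((tag l.1 * (\sum_j s j) + tagged l.1) * 2 + l.2)%N.

Definition necklace_word j : seq (C * bool) :=
  flatten [seq [:: (Tagged (fun j => 'I_(s j)) r, false);
                   (Tagged (fun j => 'I_(s j)) r, true)] | r <- enum 'I_(s j)].

Lemma mem_necklace_word j l : (l \in necklace_word j) = (tag l.1 == j).
Proof.
apply/flattenP/eqP => [[w /mapP[r _ ->]]|]; first by rewrite !inE => /orP[] /eqP ->.
case: l => [[k r] b] /= <-; exists [:: (Tagged (fun j => 'I_(s j)) r, false); (Tagged (fun j => 'I_(s j)) r, true)].
  by apply/mapP; exists r; rewrite ?mem_enum.
by rewrite !inE; case: b; rewrite eqxx ?orbT.
Qed.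

Lemma pairwise_necklace_word j :
  pairwise (fun x y => (letter_rank x < letter_rank y)%N) (necklace_word j).
Proof.
have : pairwise (fun a b : 'I_(s j) => (a < b)%N) (enum 'I_(s j)).
  rewrite -(pairwise_map val (fun i j : nat => (i < j)%N)) val_enum_ord.
  by rewrite -sorted_pairwise ?iota_ltn_sorted //; apply: ltn_trans.
rewrite /necklace_word; elim: (enum _) => //= r t IH /andP[hr /IH ->].
rewrite !andbT; apply/andP; split.
  rewrite /letter_rank /= addn0 addn1 ltnSn /=.
  apply/allP => l /flattenP[w /mapP[r' /(allP hr) rr' ->]]; rewrite !inE => /orP[] /eqP -> /=; lia.
apply/allP => l /flattenP[w /mapP[r' /(allP hr) rr' ->]].
by rewrite /letter_rank !inE => /orP[] /eqP -> /=; lia.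
Qed.

Lemma letter_rank_tag (x y : C * bool) :
  (tag x.1 < tag y.1)%N -> (letter_rank x < letter_rank y)%N.
Proof.
case: x y => [[j r] b] [[k t] c] /=; rewrite /letter_rank /= => jk.
have rj : (r < \sum_j s j)%N.
  by apply: leq_trans (ltn_ord r) _; rewrite (bigD1 j) //= leq_addr.
have : (j.+1 * (\sum_j s j) <= k * (\sum_j s j))%N by rewrite leq_mul2r jk orbT.
rewrite mulSn; move: rj; set S := (\sum_j s j)%N; move: (nat_of_ord r) => r'.
by move: (nat_of_ord t) (j * S)%N (k * S)%N => t' jS kS; case: b; case: c => /=; lia.
Qed.

End Necklace.

Section Model.
Variables (R : realType) (A : ncProbSpace R) (q : R) (N M : nat) (X : 'M[A]_(M, N)).
Hypothesis hX : q_gaussian q (fun ij : 'I_M * 'I_N => X ij.1 ij.2).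
Hypothesis hcov : forall (i k : 'I_M) (j m : 'I_N),
  tau A (X i j * X k m) = ((1%:M : 'M[R]_M) i k * ((N%:R^-1)%:M : 'M[R]_N) j m)%:C.

Definition wishart : 'M[A]_N := map_mx (@star R A) X^T *m X.
Definition wtrace k : A := \tr (wishart ^+ k).
Definition ctrace k : A := wtrace k - (tau A (wtrace k))%:A.

Definition label_word k (g : labels 'I_N 'I_M k) : A :=
  \prod_(r < k) (X (g.2 r) (g.1 r) * X (g.2 r) (g.1 (ordS r))).

Lemma wtrace_labels k : (0 < k)%N -> wtrace k = \sum_(g : labels 'I_N 'I_M k) label_word g.
Proof.
case: k => // k _; rewrite /wtrace trace_expmx.
rewrite -(pair_bigA _ (fun i a => label_word (i, a))) /=; apply: eq_bigr => i _.
rewrite -(bigA_distr_bigA (fun r a => X a (i r) * X a (i (ordS r)))).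
apply: eq_bigr => r _; rewrite !mxE; apply: eq_bigr => a _.
by rewrite !mxE; case: hX => /(_ (a, i r)) /= ->.
Qed.

Section Blocks.
Variables (m : nat) (s : 'I_m -> nat).
Hypothesis s_gt0 : forall j, (0 < s j)%N.
Notation C := (corner s).
Notation L := (labelling s 'I_N 'I_M).
Implicit Types (u : L) (V : {set {set C * bool}}) (J : {set 'I_m}).
Notation blk := (fun l : C * bool => tag l.1).

Definition index_of u (l : C * bool) : 'I_M * 'I_N := (u.2 l.1, u.1 (white (@next m s) l)).

(** Covariance of two letters as a function of the unordered pair that they
    form, as needed to weigh pairings. *)
Definition pair_moment u (P : {set C * bool}) : R[i] :=
  ((N%:R^-1 : R)%:C) * [forall x in P, forall y in P,
     (u.1 (white (@next m s) x) == u.1 (white (@next m s) y)) && (u.2 x.1 == u.2 y.1)]%:R.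

Lemma pair_momentE u x y :
  tau A (X (index_of u x).1 (index_of u x).2 * X (index_of u y).1 (index_of u y).2) =
  pair_moment u [set x; y].
Proof.
rewrite hcov /index_of /= !mxE /pair_moment.
have -> : [forall x0 in [set x; y], forall y0 in [set x; y],
     (u.1 (white (@next m s) x0) == u.1 (white (@next m s) y0)) && (u.2 x0.1 == u.2 y0.1)] =
   (u.1 (white (@next m s) x) == u.1 (white (@next m s) y)) && (u.2 x.1 == u.2 y.1).
  apply/idP/idP => [/forall_inP/(_ x)|h].
    by rewrite !inE eqxx => /(_ isT)/forall_inP/(_ y); rewrite !inE eqxx orbT; apply.
  apply/forall_inP => a; rewrite !inE => /orP[] /eqP ->; apply/forall_inP => b;
    rewrite !inE => /orP[] /eqP -> //; rewrite ?eqxx //.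
  by case/andP: h => /eqP -> /eqP ->; rewrite !eqxx.
case: eqP => _; case: eqP => _; rewrite ?mul1r ?mul0r ?mulr0n ?mulr1n ?mulr0 ?mulr1 ?andbF ?andbT //.
Qed.

Lemma monomial_label_word u j :
  monomial (fun ij : 'I_M * 'I_N => X ij.1 ij.2) (@necklace_word m s) (index_of u) j =
  label_word (label_restr u j).
Proof.
rewrite /monomial /necklace_word big_flatten big_map /label_word /=.
rewrite [index_enum _]unlock -enumT; apply: eq_bigr => r _.
by rewrite big_cons big_seq1 /label_restr /index_of /= !ffunE.
Qed.

Notation linked := (linked (fun l : C * bool => tag l.1)).
Notation spn J := (span (fun l : C * bool => tag l.1) J).

Lemma tau_label_words u J :
  tau A (\prod_(j < m | j \in J)
     (label_word (label_restr u j) - (tau A (label_word (label_restr u j)))%:A)) =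
  \sum_(V | linked J V)
     (q ^+ ncross (@letter_rank m s) V * N%:R ^- #|V|)%:C *+ consistent (@next m s) V u.1 u.2.
Proof.
have h := tau_centered hX (@mem_necklace_word m s) (@pairwise_necklace_word m s)
  (@letter_rank_tag m s) (fun x y _ => pair_momentE u x y) J.
under eq_bigr do rewrite -monomial_label_word.
rewrite h; apply: eq_bigr => V _; rewrite /weight.
rewrite big_split /= prodr_const -natr_prod rmorphM /= -[RHS]mulr_natr -[RHS]mulrA rmorphXn /=.
rewrite -exprVn rmorphXn /=.
congr (_ * (_ * _%:R)).
rewrite /consistent; case: (boolP [forall P in V, _]) => [/forall_inP h1|/forall_inPn[P PV h1]].
  by rewrite big1 // => P /h1 ->.
by rewrite (bigD1 P) //= (negbTE h1) mul0n.
Qed.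

Definition nconsistent V : nat :=
  #|[set u : L | consistent (@next m s) V u.1 u.2]|.

Definition nlabels J : nat := \prod_(j in J) #|labels 'I_N 'I_M (s j)|.

Lemma prod_or_scalar (I : eqType) (r : seq I) (Q : pred I) (G : I -> A) (c : I -> R[i]) :
  \prod_(i <- r) (if Q i then G i else (c i)%:A) =
  (\prod_(i <- r | ~~ Q i) c i) *: \prod_(i <- r | Q i) G i.
Proof.
elim: r => [|k r IH]; first by rewrite !big_nil scale1r.
rewrite !big_cons IH; case: (Q k) => /=; first by rewrite scalerAr.
by rewrite mulr_algl scalerA.
Qed.

Lemma ctrace_labels j : ctrace (s j) = \sum_(g : labels 'I_N 'I_M (s j))
   (label_word g - (tau A (label_word g))%:A).
Proof.
rewrite /ctrace (wtrace_labels (s_gt0 j)) sumrB; congr (_ - _).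
by rewrite raddf_sum scaler_suml.
Qed.

(** The sum runs over labellings of all blocks, which accounts for the factor
    counting the labels of the blocks that do not occur. *)
Lemma tau_ctraces_aux J :
  (nlabels (~: J))%:R * tau A (\prod_(j < m | j \in J) ctrace (s j)) =
  \sum_(V | linked J V) (q ^+ ncross (@letter_rank m s) V * N%:R ^- #|V| * (nconsistent V)%:R)%:C.
Proof.
transitivity (\sum_(u : L) tau A (\prod_(j < m | j \in J)
     (label_word (label_restr u j) - (tau A (label_word (label_restr u j)))%:A))).
  rewrite -raddf_sum /=.
  pose G j (g : labels 'I_N 'I_M (s j)) : A :=
    if j \in J then label_word g - (tau A (label_word g))%:A else 1.
  rewrite [X in _ = tau A X](_ : _ = \sum_(u : L) \prod_(j < m) G j (label_restr u j)); last first.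
    by apply: eq_bigr => u _; rewrite big_mkcond.
  rewrite -distr_labels.
  rewrite [X in _ = tau A X](eq_bigr (fun j => if j \in J then ctrace (s j) else (#|labels 'I_N 'I_M (s j)|%:R)%:A)); last first.
    move=> j _; rewrite /G; case: (j \in J); first by rewrite ctrace_labels.
    by rewrite scaler_nat (eq_bigl (mem predT)) // sumr_const.
  rewrite prod_or_scalar linearZ /= natr_prod; congr (_ * _); apply: eq_bigl => j; by rewrite inE.
under eq_bigr do rewrite tau_label_words.
rewrite exchange_big; apply: eq_bigr => V _.
rewrite sumrMnr -[LHS]mulr_natr [in RHS]rmorphM /= rmorph_nat; congr (_ * _%:R).
by rewrite /nconsistent -sum1_card [RHS]big_mkcond /=; apply: eq_bigr => u _; rewrite inE; case: (consistent _ _ _ _).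
Qed.

End Blocks.
End Model.

Section LinkedPairings.
Variables (m : nat) (T : finType) (bl : T -> 'I_m).
Implicit Types (V : {set {set T}}) (J : {set 'I_m}).

Lemma span_mem J x : (x \in span bl J) = (bl x \in J).
Proof. by rewrite inE. Qed.

Lemma sum_linked_split (U : nmodType) J1 J2 (F : {set {set T}} -> U) :
  [disjoint J1 & J2] ->
  \sum_(V | linked bl (J1 :|: J2) V && splits V (span bl J1)) F V =
  \sum_(V1 | linked bl J1 V1) \sum_(V2 | linked bl J2 V2) F (V1 :|: V2).
Proof.
move=> d; have d' : [disjoint J2 & J1] by rewrite disjoint_sym.
transitivity (\sum_(V | pairing (span bl (J1 :|: J2)) V && splits V (span bl J1))
   (if [forall j in J1 :|: J2, ~~ alone bl V j] then F V else 0)).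
  by rewrite -big_mkcondr; apply: eq_bigl => V; rewrite /linked andbAC.
rewrite sum_pairing_split; last by apply: spanS; apply: subsetUl.
rewrite spanD (_ : (J1 :|: J2) :\: J1 = J2); last first.
  by rewrite setDUl setDv set0U; apply/setDidPl.
rewrite [RHS]big_mkcondr; apply: eq_bigr => V1 p1.
case: (boolP [forall j in J1, ~~ alone bl V1 j]) => h1.
  rewrite [RHS]big_mkcondr; apply: eq_bigr => V2 p2; congr (if _ then _ else _).
  apply/forall_inP/forall_inP => h j jJ.
    have := h j; rewrite inE jJ orbT /alone splitsU negb_and => /(_ isT) /orP[|//].
    by rewrite (splits_disjoint p1) // span_disjoint // disjoint_sym disjoints1 (disjointFr d').
  rewrite /alone splitsU negb_and; move: jJ; rewrite inE => /orP[jJ|/h ->]; last by rewrite orbT.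
  by rewrite (forall_inP h1 j jJ).
apply: big1 => V2 p2; case: ifP => // /forall_inP h.
case/negP: h1; apply/forall_inP => j jJ; have := h j.
rewrite inE jJ /alone splitsU negb_and => /(_ isT) /orP[//|].
by rewrite (splits_disjoint p2) // span_disjoint // disjoint_sym disjoints1 (disjointFr d).
Qed.

Lemma splits_pair_uniq V (i j k : 'I_m) : j != k -> ~~ alone bl V i ->
  splits V (span bl [set i; j]) -> splits V (span bl [set i; k]) -> false.
Proof.
move=> jk /negP ni /splitsP sj /splitsP sk; case: ni; apply/splitsP => P PV.
have sub l : span bl [set i] \subset span bl [set i; l].
  by apply: spanS; rewrite sub1set !inE eqxx.
case: (sj P PV) => [Pj|d]; last by right; apply: disjointWr (sub j) d.
case: (sk P PV) => [Pk|d]; last by right; apply: disjointWr (sub k) d.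
left; apply/subsetP => x xP; rewrite span_mem inE.
have := subsetP Pj x xP; have := subsetP Pk x xP; rewrite !span_mem !inE.
by case/orP => [//|/eqP ->]; rewrite [k == j]eq_sym (negbTE jk) orbF.
Qed.

(** In a pairing without isolated blocks at most one block is matched with
    the block [i] only. *)
Lemma sum_linked_partner (U : zmodType) (i : 'I_m) (F : {set {set T}} -> U) :
  \sum_(V | linked bl setT V) F V =
  \sum_(j | j != i) \sum_(V | linked bl setT V && splits V (span bl [set i; j])) F V +
  \sum_(V | linked bl setT V && [forall j, (j != i) ==> ~~ splits V (span bl [set i; j])]) F V.
Proof.
under [X in X + _]eq_bigr do rewrite big_mkcondr.
rewrite exchange_big [X in _ + X]big_mkcondr -big_split; apply: eq_bigr => V lV /=.
have ni : ~~ alone bl V i by case/andP: lV => _ /forall_inP; apply; rewrite inE.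
rewrite -big_mkcondr.
case: (boolP [forall j, _]) => [/forallP h|/forallPn[j]].
  by rewrite big_pred0 ?add0r // => j; apply/negP => /andP[ji]; apply/negP; exact: implyP (h j) ji.
rewrite negb_imply negbK => /andP[ji sj].
rewrite addr0 (big_pred1 j) // => k /=; apply/andP/eqP => [[ki sk]|->//].
apply/eqP/negPn/negP => kj; have jk : j != k by rewrite eq_sym.
by have := splits_pair_uniq jk ni sj sk.
Qed.

(** If the first block is matched with the block [j], a pair leaving the set of
    blocks in between must cross one of their pairs. *)
Lemma ncross_gt0 (rho : T -> nat) V (i j : 'I_m) :
  (forall x y, (bl x < bl y)%N -> (rho x < rho y)%N) ->
  (forall k : 'I_m, (i <= k)%N) -> (i < j)%N -> linked bl setT V ->
  splits V (span bl [set i; j]) ->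
  ~~ splits V (span bl [set k : 'I_m | (i < k < j)%N]) -> (0 < ncross rho V)%N.
Proof.
move=> hrho hi ij /andP[pV /forall_inP lV] /splitsP sj.
have /forall_inPn[P PV] := lV i (in_setT i).
rewrite negb_or => /andP[/subsetPn[v vP vi] /pred0Pn[u /andP[uP ui]]].
rewrite /= !span_mem !inE in vi ui.
have {}uP : u \in P := uP.
have uv : u != v by apply: contraNneq vi => <-.
have eP : P = [set u; v].
  have [w uw e] := pairing_pair pV PV uP; move: vP; rewrite e !inE => /orP[] /eqP e'.
    by rewrite e' eqxx in uv.
  by rewrite e'.
have vj : bl v = j.
  case: (sj P PV) => [/subsetP/(_ v vP)|/pred0P/(_ u)].
    by rewrite span_mem !inE (negbTE vi) => /eqP.
  by rewrite /= uP span_mem !inE ui.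
move=> /forall_inPn[Q QV]; rewrite negb_or => /andP[/subsetPn[y yQ yb] /pred0Pn[x /andP[xQ xb]]].
rewrite /= !span_mem !inE in yb xb; case/andP: xb => ix xj.
have {}xQ : x \in Q := xQ.
have xy : x != y by apply: contraNneq yb => <-; rewrite ix xj.
have eQ : Q = [set x; y].
  have [w xw e] := pairing_pair pV QV xQ; move: yQ; rewrite e !inE => /orP[] /eqP e'.
    by rewrite e' eqxx in xy.
  by rewrite e'.
have jy : (j < bl y)%N.
  case: (sj Q QV) => [/subsetP/(_ x xQ)|/pred0P/(_ y)].
    rewrite span_mem !inE => /orP[] /eqP e; first by rewrite e ltnn in ix.
    by rewrite e ltnn in xj.
  rewrite /= yQ span_mem !inE => /negbT; rewrite negb_or => /andP[yi yj].
  rewrite ltn_neqAle eq_sym yj /= leqNgt; apply: contra yb => ->; rewrite andbT.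
  by rewrite ltn_neqAle eq_sym yi hi.
apply/ncrossP; exists u, x, v, y; rewrite -eP -eQ; split=> //; apply: hrho.
- by rewrite (eqP ui).
- by rewrite vj.
- by rewrite vj.
Qed.

Definition matched J V :=
  linked bl J V && [forall j in J, exists k in J :\ j, splits V (span bl [set j; k])].

(** Choose the partner of the first block, then one of at most [D] pairings of
    the letters of these two blocks. *)
Fixpoint matched_bound (D n : nat) : nat :=
  match n with 0 => 1 | 1 => 0 | k.+2 => k.+1 * D * matched_bound D k end.

Lemma card_matched (d : nat) J : (forall j, #|span bl [set j]| <= d)%N ->
  (#|[set V | matched J V]| <= matched_bound (2 ^ 2 ^ d.*2) #|J|)%N.
Proof.
move=> hd; move: {2}(#|J|) (leqnn #|J|) => n; elim: n J => [|n IH] J.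
  rewrite leqn0 cards_eq0 => /eqP ->; rewrite cards0 /=.
  rewrite -(cards1 (finset.set0 : {set {set T}})); apply/subset_leq_card/subsetP => V.
  rewrite !inE => /andP[/andP[pV _] _]; apply/eqP/setP => P; rewrite inE.
  apply/negP => PV; have := pairing_sub pV PV.
  rewrite (_ : span bl finset.set0 = finset.set0) ?subset0; last by apply/setP => x; rewrite !inE.
  by move=> /eqP e; have := pairing_set0 pV; rewrite -e PV.
move=> cJ; have [e0|/set0Pn[j jJ]] := eqVneq J finset.set0.
  by apply: IH; rewrite e0 cards0.
set D := (2 ^ 2 ^ d.*2)%N.
have step k : k \in J :\ j ->
  (#|[set V | matched J V && splits V (span bl [set j; k])]| <=
     D * #|[set V | matched (J :\: [set j; k]) V]|)%N.
  move=> kJ; have dJ : [disjoint [set j; k] & J :\: [set j; k]].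
    by rewrite -setI_eq0 setIDA setIC -setIDA setDv setI0.
  have eJ : J = [set j; k] :|: (J :\: [set j; k]).
    apply/setP => i; rewrite !inE; case: (eqVneq i j) => [->//|_] /=.
    by case: (eqVneq i k) => [->|_] //=; move: kJ; rewrite !inE => /andP[_ ->].
  have -> : #|[set V | matched J V && splits V (span bl [set j; k])]| =
     (\sum_(V | linked bl J V && splits V (span bl [set j; k]))
        [forall j in J, exists k in J :\ j, splits V (span bl [set j; k])])%N.
    rewrite -sum1_card [RHS]big_mkcond [LHS]big_mkcond; apply: eq_bigr => V _; rewrite inE /matched.
    by case: (linked bl J V); case: (splits V _); rewrite /= ?andbT ?andbF //; case: [forall j in J, _].
  rewrite {1}eJ sum_linked_split //.
  apply: (@leq_trans (\sum_(V1 | linked bl [set j; k] V1) #|[set V | matched (J :\: [set j; k]) V]|)).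
    apply: leq_sum => V1 /andP[p1 _]; rewrite -sum1_card big_mkcond [X in (_ <= X)%N]big_mkcond.
    apply: leq_sum => V2 _; rewrite inE /matched; case: (boolP (linked bl _ V2)) => //= lV2.
    case: (boolP [forall i in J, _]) => // /forall_inP h.
    suff -> : [forall i in J :\: [set j; k], exists k0 in (J :\: [set j; k]) :\ i,
       splits V2 (span bl [set i; k0])] by [].
    apply/forall_inP => i iJ; have /h/exists_inP[l] : i \in J by move: iJ; rewrite inE => /andP[].
    rewrite !inE splitsU => /andP[li lJ] /andP[_ sl].
    case: (boolP (l \in [set j; k])) => ljk; last first.
      by apply/exists_inP; exists l; rewrite // !inE li lJ andbT; rewrite !inE in ljk.
    case/andP: lV2 => p2 /forall_inP/(_ i iJ)/negP; case.
    apply/splitsP => P PV; have PJ := pairing_sub p2 PV.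
    have nl x : x \in P -> bl x != l.
      by move=> /(subsetP PJ); rewrite span_mem inE => /andP[+ _]; apply: contraNneq => ->.
    case: (elimT (splitsP _ _) sl P PV) => [/subsetP h1|/pred0P h1]; [left|right].
      apply/subsetP => x xP; have := h1 x xP; rewrite !span_mem !inE.
      by rewrite (negbTE (nl x xP)) orbF.
    apply/pred0P => x; have := h1 x; rewrite /= !span_mem !inE.
    by case: (x \in P) => //=; case: (bl x == i).
  rewrite sum_nat_const leq_mul2r; apply/orP; right.
  apply: (@leq_trans #|powerset (powerset (span bl [set j; k]))|).
    apply/subset_leq_card/subsetP => V1 lV1; rewrite inE; apply/subsetP => P PV.
    by case/andP: lV1 => p1 _; rewrite inE (pairing_sub p1 PV).
  rewrite !card_powerset leq_exp2l // leq_exp2l //.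
  have -> : span bl [set j; k] = span bl [set j] :|: span bl [set k].
    by apply/setP => x; rewrite !inE.
  by apply: leq_trans (leq_card_setU _ _) _; rewrite -addnn leq_add.
have := cardsD1 j J; rewrite jJ add1n => cJj.
apply: (@leq_trans (\sum_(k in J :\ j) D * #|[set V | matched (J :\: [set j; k]) V]|)).
  apply: (@leq_trans (\sum_(k in J :\ j) #|[set V | matched J V && splits V (span bl [set j; k])]|)); last exact: leq_sum.
  under eq_bigr do rewrite -sum1_card big_mkcond.
  rewrite exchange_big -sum1_card big_mkcond; apply: leq_sum => V _; rewrite inE.
  case: (boolP (matched J V)) => // mV.
  have [k kJ sk] : exists2 k, k \in J :\ j & splits V (span bl [set j; k]).
    by case/andP: (mV) => _ /forall_inP/(_ j jJ)/exists_inP.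
  by rewrite (bigD1 k) //= inE mV sk.
have cJk k : k \in J :\ j -> #|J| = (#|J :\: [set j; k]|).+2.
  move=> kJ; rewrite cJj (cardsD1 k (J :\ j)) kJ; congr (_.+2); apply: eq_card => i.
  by rewrite !inE negb_or andbA [(i != k) && _]andbC.
case eJj : #|J :\ j| => [|p].
  rewrite (eq_bigl pred0) ?big_pred0 // => k.
  by move/eqP: eJj; rewrite cards_eq0 => /eqP ->; rewrite inE.
rewrite cJj eJj /= -eJj -mulnA -sum_nat_const; apply: leq_sum => k kJ.
rewrite leq_mul2l; apply/orP; right.
have e : #|J :\: [set j; k]| = p by have := cJk k kJ; rewrite cJj eJj => -[].
by rewrite -e; apply: IH; rewrite e; move: cJ; rewrite cJj eJj; lia.
Qed.

Lemma matched_bound_le D n : (matched_bound D n.*2 * n`! <= D ^ n * (n.*2)`!)%N.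
Proof.
elim: n => [//|n IH]; rewrite doubleS /= !factS expnS.
have : (matched_bound D n.*2 * n`! * (n.*2.+1 * D * n.+1) <= D ^ n * (n.*2)`! * (n.*2.+1 * D * n.*2.+2))%N.
  by rewrite leq_mul // leq_mul // -addnn; lia.
have -> : (matched_bound D n.*2 * n`! * (n.*2.+1 * D * n.+1) =
  n.*2.+1 * D * matched_bound D n.*2 * (n.+1 * n`!))%N by ring.
by have -> : (D ^ n * (n.*2)`! * (n.*2.+1 * D * n.*2.+2) =
  D * D ^ n * (n.*2.+2 * (n.*2.+1 * (n.*2)`!)))%N by ring.
Qed.

End LinkedPairings.

Section Independence.
Variables (N M m : nat) (s : 'I_m -> nat).
Notation C := (corner s).
Notation L := (labelling s 'I_N 'I_M).
Implicit Types (V : {set {set C * bool}}) (J : {set 'I_m}).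
Notation bl := (fun l : C * bool => tag l.1).

Lemma tag_white (l : C * bool) : tag (white (@next m s) l) = tag l.1.
Proof. by rewrite /white; case: l.2. Qed.

Definition mix J (u v : L) : L :=
  ([ffun c => if tag c \in J then u.1 c else v.1 c],
   [ffun c => if tag c \in J then u.2 c else v.2 c]).

Lemma consistentU V1 V2 (u : L) :
  consistent (@next m s) (V1 :|: V2) u.1 u.2 =
  consistent (@next m s) V1 u.1 u.2 && consistent (@next m s) V2 u.1 u.2.
Proof.
apply/forall_inP/andP => [h|[/forall_inP h1 /forall_inP h2] P].
  by split; apply/forall_inP => P PV; apply: h; rewrite inE PV ?orbT.
by rewrite inE => /orP[/h1|/h2].
Qed.

Lemma consistent_local J V (u v : L) : pairing (span bl J) V ->
  (forall c : C, tag c \in J -> u.1 c = v.1 c /\ u.2 c = v.2 c) ->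
  consistent (@next m s) V u.1 u.2 = consistent (@next m s) V v.1 v.2.
Proof.
move=> pV uv; apply: eq_forallb => P; case: (boolP (P \in V)) => //= PV.
have inJ x : x \in P -> tag x.1 \in J.
  by move=> /(subsetP (pairing_sub pV PV)); rewrite inE.
apply: eq_forallb => x; case: (boolP (x \in P)) => //= xP.
apply: eq_forallb => y; case: (boolP (y \in P)) => //= yP.
have wJ z : z \in P -> tag (white (@next m s) z) \in J by rewrite tag_white; exact: inJ.
have [-> _] := uv _ (wJ x xP); have [-> _] := uv _ (wJ y yP).
by have [_ ->] := uv _ (inJ x xP); have [_ ->] := uv _ (inJ y yP).
Qed.

(** For independent uniform labels, consistency with pairings of disjoint
    sets of blocks are independent events. *)
Lemma nconsistentU J1 J2 V1 V2 : [disjoint J1 & J2] ->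
  pairing (span bl J1) V1 -> pairing (span bl J2) V2 ->
  (nconsistent N M V1 * nconsistent N M V2 = nconsistent N M (V1 :|: V2) * #|L|)%N.
Proof.
move=> d p1 p2.
have dn c : c \in J2 -> c \in J1 = false by move=> c2; rewrite (disjointFl d c2).
pose f (p : L * L) := (mix J1 p.1 p.2, mix J1 p.2 p.1).
have fK : involutive f.
  move=> [[i a] [i' a']]; rewrite /f /mix /=; congr ((_, _), (_, _)); apply/ffunP => c;
  by rewrite !ffunE /= ?ffunE; case: (tag c \in J1).
rewrite -cardsX -cardsT -cardsX -(card_imset _ (inv_inj fK)); congr #|pred_of_set _|.
apply/setP => -[u v]; rewrite (can_imset_pre _ fK) !inE /= andbT consistentU.
rewrite (@consistent_local J1 V1 (mix J1 u v) u) //; last first.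
  by move=> c cJ; rewrite !ffunE cJ.
rewrite (@consistent_local J2 V2 (mix J1 v u) u) //.
by move=> c cJ; rewrite !ffunE dn.
Qed.

Lemma nlabels_setC J : (nlabels N M s J * nlabels N M s (~: J) = #|L|)%N.
Proof.
rewrite card_labelling /nlabels [RHS](bigID (mem J)) /=; congr (_ * _)%N.
by apply: eq_bigl => j; rewrite inE.
Qed.

Lemma nlabels_setU J1 J2 : [disjoint J1 & J2] ->
  (nlabels N M s (J1 :|: J2) = nlabels N M s J1 * nlabels N M s J2)%N.
Proof.
move=> d; rewrite /nlabels -bigU //; apply: eq_bigl => j; by rewrite !inE.
Qed.

Section PairingWeight.
Variables (R : realType) (q : R).

Definition pweight V : R :=
  q ^+ ncross (@letter_rank m s) V * N%:R ^- #|V| * (nconsistent N M V)%:R.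

(** Both conditions make the crossing weight multiplicative: it is constant for
    [q = 1], and there is no crossing between the two parts otherwise. *)
Lemma pweightU J1 J2 V1 V2 : [disjoint J1 & J2] -> q = 1 \/ convex_in J1 J2 ->
  pairing (span bl J1) V1 -> pairing (span bl J2) V2 ->
  pweight V1 * pweight V2 = #|L|%:R * pweight (V1 :|: V2).
Proof.
move=> d h p1 p2; rewrite /pweight.
have -> : q ^+ ncross (@letter_rank m s) (V1 :|: V2) =
    q ^+ ncross (@letter_rank m s) V1 * q ^+ ncross (@letter_rank m s) V2.
  case: h => [->|h]; first by rewrite !expr1n mulr1.
  by rewrite -exprD -(ncross_span (@letter_rank_tag m s) d h p1 p2).
rewrite cardsU (_ : V1 :&: V2 = finset.set0) ?cards0 ?subn0; last first.
  by apply/disjoint_setI0; apply: pairing_disjoint (span_disjoint _ d) p1 p2.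
rewrite exprD invfM mulrACA [X in _ * X = _](_ : _ = (nconsistent N M V1 * nconsistent N M V2)%:R); last by rewrite natrM.
rewrite (nconsistentU d p1 p2) natrM.
move: (nconsistent N M (V1 :|: V2))%:R (#|L|%:R : R) => x y.
by move: (q ^+ _) (q ^+ _) (N%:R ^- _) (N%:R ^- _) => a b c e; ring.
Qed.

Lemma sum_pweight_mul J1 J2 (Q : pred {set {set C * bool}}) :
  [disjoint J1 & J2] -> q = 1 \/ convex_in J1 J2 ->
  (forall V1 V2, linked bl J1 V1 -> linked bl J2 V2 -> Q (V1 :|: V2) = Q V2) ->
  (\sum_(V | linked bl J1 V) pweight V) * (\sum_(V | linked bl J2 V && Q V) pweight V) =
  #|L|%:R * \sum_(V | [&& linked bl (J1 :|: J2) V, splits V (span bl J1) & Q V]) pweight V.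
Proof.
move=> d h hQ.
transitivity (#|L|%:R * \sum_(V | linked bl (J1 :|: J2) V && splits V (span bl J1))
   (if Q V then pweight V else 0)); last first.
  by rewrite -big_mkcondr; congr (_ * _); apply: eq_bigl => V; rewrite andbA.
rewrite sum_linked_split // mulr_suml mulr_sumr; apply: eq_bigr => V1 l1.
rewrite big_mkcondr !mulr_sumr; apply: eq_bigr => V2 l2.
rewrite hQ //; case: (Q V2); rewrite ?mulr0 //.
by case/andP: l1 => p1 _; case/andP: l2 => p2 _; rewrite (pweightU d).
Qed.

Lemma sum_pweight_mul2 J1 J2 : [disjoint J1 & J2] -> q = 1 \/ convex_in J1 J2 ->
  (\sum_(V | linked bl J1 V) pweight V) * (\sum_(V | linked bl J2 V) pweight V) =
  #|L|%:R * \sum_(V | linked bl (J1 :|: J2) V && splits V (span bl J1)) pweight V.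
Proof.
move=> d h.
transitivity ((\sum_(V | linked bl J1 V) pweight V) *
    (\sum_(V | linked bl J2 V && predT V) pweight V)).
  by congr (_ * _); apply: eq_bigl => V; rewrite andbT.
rewrite sum_pweight_mul //; congr (_ * _); apply: eq_bigl => V; by rewrite andbT.
Qed.

End PairingWeight.
End Independence.

Section Recursion.
Variables (R : realType) (A : ncProbSpace R) (q : R) (N M : nat) (X : 'M[A]_(M, N)).
Hypothesis N_gt0 : (0 < N)%N.
Hypothesis hX : q_gaussian q (fun ij : 'I_M * 'I_N => X ij.1 ij.2).
Hypothesis hcov : forall (i k : 'I_M) (j m : 'I_N),
  tau A (X i j * X k m) = ((1%:M : 'M[R]_M) i k * ((N%:R^-1)%:M : 'M[R]_N) j m)%:C.

Section Blocks.
Variables (m : nat) (s : 'I_m -> nat).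
Hypothesis s_gt0 : forall j, (0 < s j)%N.
Notation C := (corner s).
Notation L := (labelling s 'I_N 'I_M).
Implicit Types (V : {set {set C * bool}}) (J : {set 'I_m}).
Notation bl := (fun l : C * bool => tag l.1).

Definition tau_blocks J : R[i] := tau A (\prod_(j < m | j \in J) ctrace X (s j)).

Lemma tau_blocksE J :
  (nlabels N M s (~: J))%:R * tau_blocks J = (\sum_(V | linked bl J V) pweight N M q V)%:C.
Proof.
by rewrite (tau_ctraces_aux hX hcov s_gt0) raddf_sum.
Qed.

Lemma tau_blocksT : tau_blocks setT = (\sum_(V | linked bl setT V) pweight N M q V)%:C.
Proof.
by rewrite -tau_blocksE setCT /nlabels big_set0 mul1r.
Qed.

Hypothesis M_gt0 : (0 < M)%N.

Let nlabels_neq0 J : (nlabels N M s J)%:R != 0 :> R[i].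
Proof.
rewrite pnatr_eq0 -lt0n prodn_gt0 // => j.
by rewrite card_prod !card_ffun !card_ord muln_gt0 !expn_gt0 N_gt0 M_gt0.
Qed.

Let cardL_neq0 : #|L|%:R != 0 :> R[i].
Proof. by rewrite -(nlabels_setC N M s finset.set0) natrM mulf_neq0. Qed.

Let complex_mul (x y z w : R) : x * y = z * w -> x%:C * y%:C = z%:C * w%:C.
Proof. by move=> e; rewrite -!rmorphM /= e. Qed.

Let complex_nat n : (n%:R : R)%:C = n%:R.
Proof. by rewrite rmorph_nat. Qed.

Lemma tau_blocks_mul J1 J2 : [disjoint J1 & J2] -> J1 :|: J2 = setT ->
  q = 1 \/ convex_in J1 J2 ->
  tau_blocks J1 * tau_blocks J2 =
  (\sum_(V | linked bl setT V && splits V (span bl J1)) pweight N M q V)%:C.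
Proof.
move=> d hT h; apply: (mulfI cardL_neq0).
have e1 : ~: J1 = J2.
  apply/setP => j; have /setP/(_ j) := hT; rewrite !inE.
  by case: (boolP (j \in J1)) => [j1 _|]; rewrite ?(disjointFr d j1).
have e2 : ~: J2 = J1 by rewrite -e1 setCK.
have := @sum_pweight_mul2 N M m s R q J1 J2 d h.
move/complex_mul; rewrite hT -!tau_blocksE complex_nat e1 e2 => <-.
rewrite -(nlabels_setC N M s J1) e1 natrM.
move: (nlabels N M s J1)%:R (nlabels N M s J2)%:R (tau_blocks J1) (tau_blocks J2) => a b x y.
by ring.
Qed.

(** Used when [J2] is the first block with its partner, [J1] the blocks in
    between and [J3] the blocks after. *)
Lemma tau_blocks_mul3 J1 J2 J3 : [disjoint J1 & J3] -> [disjoint J2 & J1 :|: J3] ->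
  J2 :|: (J1 :|: J3) = setT -> convex_in J1 J3 -> convex_in J2 (J1 :|: J3) ->
  tau_blocks J1 * tau_blocks J2 * tau_blocks J3 =
  (\sum_(V | [&& linked bl setT V, splits V (span bl J2) & splits V (span bl J1)])
      pweight N M q V)%:C.
Proof.
move=> d13 d2 hT c13 c2; apply: (mulfI (mulf_neq0 cardL_neq0 cardL_neq0)).
have h1 := @sum_pweight_mul2 N M m s R q J1 J3 d13 (or_intror c13).
have h2 : forall V1 V2 : {set {set C * bool}}, linked bl J2 V1 -> linked bl (J1 :|: J3) V2 ->
   splits (V1 :|: V2) (span bl J1) = splits V2 (span bl J1).
  move=> V1 V2 /andP[p1 _] _; rewrite splitsU (splits_disjoint p1) //.
  by apply: span_disjoint; apply: disjointWr d2; apply: subsetUl.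
have {h2} := @sum_pweight_mul N M m s R q J2 _ (fun V => splits V (span bl J1)) d2 (or_intror c2) h2.
move: h1; rewrite hT => /complex_mul h1 /complex_mul.
move: h1; rewrite -!tau_blocksE complex_nat => h1 h2.
rewrite -[RHS]mulrA -h2 [RHS]mulrCA -h1.
have -> : (#|L|%:R : R[i]) * (#|L|%:R) * (tau_blocks J1 * tau_blocks J2 * tau_blocks J3) =
  #|L|%:R * #|L|%:R * (tau_blocks J1 * tau_blocks J3) * tau_blocks J2 by move: (#|L|%:R) (tau_blocks _) (tau_blocks _) (tau_blocks _) => a x y z; ring.
have e2 : ~: J2 = J1 :|: J3.
  apply/setP => j; have /setP/(_ j) := hT; rewrite [in X in X -> _]inE in_setC in_setT.
  by case: (boolP (j \in J2)) => [j2 _|_ /= ->] //; rewrite (disjointFr d2 j2).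
have e1 : ~: J1 = J2 :|: J3.
  apply/setP => j; have /setP/(_ j) := hT; have d2' : [disjoint J1 & J2].
    by rewrite disjoint_sym; apply: disjointWr d2; apply: subsetUl.
  rewrite !inE; case: (boolP (j \in J1)) => [j1 _|_ /= ->] //.
  by rewrite (disjointFr d2' j1) (disjointFr d13 j1).
have e3 : ~: J3 = J1 :|: J2.
  apply/setP => j; have /setP/(_ j) := hT; have d2' : [disjoint J3 & J2].
    by rewrite disjoint_sym; apply: disjointWr d2; apply: subsetUr.
  rewrite !inE; case: (boolP (j \in J3)) => [j3 _|_ /=]; last by rewrite orbF orbC => ->.
  by rewrite (disjointFl d13 j3) (disjointFr d2' j3).
have d12 : [disjoint J1 & J2] by rewrite disjoint_sym; apply: disjointWr d2; apply: subsetUl.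
have d23 : [disjoint J2 & J3] by apply: disjointWr d2; apply: subsetUr.
rewrite e1 e2 e3 -(nlabels_setC N M s J2) e2 !nlabels_setU // !natrM.
move: (nlabels N M s J1)%:R (nlabels N M s J2)%:R (nlabels N M s J3)%:R => a b c.
by move: (tau_blocks J1) (tau_blocks J2) (tau_blocks J3) => x y z; ring.
Qed.

End Blocks.
End Recursion.

Section OrderedProducts.
Variable A : pzRingType.

Lemma prod_take (g : nat -> A) l j : (j <= size l)%N ->
  \prod_(i < size l | (i < j)%N) g (nth 0%N l i) = \prod_(k <- take j l) g k.
Proof.
move=> jl; rewrite -(big_mkord (fun i => (i < j)%N) (fun i => g (nth 0%N l i))).
rewrite (big_cat_nat (n := j)) //= [X in _ * X]big_nat_cond [X in _ * X]big_pred0 ?mulr1; last first.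
  by move=> i; rewrite (ltnNge i j); case: (j <= i)%N; rewrite /= ?andbF.
rewrite [RHS](big_nth 0%N) size_take_min (minn_idPl jl) [LHS]big_nat_cond [RHS]big_nat_cond.
apply: eq_big => i; first by rewrite andbT -andbA andbb.
by move=> /andP[_ ij]; rewrite nth_take.
Qed.

Lemma prod_drop (g : nat -> A) l j : (j < size l)%N ->
  \prod_(i < size l | (j < i)%N) g (nth 0%N l i) = \prod_(k <- drop j.+1 l) g k.
Proof.
move=> jl; rewrite -(big_mkord (fun i => (j < i)%N) (fun i => g (nth 0%N l i))).
rewrite (big_cat_nat (n := j.+1)) //= [X in X * _]big_nat_cond [X in X * _]big_pred0 ?mul1r; last first.
  by move=> i; rewrite ltnS (ltnNge j i); case: (i <= j)%N; rewrite /= ?andbF.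
rewrite -{1}[j.+1]add0n big_addn [RHS](big_nth 0%N) size_drop.
rewrite [LHS]big_nat_cond [RHS]big_nat_cond; apply: eq_big => i.
  by rewrite addnS ltnS leq_addl !andbT.
by move=> _; rewrite nth_drop addnC.
Qed.

Lemma prod_except (g : nat -> A) l j : (j < size l)%N ->
  \prod_(i < size l | (i != j :> nat)) g (nth 0%N l i) =
  \prod_(k <- take j l ++ drop j.+1 l) g k.
Proof.
move=> jl; rewrite big_cat -prod_take ?(ltnW jl) // -prod_drop //.
pose F i := g (nth 0%N l i).
rewrite -(big_mkord (fun i => i != j) F) -(big_mkord (fun i => (i < j)%N) F).
rewrite -(big_mkord (fun i => (j < i)%N) F).
have jl' := ltnW jl; rewrite (big_cat_nat (n := j)) //=.
rewrite [X in _ = X * _](big_cat_nat (n := j)) //= [X in _ = _ * X](big_cat_nat (n := j)) //=.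
rewrite [X in _ = _ * X * _]big_nat_cond [X in _ = _ * X * _]big_pred0 ?mulr1; last first.
  by move=> i; rewrite (ltnNge i j); case: (j <= i)%N; rewrite /= ?andbF.
rewrite [X in _ = _ * (X * _)]big_nat_cond [X in _ = _ * (X * _)]big_pred0 ?mul1r; last first.
  by move=> i; case: (ltngtP i j); rewrite /= ?andbF.
by congr (_ * _); rewrite [LHS]big_nat_cond [RHS]big_nat_cond; apply: eq_bigl => i;
  case: (ltngtP i j); rewrite /= ?andbF.
Qed.

End OrderedProducts.

Section BlockSets.
Variables (A : pzRingType) (n : nat) (G : nat -> A) (j : 'I_n).

Lemma prod_block_pair :
  \prod_(i < n.+1 | i \in [set ord0; lift ord0 j]) G i = G 0%N * G j.+1.
Proof.
rewrite big_mkcond big_ord_recl !inE eqxx /=; congr (_ * _).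
rewrite -big_mkcond /= (big_pred1 j) //= => i; rewrite !inE.
by rewrite (inj_eq (@lift_inj _ ord0)).
Qed.

Lemma prod_block_pairC :
  \prod_(i < n.+1 | i \in ~: [set ord0; lift ord0 j]) G i =
  \prod_(i < n | (i != j :> nat)) G i.+1.
Proof.
rewrite big_mkcond big_ord_recl !inE eqxx /= mul1r [RHS]big_mkcond; apply: eq_bigr => i _.
by rewrite !inE (inj_eq (@lift_inj _ ord0)).
Qed.

Lemma prod_block_between :
  \prod_(i < n.+1 | i \in [set k : 'I_n.+1 | (@ord0 n < k < lift ord0 j)%N]) G i =
  \prod_(i < n | (i < j)%N) G i.+1.
Proof.
rewrite big_mkcond big_ord_recl !inE ltnn /= mul1r [RHS]big_mkcond; apply: eq_bigr => i _.
by rewrite !inE.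
Qed.

Lemma prod_block_after :
  \prod_(i < n.+1 | i \in [set k : 'I_n.+1 | (@lift n.+1 ord0 j < k)%N]) G i =
  \prod_(i < n | (j < i)%N) G i.+1.
Proof.
rewrite big_mkcond big_ord_recl !inE /= mul1r [RHS]big_mkcond; apply: eq_bigr => i _.
by rewrite !inE.
Qed.

End BlockSets.

Section ListRecursion.
Variables (R : realType) (q : R).

Definition block_lengths (l : seq nat) : 'I_(size l) -> nat := fun i => nth 0%N l i.
Notation bl := (fun x => tag x.1).

Definition centered_moment (N M : nat) (l : seq nat) : R :=
  \sum_(V | linked (fun x : corner (@block_lengths l) * bool => tag x.1) setT V) pweight N M q V.

(** The pairings in which the first block is not matched with a single block:
    they disappear in the limit. *)
Definition unpaired (k : nat) (l : seq nat)
    (V : {set {set corner (@block_lengths (k :: l)) * bool}}) :=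
  linked bl setT V &&
  [forall j : 'I_(size l).+1, (j != ord0) ==> ~~ splits V (span bl [set ord0; j])].

Definition unpaired_moment (N M k : nat) (l : seq nat) : R :=
  \sum_(V | @unpaired k l V) pweight N M q V.

Variables (A : ncProbSpace R) (N M : nat) (X : 'M[A]_(M, N)).
Hypothesis N_gt0 : (0 < N)%N.
Hypothesis hX : q_gaussian q (fun ij : 'I_M * 'I_N => X ij.1 ij.2).
Hypothesis hcov : forall (i k : 'I_M) (j m : 'I_N),
  tau A (X i j * X k m) = ((1%:M : 'M[R]_M) i k * ((N%:R^-1)%:M : 'M[R]_N) j m)%:C.

Definition list_moment (l : seq nat) : R[i] := tau A (\prod_(k <- l) ctrace X k).

Let pos (l : seq nat) := all (fun k => 0 < k)%N l.

Let block_lengths_gt0 l : pos l -> forall i, (0 < @block_lengths l i)%N.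
Proof. by move=> /allP h i; apply: h; rewrite mem_nth. Qed.

Lemma list_momentE l : pos l -> list_moment l = (centered_moment N M l)%:C.
Proof.
move=> pl; rewrite -(tau_blocksT hX hcov (block_lengths_gt0 pl)).
rewrite /tau_blocks /list_moment (big_nth 0%N) big_mkord; congr (tau A _).
by apply: eq_bigl => i; rewrite inE.
Qed.

Let ctrace0 k : (0 < k)%N -> M = 0%N -> ctrace X k = 0.
Proof.
move=> k0 M0; rewrite /ctrace (wtrace_labels hX k0) big_pred0 ?raddf0 ?scale0r ?subr0 //.
move=> [i a]; exfalso; case: (a (Ordinal k0)) => r; by rewrite {1}M0.
Qed.

Let list_moment0 k l : (0 < k)%N -> M = 0%N -> list_moment (k :: l) = 0.
Proof. by move=> k0 M0; rewrite /list_moment big_cons ctrace0 // mul0r raddf0. Qed.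

Let unpaired0 k l : pos (k :: l) -> M = 0%N -> unpaired_moment N M k l = 0.
Proof.
move=> pl M0; apply: big1 => V _; rewrite /pweight /nconsistent.
rewrite (_ : [set u | _] = finset.set0) ?cards0 ?mulr0 //.
apply/setP => -[i a]; exfalso.
case: (a (Tagged (fun j => 'I_(@block_lengths (k :: l) j)) (Ordinal (block_lengths_gt0 pl ord0)))) => r.
by rewrite {1}M0.
Qed.

Section OneStep.
Variables (k : nat) (l : seq nat).
Hypothesis pkl : pos (k :: l).
Let bkl := block_lengths_gt0 pkl.
Let G i := ctrace X (nth 0%N (k :: l) i).

Let tau_pair (j : 'I_(size l)) : tau_blocks X (@block_lengths (k :: l)) [set ord0; lift ord0 j] =
  list_moment [:: k; nth 0%N l j].
Proof.
by rewrite /tau_blocks (prod_block_pair G) /list_moment big_cons big_seq1.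
Qed.

Let tau_pairC (j : 'I_(size l)) : tau_blocks X (@block_lengths (k :: l)) (~: [set ord0; lift ord0 j]) =
  list_moment (take j l ++ drop j.+1 l).
Proof.
by rewrite /tau_blocks (prod_block_pairC G) (prod_except (ctrace X)).
Qed.

Let tau_between (j : 'I_(size l)) : tau_blocks X (@block_lengths (k :: l))
    [set i : 'I_(size l).+1 | (@ord0 (size l) < i < lift ord0 j)%N] = list_moment (take j l).
Proof.
by rewrite /tau_blocks (prod_block_between G) (prod_take (ctrace X)) // ltnW.
Qed.

Let tau_after (j : 'I_(size l)) : tau_blocks X (@block_lengths (k :: l))
    [set i : 'I_(size l).+1 | (@lift (size l).+1 ord0 j < i)%N] = list_moment (drop j.+1 l).
Proof.
by rewrite /tau_blocks (prod_block_after G) (prod_drop (ctrace X)).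
Qed.

Let sum_lift (F : 'I_(size l).+1 -> R) :
  \sum_(j | j != ord0) F j = \sum_(j < size l) F (lift ord0 j).
Proof.
by rewrite big_mkcond big_ord_recl /= add0r; apply: eq_bigr => j _.
Qed.

(** For [q = 1] the weight factors over the first block with its partner and
    the remaining blocks. *)
Lemma list_moment_rec1 : q = 1 ->
  list_moment (k :: l) =
  \sum_(j < size l) list_moment [:: k; nth 0%N l j] * list_moment (take j l ++ drop j.+1 l)
  + (unpaired_moment N M k l)%:C.
Proof.
move=> q1; have k0 : (0 < k)%N by case/andP: pkl.
have [M0|M_gt0] := posnP M.
  rewrite list_moment0 // unpaired0 // addr0 big1 // => j _.
  by rewrite list_moment0 // mul0r.
rewrite list_momentE // /centered_moment (sum_linked_partner _ (ord0 : 'I_(size l).+1)) rmorphD /=; congr (_ + _).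
rewrite sum_lift rmorph_sum; apply: eq_bigr => j _.
rewrite -tau_pair -tau_pairC (tau_blocks_mul N_gt0 hX hcov bkl M_gt0) ?setUCr //; last by left.
by rewrite -setI_eq0 setICr.
Qed.

(** For [q = 0] a crossing pairing has weight zero, so the blocks between the
    first one and its partner are matched among themselves. *)
Lemma list_moment_rec0 : q = 0 ->
  list_moment (k :: l) =
  \sum_(j < size l) list_moment [:: k; nth 0%N l j] * list_moment (take j l)
    * list_moment (drop j.+1 l)
  + (unpaired_moment N M k l)%:C.
Proof.
move=> q0; have k0 : (0 < k)%N by case/andP: pkl.
have [M0|M_gt0] := posnP M.
  rewrite list_moment0 // unpaired0 // addr0 big1 // => j _.
  by rewrite list_moment0 // !mul0r.
rewrite list_momentE // /centered_moment (sum_linked_partner _ (ord0 : 'I_(size l).+1)) rmorphD /=; congr (_ + _).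
rewrite sum_lift rmorph_sum; apply: eq_bigr => j _.
rewrite -tau_pair -tau_between -tau_after (tau_blocks_mul3 N_gt0 hX hcov bkl M_gt0).
- congr (_%:C).
  rewrite [LHS](bigID (fun V => splits V (span bl [set i : 'I_(size l).+1 | (@ord0 (size l) < i < lift ord0 j)%N]))) /=.
  rewrite [X in _ + X]big1 ?addr0; last first.
    move=> V /andP[/andP[lV sV] nV]; rewrite /pweight q0 expr0n.
    have := @ncross_gt0 _ _ _ (@letter_rank _ _) V (ord0 : 'I_(size l).+1) (lift ord0 j) (@letter_rank_tag _ _) leq0n isT lV sV nV.
    by rewrite lt0n => /negbTE ->; rewrite !mul0r.
  by apply: eq_bigl => V; rewrite -andbA; congr (_ && _); rewrite andbC.
- rewrite -setI_eq0; apply/eqP/setP => i; rewrite !inE.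
  by apply/negP => /andP[/orP[] /eqP ->]; rewrite ?ltnn.
- rewrite -setI_eq0; apply/eqP/setP => i; rewrite !inE.
  apply/negP => /andP[/andP[h1 h2] /orP[/orP[]/eqP e|h3]].
  + by rewrite e ltnn in h1.
  + by rewrite e ltnn in h2.
  + by have := ltn_trans h2 h3; rewrite ltnn.
- apply/setP => i; rewrite !inE -!val_eqE /= /bump /=.
  by case: (nat_of_ord i) => [|i'] //=; case: (ltngtP i'.+1 (1 + j)).
- move=> a b c; rewrite !inE => _ /orP[] /eqP -> h /andP[_ h2].
    by move: h2; rewrite /= ltn0.
  by have := ltn_trans h h2; rewrite ltnn.
- move=> a b c; rewrite !inE => /andP[a1 a2] /andP[b1 b2] /orP[/orP[] /eqP ->|h] /andP[h1 h2].
  + by move: h1; rewrite /= ltn0.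
  + by have := ltn_trans h2 b2; rewrite ltnn.
  + by have := ltn_trans (ltn_trans h h2) b2; rewrite ltnn.
Qed.

End OneStep.
End ListRecursion.

Local Close Scope complex_scope.

(** * Gaussian quadrature *)

Section Hermitian.
Local Open Scope sesquilinear_scope.
Variable C : numClosedFieldType.

Lemma hermitian_diagonalization n (A : 'M[C]_n) : A^t* = A ->
  exists (U : 'M[C]_n) (d : 'rV[C]_n),
    [/\ U *m U^t* = 1%:M, U^t* *m U = 1%:M, forall i, d 0 i \is Num.real
      & A = U^t* *m diag_mx d *m U].
Proof.
move=> hA; have herm : A \is hermsymmx.
  by apply/is_hermitianmxP; rewrite expr0 scale1r hA.
exists (spectralmx A), (spectral_diag A).
have Uu := spectral_unitarymx A; split.
- exact/unitarymxP.
- by rewrite -invmx_unitary // mulVmx // unitarymx_unit.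
- by move=> i; have /mxOverP := hermitian_spectral_diag_real herm; apply.
- by rewrite -invmx_unitary //; apply/orthomx_spectralP/hermitian_normalmx.
Qed.

Lemma trmxCM m n p (A : 'M[C]_(m, n)) (B : 'M[C]_(n, p)) : (A *m B)^t* = B^t* *m A^t*.
Proof. by rewrite trmx_mul map_mxM. Qed.

Lemma posdef_factor n (H : 'M[C]_n) : H^t* = H ->
  (forall c : 'rV[C]_n, c != 0 -> 0 < (c *m H *m c^t*) 0 0) ->
  exists2 B : 'M[C]_n, B \in unitmx & H = B *m B^t*.
Proof.
move=> hH pos; have [U [d [UU UU' dr eH]]] := hermitian_diagonalization hH.
have UHU : U *m H *m U^t* = diag_mx d.
  by rewrite eH !mulmxA UU mul1mx -mulmxA UU mulmx1.
have d0 i : 0 < d 0 i.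
  have c0 : row i U != 0.
    apply/eqP => c0; have /(congr1 (row i)) := UU; rewrite row_mul c0 mul0mx.
    by move=> /rowP/(_ i); rewrite !mxE eqxx => /esym/eqP; rewrite oner_eq0.
  have := pos _ c0; congr (0 < _).
  have := congr1 (fun X : 'M_n => X i i) UHU; rewrite [in RHS]mxE eqxx mulr1n => <-.
  by rewrite -row_mul mxE [RHS]mxE; apply: eq_bigr => k _; rewrite !mxE.
pose r : 'rV[C]_n := \row_i sqrtC (d 0 i).
have rr : map_mx Num.conj r = r.
  apply/rowP => i; rewrite !mxE; apply/CrealP/ger0_real.
  by rewrite sqrtC_ge0 ltW.
have r2 : diag_mx r *m diag_mx r = diag_mx d.
  by rewrite mulmx_diag; congr diag_mx; apply/rowP => i; rewrite !mxE -expr2 sqrtCK.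
exists (U^t* *m diag_mx r); last first.
  by rewrite trmxCM trmxCK tr_diag_mx map_diag_mx rr mulmxA -[_ *m diag_mx r *m diag_mx r]mulmxA r2.
rewrite unitmx_mul; apply/andP; split; first by case/mulmx1_unit: UU'.
rewrite unitmxE det_diag unitfE; apply/prodf_neq0 => i _.
by rewrite mxE sqrtC_eq0 gt_eqF.
Qed.

(** Gaussian quadrature: a strictly positive Hankel form is, up to any given
    order, the moment sequence of finitely many atoms. The nodes are the
    eigenvalues of multiplication by the variable, compressed to the
    polynomials of bounded degree. *)
Lemma gauss_quadrature n (h : nat -> C) :
  (forall k, h k \is Num.real) ->
  (forall c : 'rV[C]_n.+1, c != 0 ->
     0 < (c *m (\matrix_(i < n.+1, j < n.+1) h (i + j)%N) *m c^t*) 0 0) ->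
  exists (w x : 'I_n.+1 -> C),
    [/\ forall i, 0 <= w i, forall i, x i \is Num.real
      & forall k, (k <= n)%N -> \sum_i w i * x i ^+ k = h k].
Proof.
move=> hr; set H := \matrix_(i, j) _ => pos.
pose S : 'M[C]_n.+1 := \matrix_(i, j) h (i + j).+1.
have hankel_herm (g : nat -> C) : (forall k, g k \is Num.real) ->
    (\matrix_(i < n.+1, j < n.+1) g (i + j)%N)^t* = \matrix_(i, j) g (i + j)%N.
  by move=> gr; apply/matrixP => i j; rewrite !mxE addnC; apply/CrealP.
have Hh : H^t* = H by exact: hankel_herm.
have Sh : S^t* = S by exact: (hankel_herm (fun k => h k.+1)).
have [B Bu eH] := posdef_factor Hh pos.
have trV : (invmx B)^t* = invmx (B^t*) by rewrite trmx_inv map_invmx.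
pose A := invmx B *m S *m (invmx B)^t*.
have Ah : A^t* = A by rewrite /A !trmxCM trmxCK Sh mulmxA.
pose b (k : nat) : 'rV[C]_n.+1 := row (inord k) B.
have bS k : (k < n)%N -> b k *m A = b k.+1.
  move=> kn; have kn' : (k < n.+1)%N by apply: ltnW.
  have rS : row (inord k) S = row (inord k.+1) H.
    by apply/rowP => j; rewrite !mxE !inordK.
  rewrite /A !mulmxA /b -row_mul mulmxV // row1 -rowE rS eH row_mul trV -mulmxA.
  by rewrite mulmxV ?mulmx1 // map_unitmx unitmx_tr.
have bA k : (k <= n)%N -> b 0%N *m A ^+ k = b k.
  elim: k => [|k IH] kn; first by rewrite expr0 mulmx1.
  by rewrite exprSr mulmxA IH ?bS // ltnW.
have [U [d [UU UU' dr eA]]] := hermitian_diagonalization Ah.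
have Apow k : A ^+ k = U^t* *m diag_mx (\row_i (d 0 i ^+ k)) *m U.
  elim: k => [|k IH].
    rewrite expr0 (_ : \row_i _ = const_mx 1) ?diag_const_mx ?mulmx1 ?UU' //.
    by apply/rowP => i; rewrite !mxE expr0.
  rewrite exprSr IH [in X in _ * X = _]eA -[_ * _]/(_ *m _) !mulmxA.
  rewrite -[_ *m U *m U^t*]mulmxA UU mulmx1 -[_ *m diag_mx _ *m diag_mx _]mulmxA mulmx_diag.
  by congr (_ *m diag_mx _ *m _); apply/rowP => i; rewrite !mxE exprSr.
pose v := b 0%N *m U^t*.
exists (fun i => v 0 i * (v 0 i)^*), (fun i => d 0 i); split=> //.
  by move=> i; rewrite mul_conjC_ge0.
move=> k kn; have : (b 0%N *m A ^+ k *m (b 0%N)^t*) 0 0 = h k.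
  rewrite bA //; have := congr1 (fun X : 'M_n.+1 => X (inord k) (inord 0)) eH.
  rewrite mxE !inordK // addn0 => ->; rewrite mxE [RHS]mxE; apply: eq_bigr => i _.
  by rewrite !mxE.
rewrite Apow !mulmxA -[_ *m U *m _]mulmxA -/v => <-.
have -> : U *m (b 0%N)^t* = v^t* by rewrite /v trmxCM trmxCK.
rewrite mul_mx_diag mxE; apply: eq_bigr => i _; rewrite !mxE; ring.
Qed.

End Hermitian.

From mathcomp Require Import all_classical all_reals all_analysis measurable_realfun.
Import numFieldNormedType.Exports.
Local Open Scope classical_set_scope.
Local Open Scope ring_scope.

(** * The limit of the mixed moments *)

Section GenusLimit.
Variables (R : realType) (q : R) (M : nat -> nat) (lambda : R).
Hypothesis hM : (fun N : nat => (M N)%:R / N%:R : R) @ \oo --> lambda.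

Let cvg_inv_nat : (fun N : nat => (N%:R : R)^-1) @ \oo --> (0 : R).
Proof. by rewrite -cvg_shiftS; exact: cvg_harmonic. Qed.

Section Weights.
Variables (m : nat) (s : 'I_m -> nat).
Hypothesis s_gt0 : forall j, (0 < s j)%N.
Notation C := (corner s).
Implicit Types (V : {set {set C * bool}}).
Notation bl := (fun l : C * bool => tag l.1).

(** The case of equality in the bound of the components. *)
Definition planar V : bool := (nwhite (@next m s) V + nblack V == #|C|)%N.

Lemma nconsistentE (N K : nat) V :
  nconsistent N K V = (N ^ nwhite (@next m s) V * K ^ nblack V)%N.
Proof. by rewrite /nconsistent card_consistent !card_ord. Qed.

Lemma card_linked V : linked bl [set: 'I_m]%SET V -> #|V| = #|C|.
Proof.
move=> /andP[pV _]; have := card_pairing pV.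
rewrite (_ : span bl _ = [set: C * bool]%SET); last by apply/setP => x; rewrite !inE.
by rewrite cardsT card_prod card_bool => /eqP; rewrite eqn_pmul2r // => /eqP.
Qed.

Let linked_pairing V : linked bl [set: 'I_m]%SET V -> pairing [set: C * bool]%SET V.
Proof.
move=> /andP[+ _]; rewrite (_ : span bl _ = [set: C * bool]%SET) //.
by apply/setP => x; rewrite !inE.
Qed.

Let linked_alone V : linked bl [set: 'I_m]%SET V -> forall j, ~~ unlinked_block (fun c : C => tag c) V j.
Proof. by move=> /andP[_ /forall_inP h] j; apply: h; rewrite inE. Qed.

Lemma linked_genus V : linked bl [set: 'I_m]%SET V ->
  (nwhite (@next m s) V + nblack V <= #|C|)%N.
Proof.
move=> lV; apply: (gluing_le (@next_inj m s) (@tag_next m s) (@next_trans m s) (tag_surj s_gt0)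
  (linked_pairing lV) (linked_alone lV)).
Qed.

Lemma linked_nonplanar V j : linked bl [set: 'I_m]%SET V ->
  (forall k, k != j -> ~~ splits V (span bl [set j; k]%SET)) -> ~~ planar V.
Proof.
move=> lV h; rewrite /planar neq_ltn; apply/orP; left.
exact: (gluing_lt (@next_inj m s) (@tag_next m s) (@next_trans m s) (tag_surj s_gt0)
  (linked_pairing lV) (linked_alone lV) h).
Qed.

Definition limit_weight V : R :=
  q ^+ ncross (@letter_rank m s) V * (lambda ^+ nblack V *+ planar V).

(** The defect in the bound on the components is the exponent of [1 / N]. *)
Lemma cvg_pweight V : linked bl [set: 'I_m]%SET V ->
  (fun N => pweight N (M N) q V) @ \oo --> limit_weight V.
Proof.
move=> lV; pose e := (#|C| - (nwhite (@next m s) V + nblack V))%N.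
have h : \forall N \near \oo, q ^+ ncross (@letter_rank m s) V *
    (((M N)%:R / N%:R) ^+ nblack V * (N%:R^-1) ^+ e) = pweight N (M N) q V.
  near=> N; have N0 : (N%:R : R) != 0.
    by rewrite pnatr_eq0 -lt0n; near: N; exact: nbhs_infty_gt.
  rewrite /pweight nconsistentE card_linked // -mulrA; congr (_ * _).
  have -> : #|C| = (e + nwhite (@next m s) V + nblack V)%N.
    by rewrite -addnA subnK // linked_genus.
  move: (nwhite _ V) (nblack V) e => w b e'.
  by rewrite natrM !natrX exprMn !exprVn !exprD; field; rewrite !expf_neq0.
apply: cvg_trans (near_eq_cvg h) _.
apply: cvgM; first exact: cvg_cst.
have cX (n : nat) (u : nat -> R) (l : R) : u @ \oo --> l -> (fun N => u N ^+ n) @ \oo --> l ^+ n.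
  move=> ul; elim: n => [|n IH]; first by under eq_fun do rewrite expr0; rewrite expr0; exact: cvg_cst.
  by under eq_fun do rewrite exprS; rewrite exprS; exact: cvgM.
rewrite -mulr_natr; apply: cvgM; first exact: cX.
have -> : (planar V)%:R = (0 : R) ^+ e.
  rewrite expr0n /planar /e; have := linked_genus lV; rewrite leq_eqVlt => /orP[/eqP ->|lt].
    by rewrite eqxx subnn.
  by rewrite (ltn_eqF lt) subn_eq0 leqNgt lt.
by apply: cX; exact: cvg_inv_nat.
Unshelve. all: by end_near.
Qed.

End Weights.

Definition limit_moment (l : seq nat) : R :=
  \sum_(V | linked (fun x : corner (@block_lengths l) * bool => tag x.1) [set: 'I_(size l)]%SET V)
    limit_weight V.

Let pos (l : seq nat) := all (fun k => 0 < k)%N l.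

Let block_lengths_gt0 l : pos l -> forall i, (0 < @block_lengths l i)%N.
Proof. by move=> /allP h i; apply: h; rewrite mem_nth. Qed.

Lemma cvg_centered_moment l : pos l ->
  (fun N => centered_moment q N (M N) l) @ \oo --> limit_moment l.
Proof.
move=> pl; rewrite /centered_moment /limit_moment.
apply: cvg_big => [|V lV]; first by move=> x; exact: add_continuous.
by have h := cvg_pweight (block_lengths_gt0 pl) lV; exact h.
Qed.

(** The genus bound is strict for these pairings, so each weight carries at
    least a factor [1 / N]. *)
Lemma cvg_unpaired_moment k l : pos (k :: l) ->
  (fun N => unpaired_moment q N (M N) k l) @ \oo --> 0.
Proof.
move=> pl; have h : (fun N => unpaired_moment q N (M N) k l) @ \oo -->
    \sum_(V | @unpaired k l V) limit_weight V.
  rewrite /unpaired_moment.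
  apply: cvg_big => [|V /andP[lV _]]; first by move=> x; exact: add_continuous.
  by have h := cvg_pweight (block_lengths_gt0 pl) lV; exact h.
rewrite big1 // in h => V /andP[lV /forallP hV]; rewrite /limit_weight.
have np : ~~ planar V.
  by apply: (linked_nonplanar (block_lengths_gt0 pl) (j := ord0) lV) => j; exact: implyP (hV j).
by rewrite (negbTE np) mulr0n mulr0.
Qed.

Hypothesis q1 : `|q| <= 1.

Lemma limit_moment_le d l : all (fun k => 0 < k <= d)%N l ->
  `|limit_moment l| <= (Num.max 1 `|lambda|) ^+ (d * size l) *
    (matched_bound (2 ^ 2 ^ (d.*2).*2) (size l))%:R.
Proof.
Proof.
move=> hl; have pl : pos l by apply: sub_all hl => k /andP[].
set D := Num.max 1 `|lambda|; have D1 : 1 <= D by rewrite le_max lexx.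
rewrite /limit_moment; apply: le_trans (ler_norm_sum _ _ _) _.
pose B := [set V | matched (fun x : corner (@block_lengths l) * bool => tag x.1) [set: 'I_(size l)]%SET V]%SET.
have cC : (#|corner (@block_lengths l)| <= d * size l)%N.
  rewrite tagnat.card -[X in (_ <= _ * X)%N]card_ord -sum1_card big_distrr /=.
  apply: leq_sum => i _; rewrite muln1.
  by have /andP[] := allP hl _ (mem_nth 0%N (ltn_ord i)).
apply: (@le_trans _ _ (\sum_(V in B) D ^+ (d * size l))).
  rewrite [leLHS](bigID (mem B)) /= [X in _ + X]big1 ?addr0; last first.
    move=> V /andP[lV]; rewrite inE /matched lV /= => /forall_inPn[j _ /exists_inPn h].
    rewrite /limit_weight (_ : planar V = false) ?mulr0n ?mulr0 ?normr0 //.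
    apply/negbTE/(linked_nonplanar (block_lengths_gt0 pl) (j := j) lV) => k kj.
    by apply: h; rewrite !inE kj.
  rewrite [leLHS](eq_bigl (mem B)); last first.
    by move=> V; rewrite /= inE /matched; case: (linked _ _ V).
  apply: ler_sum => V VB; have : V \in B := VB.
  rewrite inE => /andP[lV _]; rewrite /limit_weight normrM normrX.
  apply: (@le_trans _ _ (1 * D ^+ (d * size l))); last by rewrite mul1r.
  apply: ler_pM => //; first by rewrite exprn_ile1.
  case: (boolP (planar V)) => pV; last by rewrite mulr0n normr0 exprn_ge0 // (le_trans ler01).
  rewrite mulr1n normrX; apply: (@le_trans _ _ (D ^+ nblack V)).
    by rewrite lerXn2r ?nnegrE ?normr_ge0 ?(le_trans ler01) // le_max lexx orbT.
  rewrite ler_weXn2l //; apply: leq_trans cC.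
  by rewrite -(eqP pV) leq_addl.
rewrite sumr_const -[leLHS]mulr_natr ler_wpM2l ?exprn_ge0 ?(le_trans ler01) // ler_nat.
rewrite -[X in matched_bound _ X](card_ord (size l)) -cardsT; apply: card_matched => j.
rewrite (_ : span _ _ = finset.setX [set c : corner (@block_lengths l) | tag c == j]%SET [set: bool]%SET); last first.
  by apply/setP => -[c b]; rewrite !inE andbT.
rewrite cardsX cardsT card_bool muln2 leq_double.
have hj : (block_lengths j <= d)%N by have /andP[] := allP hl _ (mem_nth 0%N (ltn_ord j)).
apply: leq_trans hj; rewrite -[leqRHS]card_ord.
pose f (r : 'I_(block_lengths j)) : corner (@block_lengths l) := Tagged (fun j => 'I_(block_lengths j)) r.
apply: leq_trans (leq_imset_card f predT); apply/subset_leq_card/fintype.subsetP => -[i r].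
by rewrite inE => /eqP /= e; subst i; apply/imsetP; exists r.
Qed.

End GenusLimit.

(** * The Hamburger moment problem *)

Section Quadrature.
Variable R : realType.

Definition hankel_form (h : nat -> R) n (c : 'I_n -> R) : R :=
  \sum_(i < n) \sum_(j < n) c i * c j * h (i + j)%N.

(** Moments of the uniform law on a regular grid: a bounded sequence with
    positive definite Hankel forms. *)
Definition grid_moment n (k : nat) : R := n.+1%:R^-1 * \sum_(t < n.+1) (t%:R / n.+1%:R) ^+ k.

Lemma grid_moment_ge0 n k : 0 <= grid_moment n k.
Proof.
by rewrite mulr_ge0 ?invr_ge0 // sumr_ge0 // => t _; rewrite exprn_ge0 // divr_ge0.
Qed.

Lemma grid_moment_le1 n k : grid_moment n k <= 1.
Proof.
rewrite /grid_moment mulrC ler_pdivrMr ?ltr0n // mul1r.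
rewrite -[X in _ <= X%:R](card_ord n.+1) -sumr_const; apply: ler_sum => t _.
by rewrite exprn_ile1 // ?divr_ge0 // ler_pdivrMr ?ltr0n // mul1r ler_nat ltnW.
Qed.

Lemma hankel_grid n (c : 'I_n.+1 -> R) : hankel_form (grid_moment n) c =
  n.+1%:R^-1 * \sum_(t < n.+1) (\sum_(i < n.+1) c i * (t%:R / n.+1%:R) ^+ i) ^+ 2.
Proof.
rewrite /hankel_form mulr_sumr.
under eq_bigr => i _ do under eq_bigr => j _ do
  rewrite /grid_moment mulrCA mulr_sumr mulr_sumr.
under eq_bigr do rewrite exchange_big.
rewrite exchange_big; apply: eq_bigr => t _ /=.
rewrite expr2 mulr_suml mulr_sumr; apply: eq_bigr => i _.
rewrite 2!mulr_sumr; apply: eq_bigr => j _; rewrite exprD; ring.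
Qed.

Lemma hankel_grid_gt0 n (c : 'I_n.+1 -> R) : (exists i, c i != 0) ->
  0 < hankel_form (grid_moment n) c.
Proof.
move=> [i0 ci0]; rewrite hankel_grid pmulr_rgt0 ?invr_gt0 ?ltr0n //.
rewrite lt_neqAle sumr_ge0 ?andbT; last by move=> t _; exact: sqr_ge0.
rewrite eq_sym; apply/eqP => /psumr_eq0P h.
pose p := \poly_(i < n.+1) c (inord i).
have p0 : p != 0.
  apply: contra_neq ci0 => /(congr1 (fun p : {poly R} => p`_i0)).
  by rewrite coef_poly ltn_ord inord_val coef0.
have := max_poly_roots p0 (rs := [seq t%:R / n.+1%:R : R | t <- iota 0 n.+1]).
rewrite size_map size_iota => /(_ _ _) h1.
suff : (n.+1 < size p)%N by rewrite ltnNge size_poly.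
apply: h1.
  apply/allP => x /mapP[t]; rewrite mem_iota add0n => /andP[_ tn] ->.
  apply/eqP; have /eqP := h (fun t _ => sqr_ge0 _) (Ordinal tn) isT.
  rewrite sqrf_eq0 => /eqP <-; rewrite horner_poly; apply: eq_bigr => i _.
  by rewrite inord_val.
rewrite map_inj_uniq ?iota_uniq // => a b /(congr1 (fun x => x * n.+1%:R)).
by rewrite !divfK ?pnatr_eq0 // => /eqP; rewrite eqr_nat => /eqP.
Qed.

Lemma real_quadrature n (h : nat -> R) :
  (forall c : 'I_n.+1 -> R, (exists i, c i != 0) -> 0 < hankel_form h c) ->
  exists (w x : 'I_n.+1 -> R), (forall i, 0 <= w i) /\
    forall k, (k <= n)%N -> \sum_i w i * x i ^+ k = h k.
Proof.
move=> pos.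
have [|c c0|w [x [w0 xr wx]]] := @gauss_quadrature R[i] n (fun k => (h k)%:C%C).
- by move=> k; apply/complex_realP; exists (h k).
- have form0 (a : 'I_n.+1 -> R) : 0 <= hankel_form h a.
    have [/pos /ltW //|ha] := pselect (exists i, a i != 0).
    rewrite /hankel_form big1 // => i _; rewrite big1 // => j _.
    have -> : a i = 0 by apply: contrapT => /eqP ai; apply: ha; exists i.
    by rewrite !mul0r.
  pose a i := complex.Re (c 0 i); pose b i := complex.Im (c 0 i).
  have cE i : c 0 i = (a i +i* b i)%C by rewrite /a /b; case: (c 0 i).
  have -> : (c *m (\matrix_(i < n.+1, j < n.+1) (h (i + j)%N)%:C%C) *m (map_mx Num.conj c^T)) 0 0 =
      (hankel_form h a + hankel_form h b)%:C%C.
    rewrite mxE.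
    have -> : \sum_j (c *m \matrix_(i, j0) (h (i + j0)%N)%:C%C) 0 j * (map_mx Num.conj c^T) j 0 =
       \sum_j \sum_i ((a i * a j * h (i + j)%N + b i * b j * h (i + j)%N) +i*
                 (b i * a j * h (i + j)%N - a i * b j * h (i + j)%N))%C.
      apply: eq_bigr => j _; rewrite !mxE mulr_suml; apply: eq_bigr => i _.
      rewrite !mxE !cE; apply/eqP; rewrite eq_complex /=; apply/andP; split; apply/eqP; ring.
    apply/eqP; rewrite eq_complex; apply/andP; split; apply/eqP.
      rewrite raddf_sum /=; under eq_bigr do rewrite raddf_sum /= big_split /=.
      by rewrite big_split /= /hankel_form [X in X + _ = _]exchange_big [X in _ + X = _]exchange_big.
    rewrite raddf_sum /=; under eq_bigr do rewrite raddf_sum /= sumrB.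
    rewrite sumrB [X in X - _]exchange_big /=; apply/eqP; rewrite subr_eq0; apply/eqP.
    by apply: eq_bigr => i _; apply: eq_bigr => j _; rewrite addnC; congr (_ * _); rewrite mulrC.
  rewrite ltcR.
  have [i ci] : exists i, c 0 i != 0.
    apply: contrapT => hc; move/eqP: c0; apply; apply/rowP => i; rewrite mxE.
    by apply: contrapT => /eqP ci; apply: hc; exists i.
  have [ai|ai] := eqVneq (a i) 0; last by rewrite ltr_wpDr // pos //; exists i.
  rewrite ltr_wpDl // pos //; exists i; apply: contra_neq ci => bi.
  by rewrite cE ai bi.
exists (fun i => complex.Re (w i)), (fun i => complex.Re (x i)); split.
  by move=> i; have := w0 i; rewrite lecE => /andP[].
move=> k kn; have /(congr1 (@complex.Re R)) := wx k kn; rewrite /= => <-.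
rewrite raddf_sum; apply: eq_bigr => i _ /=.
have RRe_ (z : R[i]) : z \is Num.real -> z = (complex.Re z)%:C%C.
  by move=> zr; rewrite RRe_real.
rewrite [in RHS](RRe_ (x i)) // [in RHS](RRe_ (w i)) ?ger0_real //.
by rewrite -rmorphXn -rmorphM.
Qed.

(** Adding a vanishing multiple of a nondegenerate moment sequence removes
    possible kernels of the Hankel forms. *)
Lemma approximate_quadrature (mo : nat -> R) : (forall n (c : 'I_n -> R), 0 <= hankel_form mo c) ->
  exists (w x : forall n, 'I_n.+1 -> R), (forall n i, 0 <= w n i) /\
    forall k, (fun n => \sum_i w n i * x n i ^+ k) @ \oo --> mo k.
Proof.
move=> pos.
have ex n : exists w x : 'I_n.+1 -> R, (forall i, 0 <= w i) /\
    forall k, (k <= n)%N -> \sum_i w i * x i ^+ k = mo k + n.+1%:R^-1 * grid_moment n k.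
  apply: real_quadrature => c c0.
  rewrite (_ : hankel_form _ c = hankel_form mo c + n.+1%:R^-1 * hankel_form (grid_moment n) c).
    by rewrite ltr_wpDl // mulr_gt0 ?invr_gt0 ?ltr0n // hankel_grid_gt0.
  rewrite /hankel_form mulr_sumr -big_split; apply: eq_bigr => i _ /=.
  rewrite mulr_sumr -big_split; apply: eq_bigr => j _ /=; ring.
exists (fun n => sval (cid (ex n))), (fun n => sval (cid (svalP (cid (ex n))))).
split=> [n i|k]; first by case: (svalP (cid (svalP (cid (ex n))))) => + _; apply.
apply: (@cvg_trans _ ((fun n => mo k + harmonic n * grid_moment n k) @ \oo)).
  apply: near_eq_cvg; near=> n.
  case: (svalP (cid (svalP (cid (ex n))))) => _ /(_ k) -> //.
  by near: n; exact: nbhs_infty_ge.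
suff h : (fun n => mo k + harmonic n * grid_moment n k) @ \oo --> mo k + 0 by rewrite addr0 in h.
apply: cvgD; first exact: cvg_cst.
apply: (@squeeze_cvgr _ _ _ _ (fun=> 0) harmonic) => //; last 2 first.
  exact: cvg_cst.
  exact: cvg_harmonic.
near=> n; rewrite mulr_ge0 ?grid_moment_ge0 ?harmonic_ge0 //=.
by rewrite ler_piMr ?harmonic_ge0 ?grid_moment_le1.
Unshelve. all: by end_near.
Qed.

End Quadrature.

Section Helly.
Variable R : realType.

(** A pointwise cluster function of a bounded sequence of functions: along an
    ultrafilter refining the tails every bounded sequence converges. *)
Lemma pointwise_cluster (u : nat -> R -> R) (B : R) :
  (\forall n \near \oo, forall x, 0 <= u n x <= B) ->
  exists G : R -> R, forall (s : seq R) (e : R) (n0 : nat), 0 < e ->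
    exists2 n, (n0 <= n)%N & forall c, c \in s -> `|u n c - G c| < e.
Proof.
move=> ub; have [U [UU oU]] := ultraFilterLemma (eventually_filter : ProperFilter \oo).
have cvgU c : exists l : R, (u ^~ c) @ U --> l.
  have := @segment_compact R 0 B; rewrite compact_ultra => /(_ ((u ^~ c) @ U)).
  have UI : UltraFilter ((u ^~ c) @ U).
    split=> [|G GF sub]; first exact: fmap_proper_filter.
    apply/seteqP; split=> [A GA|A]; last exact: sub.
    have [//|UAC] := in_ultra_setVsetC ((u ^~ c) @^-1` A) UU.
    have : G (~` A) by apply: sub.
    by move=> /(filterI GA); rewrite setICr => /filter_not_empty.
  move=> /(_ UI) [|l [_ cl]]; last by exists l.
  suff : U ((u ^~ c) @^-1` `[0, B]) by [].
  by apply: filterS (oU _ ub) => n ubn; rewrite /= in_itv /=; exact: ubn.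
have [G hG] := choice cvgU.
exists G => s e n0 e0.
have near_s : \forall n \near U, forall c, c \in s -> `|u n c - G c| < e.
  elim: s => [|c s IH]; first by apply: filterS filterT.
  have hc : \forall n \near U, `|u n c - G c| < e.
    by have /cvgrPdist_lt/(_ e e0) := hG c; apply: filterS => n; rewrite distrC.
  apply: filterS2 hc IH => n hn hs c'; rewrite inE => /orP[/eqP -> //|]; exact: hs.
have : U [set n | (n0 <= n)%N] by apply: oU; exact: nbhs_infty_ge.
by move=> /(filterI near_s)/filter_ex[n [h1 h2]]; exists n.
Qed.

(** A monotone function has countably many discontinuities. *)
Lemma discontinuity_free_point (G : R -> R) a b : a < b -> {homo G : x y / x <= y} ->
  exists2 c, a < c < b & ~ discontinuity G c.
Proof.
move=> ab Gnd; apply: contrapT => h.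
have : countable `]a, b[%classic.
  have Gnd' : {in `[a, b] &, nondecreasing_fun G} by move=> x y _ _; exact: Gnd.
  apply: sub_countable (discontinuity_countable Gnd'); apply: subset_card_le => x.
  rewrite /= => xab; split; first exact: xab.
  by apply: contrapT => cx; apply: h; exists x => //; move: xab; rewrite in_itv.
move=> /countable_lebesgue_measure0 /eqP; apply/negP.
by rewrite lebesgue_measure_itv /= lte_fin ab -EFinB eqe subr_eq0 gt_eqF.
Qed.

Section RightRegularisation.
Variable G : R -> R.
Hypothesis G_nd : {homo G : x y / x <= y}.

(** The right-continuous regularisation of a monotone function. *)
Definition right_inf (x : R) : R := inf [set G y | y in [set y | x < y]].

Let set_inf x : has_inf [set G y | y in [set y | x < y]].
Proof.
split; first by exists (G (x + 1)), (x + 1) => //=; rewrite ltrDl.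
by exists (G x) => _ [y /= xy <-]; apply/G_nd/ltW.
Qed.

Lemma right_inf_ge x : G x <= right_inf x.
Proof.
by apply: lb_le_inf => [|_ [y /= xy <-]]; [case: (set_inf x) | apply/G_nd/ltW].
Qed.

Lemma right_inf_le x y : x < y -> right_inf x <= G y.
Proof. by move=> xy; apply: ge_inf; [case: (set_inf x) | exists y]. Qed.

Lemma right_inf_nd : {homo right_inf : x y / x <= y}.
Proof.
move=> x y; rewrite le_eqVlt => /orP[/eqP -> //|xy].
exact: le_trans (right_inf_le xy) (right_inf_ge y).
Qed.

Lemma right_inf_rc : right_continuous right_inf.
Proof.
move=> x; apply/cvgrPdist_lt => e e0.
have [y /= [z /= xz <-] ye] := inf_adherent e0 (set_inf x).
near=> t; rewrite distrC ger0_norm; last first.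
  rewrite subr_ge0; apply: right_inf_nd; near: t; exact: nbhs_right_ge.
rewrite ltrBlDl; apply: le_lt_trans ye; apply: right_inf_le.
by near: t; apply: nbhs_right_lt.
Unshelve. all: by end_near.
Qed.

Lemma right_inf_id c : ~ discontinuity G c -> right_inf c = G c.
Proof.
move=> dc; apply/eqP; rewrite eq_le right_inf_ge andbT.
have cl : cvg (G x @[x --> c^'-]).
  apply: nondecreasing_at_left_is_cvgr.
  - by near=> x => y z _ _; exact: G_nd.
  - near=> x; exists (G c) => _ [y /= yx <-]; apply/G_nd/ltW.
    by move: yx; rewrite in_itv => /andP[].
have cr : cvg (G x @[x --> c^'+]).
  apply: nondecreasing_at_right_is_cvgr.
  - by near=> x => y z _ _; exact: G_nd.
  - near=> x; exists (G c) => _ [y /= yx <-]; apply/G_nd/ltW.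
    by move: yx; rewrite in_itv => /andP[].
have e : lim (G x @[x --> c^'-]) = lim (G x @[x --> c^'+]).
  by apply/eqP; apply: contrapT => /negP h; apply: dc; split.
apply: (@le_trans _ _ (lim (G x @[x --> c^'+]))).
  apply: limr_ge => //; near=> x; apply: right_inf_le; near: x; exact: nbhs_right_gt.
rewrite -e; apply: limr_le => //; near=> x; apply/G_nd/ltW; near: x; exact: nbhs_left_lt.
Unshelve. all: by end_near.
Qed.

End RightRegularisation.
End Helly.

Section MeasureFromCdf.
Variable R : realType.

Lemma cdf_measure (F : R -> R) : {homo F : x y / x <= y} -> right_continuous F ->
  F @ -oo --> (0 : R) -> F @ +oo --> (1 : R) ->
  exists P : probability (measurableTypeR R) R,
    forall a b, a <= b -> P `]a, b]%classic = (F b - F a)%:E.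
Proof.
move=> Fnd Frc F0 F1.
pose F' : cumulativeBounded (0 : R) (1 : R) := HB.pack F
  (isCumulative.Build R _ R F Fnd Frc) (isCumulativeBounded.Build R 0 1 F F0 F1).
exists (lebesgue_stieltjes_measure F') => a b ab.
rewrite /= /lebesgue_stieltjes_measure /measure_extension measurable_mu_extE/=; last exact: is_ocitv.
by rewrite wlength_itv_bnd.
Qed.

Section StepEstimate.
Variables (P : probability (measurableTypeR R) R) (f : R -> R).
Hypothesis f_cont : continuous f.

Lemma integrable_bounded_itv a b : P.-integrable `]a, b]%classic (EFin \o f).
Proof.
apply: (@integrableS _ _ _ P `[a, b]%classic) => //.
  by move=> x /=; rewrite !in_itv /= => /andP[/ltW -> ->].
apply: measurable_bounded_integrable => //.
- by rewrite (le_lt_trans (probability_le1 _ _)) ?ltry.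
- by apply: measurable_funTS; exact: measurable_realfun.continuous_measurable_fun.
- have [M [Mr hM]] := compact_bounded (continuous_compact
    (continuous_subspaceT (A := `[a, b]%classic) f_cont) (@segment_compact R a b)).
  exists M; split=> // y My x xab; apply: hM My _ _; by exists x.
Qed.

Lemma Rintegral_cell a b (w : R) : (forall x, a < x <= b -> `|f x - f b| <= w) ->
  `|\int[P]_(x in `]a, b]) f x - f b * fine (P `]a, b]%classic)| <= w * fine (P `]a, b]%classic).
Proof.
move=> h; have mab : measurable (`]a, b]%classic : set (measurableTypeR R)) by [].
have i1 := integrable_bounded_itv a b.
have ic (r : R) : P.-integrable `]a, b]%classic (EFin \o cst r).
  by apply: finite_measure_integrable_cst.
rewrite -(Rintegral_cst P mab (f b)) -(RintegralB mab i1 (ic (f b))).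
rewrite -(Rintegral_cst P mab w).
have ib : P.-integrable `]a, b]%classic (EFin \o (f \- cst (f b))) := integrableB mab i1 (ic (f b)).
apply: le_trans (le_normr_Rintegral mab ib) _.
apply: (le_Rintegral mab (integrable_norm ib) (ic w)).
by move=> x /=; rewrite in_itv; exact: h.
Qed.

(** Riemann sums over cells on which the oscillation of [f] is at most [w]. *)
Lemma Rintegral_step (c : nat -> R) p (w : R) : (forall i, c i <= c i.+1) ->
  (forall i x, (i < p)%N -> c i < x <= c i.+1 -> `|f x - f (c i.+1)| <= w) ->
  `|\int[P]_(x in `]c 0%N, c p]) f x -
    \sum_(i < p) f (c i.+1) * fine (P `]c i, c i.+1]%classic)|
  <= w * fine (P `]c 0%N, c p]%classic).
Proof.
move=> cnd; elim: p => [|p IH] h.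
  by rewrite big_ord0 set_itvoc0 ?lexx // Rintegral_set0 subr0 normr0 measure0 mulr0.
have c0p : c 0%N <= c p by elim: (p) => // k; move=> /le_trans; apply.
have eU : `]c 0%N, c p.+1]%classic = `]c 0%N, c p] `|` `]c p, c p.+1] :> set R.
  by rewrite -itv_bndbnd_setU ?bnd_simp.
have dU : [disjoint `]c 0%N, c p]%classic & `]c p, c p.+1]%classic : set R].
  apply/disj_setPS => x /= []; rewrite !in_itv /= => /andP[_ h1] /andP[h2 _].
  by move: (lt_le_trans h2 h1); rewrite ltxx.
rewrite eU Rintegral_setU //; last by rewrite -eU; exact: integrable_bounded_itv.
rewrite measureU //; last by move/disj_setPS: dU; rewrite subset0.
rewrite fineD ?fin_num_measure // mulrDr big_ord_recr /= opprD addrACA.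
apply: le_trans (ler_normD _ _) _; apply: lerD.
  by apply: IH => i x ip; apply: h; apply: ltnW.
by apply: Rintegral_cell => x; apply: h.
Qed.

End StepEstimate.
End MeasureFromCdf.

Section AtomicStep.
Variables (R : realType) (n : nat) (w x : 'I_n -> R).
Hypothesis w_ge0 : forall i, 0 <= w i.

Definition atom_sum (f : R -> R) : R := \sum_i w i * f (x i).
Definition atom_cdf (c : R) : R := atom_sum (fun y => (y <= c)%R%:R).

Lemma atom_sum_le f g : (forall y, f y <= g y) -> atom_sum f <= atom_sum g.
Proof. by move=> fg; apply: ler_sum => i _; rewrite ler_wpM2l. Qed.

Lemma atom_sumD f g : atom_sum (f \+ g) = atom_sum f + atom_sum g.
Proof. by rewrite /atom_sum -big_split; apply: eq_bigr => i _; rewrite mulrDr. Qed.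

Lemma atom_sumZ c f : atom_sum (fun y => c * f y) = c * atom_sum f.
Proof. by rewrite /atom_sum mulr_sumr; apply: eq_bigr => i _; rewrite mulrCA. Qed.

Lemma atom_cdf_nd : {homo atom_cdf : a b / a <= b}.
Proof.
move=> a b ab; apply: atom_sum_le => y; rewrite ler_nat.
by case: (lerP y a) => // ya; rewrite (le_trans ya ab).
Qed.

Lemma atom_cdf_ge0 c : 0 <= atom_cdf c.
Proof. by apply: sumr_ge0 => i _; rewrite mulr_ge0. Qed.

(** The analogue of [Rintegral_step] for atoms, with the same Riemann sum. *)
Lemma atom_step (f : R -> R) (c : nat -> R) p (d : R) : (forall i, c i <= c i.+1) ->
  (forall i y, (i < p)%N -> c i < y <= c i.+1 -> `|f y - f (c i.+1)| <= d) ->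
  `|atom_sum (fun y => f y * (c 0%N < y <= c p)%R%:R) -
    \sum_(i < p) f (c i.+1) * (atom_cdf (c i.+1) - atom_cdf (c i))|
  <= d * (atom_cdf (c p) - atom_cdf (c 0%N)).
Proof.
move=> cnd h.
have cnd' i j : (i <= j)%N -> c i <= c j.
  by move=> /subnK <-; elim: (j - i)%N => // k ih; exact: le_trans ih (cnd _).
have cell (a b : R) y : a <= b -> (y <= b)%R%:R - (y <= a)%R%:R = (a < y <= b)%R%:R :> R.
  move=> ab; rewrite ltNge; case: (lerP y a) => ya /=; last by rewrite subr0.
  by rewrite (le_trans ya ab) subrr.
have cdfB a b : a <= b -> atom_cdf b - atom_cdf a = \sum_i w i * (a < x i <= b)%R%:R.
  move=> ab; rewrite /atom_cdf /atom_sum -sumrB; apply: eq_bigr => i _.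
  by rewrite -mulrBr cell.
have tele y : (c 0%N < y <= c p)%R%:R = \sum_(i < p) (c i < y <= c i.+1)%R%:R :> R.
  rewrite -cell; last exact: cnd'.
  under eq_bigr => i _ do rewrite -cell //.
  rewrite -(big_mkord xpredT (fun i => (y <= c i.+1)%R%:R - (y <= c i)%R%:R)).
  by rewrite (telescope_sumr (fun i => (y <= c i)%R%:R)).
rewrite cdfB; last exact: cnd'.
under [X in _ - X]eq_bigr => i _ do rewrite cdfB // mulr_sumr.
rewrite exchange_big -sumrB mulr_sumr; apply: le_trans (ler_norm_sum _ _ _) _.
apply: ler_sum => i _; rewrite tele [X in w i * X]mulr_sumr mulr_sumr.
rewrite -sumrB mulrCA mulr_sumr mulr_sumr.
apply: le_trans (ler_norm_sum _ _ _) _; apply: ler_sum => j _.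
rewrite (_ : _ - _ = w i * ((f (x i) - f (c j.+1)) * (c j < x i <= c j.+1)%R%:R)); last by rewrite mulrBl; ring.
rewrite normrM (ger0_norm (w_ge0 i)) ler_wpM2l // normrM.
case: (boolP (c j < x i <= c j.+1)) => hx; last by rewrite normr0 !mulr0.
by rewrite normr1 !mulr1; apply: h.
Qed.

End AtomicStep.

Section Tails.
Variables (R : realType) (P : probability (measurableTypeR R) R).

Lemma expr_even_ge0 k (y : R) : 0 <= y ^+ k.*2.
Proof. by rewrite -mul2n exprM exprn_ge0 // sqr_ge0. Qed.

Lemma normr_expr_le k (y : R) : `|y ^+ k| <= 1 + y ^+ k.*2.
Proof.
rewrite -muln2 exprM; move: (y ^+ k) => z.
by have := sqr_ge0 (`|z| - 1); rewrite sqrrB real_normK ?num_real //; have := normr_ge0 z; nra.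
Qed.

Lemma measurable_expr (D : set (measurableTypeR R)) k : measurable_fun D (fun y : R => y ^+ k).
Proof.
apply: measurable_funTS.
by apply: measurable_realfun.continuous_measurable_fun; exact: exprn_continuous.
Qed.

(** Monotone convergence along [-K, K] bounds the even moments, which dominate
    all the others. *)
Lemma even_moments_le (e : nat -> R) :
  (forall k K : nat, \int[P]_(y in `](- (K%:R : R))%R, K%:R%R]) ((y : R) ^+ k.*2)%:E <= (e k)%:E)%E ->
  has_moments P /\ forall k, moment P k.*2 <= e k.
Proof.
move=> h; have even k : (\int[P]_y (y ^+ k.*2)%:E <= (e k)%:E)%E.
  have -> : setT = \bigcup_K `]- K%:R, K%:R]%classic :> set R.
    apply/seteqP; split=> // y _; exists (Num.truncn `|y|).+1 => //=.
    by have := truncnS_gt `|y|; rewrite in_itv /= ltr_norml => /andP[-> /ltW ->].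
  apply: cvge_le; last first.
    apply: ge0_nondecreasing_set_cvg_integral => //.
    - move=> i j ij; apply/subsetPset => y /=; rewrite !in_itv /= => /andP[y1 y2].
      have ijR : i%:R <= j%:R :> R by rewrite ler_nat.
      by rewrite (le_lt_trans _ y1) ?lerN2 // (le_trans y2).
    - by move=> i; apply/measurable_EFinP; exact: measurable_expr.
    - by move=> i y _; rewrite lee_fin expr_even_ge0.
  by near=> K; exact: h.
  exact: eventually_filter.
have evenI : forall k, P.-integrable setT (fun y : R => (y ^+ k.*2)%:E).
  move=> k; apply/integrableP; split; first by apply/measurable_EFinP; exact: measurable_expr.
  under eq_integral do rewrite gee0_abs ?lee_fin ?expr_even_ge0 //.
  by apply: le_lt_trans (even k) _; rewrite ltry.
split.
  move=> k; have i1 : P.-integrable setT (fun y : R => (1 + y ^+ k.*2)%:E).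
    have := integrableD measurableT (finite_measure_integrable_cst P 1 measurableT) (evenI k).
    by apply: eq_integrable => // y _; rewrite EFinD.
  apply: (le_integrable measurableT _ _ i1).
    by apply/measurable_EFinP; exact: measurable_expr.
  move=> y _; rewrite lee_fin [`|1 + _|]ger0_norm ?normr_expr_le //.
  by rewrite addr_ge0 ?expr_even_ge0.
move=> k; rewrite /moment /Rintegral -lee_fin fineK //.
by apply: integrable_fin_num (evenI k).
Unshelve. all: by end_near.
Qed.

(** Truncating a moment to [-K, K] thus costs a higher moment divided by [K]. *)
Lemma expr_tail k (K : R) (y : R) : 1 <= K -> K <= `|y| -> `|y ^+ k| <= y ^+ k.+1.*2 / K.
Proof.
move=> K1 Ky; have K0 : 0 < K by apply: lt_le_trans K1.
have y1 : 1 <= `|y| by apply: le_trans Ky.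
rewrite ler_pdivlMr // (_ : y ^+ k.+1.*2 = `|y ^+ k| * `|y ^+ k.+2|).
  rewrite ler_wpM2l // normrX; apply: (le_trans Ky); rewrite -{1}[`|y|]expr1.
  exact: ler_weXn2l.
by rewrite -normrM -exprD !addnS addnn -doubleS ger0_norm // expr_even_ge0.
Qed.

Lemma moment_tail k (a b K : R) : has_moments P -> 1 <= K ->
  a <= - K -> K <= b ->
  `|moment P k - \int[P]_(y in `]a, b]) (y ^+ k)| <= moment P k.+1.*2 / K.
Proof.
move=> hP K1 aK Kb; have K0 : 0 < K by apply: lt_le_trans K1.
have mI : measurable (`]a, b]%classic : set (measurableTypeR R)) by [].
have mC := measurableC mI.
have iK : P.-integrable setT (fun y : R => (K^-1 * y ^+ k.+1.*2)%:E).
  by under eq_fun do rewrite EFinM; apply: integrableZl => //; exact: hP.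
have sub (D : set (measurableTypeR R)) (f : R -> R) : measurable D ->
    P.-integrable setT (fun y : R => (f y)%:E) -> P.-integrable D (EFin \o f).
  by move=> mD; apply: integrableS.
rewrite /moment -(setvU `]a, b]) Rintegral_setU //; last 2 first.
- by rewrite setvU; exact: hP.
- by rewrite disj_set2E setICl.
rewrite addrK setvU; apply: le_trans (le_normr_Rintegral mC (sub _ _ mC (hP k))) _.
rewrite mulrC -RintegralZl //; last exact: hP.
have -> : \int[P]_y (K^-1 * y ^+ k.+1.*2) = \int[P]_(y in ~` `]a, b] `|` `]a, b]) (K^-1 * y ^+ k.+1.*2).
  by rewrite setvU.
rewrite Rintegral_setU //; last 2 first.
- by rewrite setvU.
- by rewrite disj_set2E setICl.
rewrite -[leLHS]addr0; apply: lerD; last first.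
  by apply: Rintegral_ge0 => y _; rewrite mulr_ge0 ?expr_even_ge0 // invr_ge0 ltW.
apply: le_Rintegral => //; [|exact: sub|].
  by have := integrable_norm (sub _ _ mC (hP k)).
move=> y yab; rewrite mulrC; apply: expr_tail => //.
rewrite leNgt ltr_norml; apply/negP => /andP[y1 y2]; apply: yab; rewrite /= in_itv /=.
by rewrite (le_lt_trans aK y1) (le_trans (ltW y2) Kb).
Qed.

End Tails.

Section Hamburger.
Variable R : realType.

Lemma exprn_lipschitz k (K x y : R) : `|x| <= K -> `|y| <= K ->
  `|x ^+ k - y ^+ k| <= k%:R * K ^+ k.-1 * `|x - y|.
Proof.
move=> xK yK; have K0 : 0 <= K by apply: le_trans xK.
rewrite subrXX normrM mulrC ler_wpM2r //; apply: le_trans (ler_norm_sum _ _ _) _.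
rewrite mulr_natl -[X in _ <= _ *+ X](card_ord k) -sumr_const; apply: ler_sum => i _.
rewrite normrM !normrX (_ : K ^+ k.-1 = K ^+ (k.-1 - i) * K ^+ i); last first.
  by rewrite -exprD subnK //; case: k i => [[]|k] // i; rewrite -ltnS ltn_ord.
by apply: ler_pM => //; rewrite ?exprn_ge0 // lerXn2r ?nnegrE.
Qed.

Variable mo : nat -> R.
Hypothesis mo_psd : forall n (c : 'I_n -> R), 0 <= hankel_form mo c.
Hypothesis mo0 : mo 0%N = 1.

Lemma even_moment_ge0 k : 0 <= mo k.*2.
Proof.
have := mo_psd (fun i : 'I_k.+1 => (i == ord_max)%:R).
rewrite /hankel_form (bigD1 ord_max) //= (bigD1 ord_max) //= eqxx !mul1r addnn.
rewrite !big1 ?addr0 // => [i /negbTE ->|i /negbTE ->]; last by rewrite mulr0 mul0r.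
by apply: big1 => j _; rewrite !mul0r.
Qed.

Section Atoms.
Variables (w x : forall n, 'I_n.+1 -> R).
Arguments w : clear implicits.
Arguments x : clear implicits.
Hypothesis w_ge0 : forall n i, 0 <= w n i.
Hypothesis w_cvg : forall k, (fun n => \sum_i w n i * x n i ^+ k) @ \oo --> mo k.

Let L n (f : R -> R) := atom_sum (w n) (x n) f.
Let cdf n c := atom_cdf (w n) (x n) c.

Let L_cvg k (e : R) : 0 < e -> \forall n \near \oo, `|L n (fun y => y ^+ k) - mo k| < e.
Proof.
move=> e0; have /cvgrPdist_lt/(_ e e0) := @w_cvg k.
by apply: filterS => n; rewrite distrC.
Qed.

Let cdf_le n c : cdf n c <= L n (fun y => y ^+ 0).
Proof. by apply: atom_sum_le => // y; rewrite expr0 lern1 leq_b1. Qed.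

Let cdf_bounded : \forall n \near \oo, forall c, 0 <= cdf n c <= 2.
Proof.
apply: filterS (@L_cvg 0%N 1 ltr01) => n; rewrite mo0 => h c.
rewrite atom_cdf_ge0 //=; apply: le_trans (cdf_le n c) _.
by move: h; rewrite ltr_norml; lra.
Qed.

Section Limit.
Variable G : R -> R.
Hypothesis G_cluster : forall (s : seq R) (e : R) (n0 : nat), 0 < e ->
    exists2 n, (n0 <= n)%N & forall c, c \in s -> `|cdf n c - G c| < e.

Let select (s : seq R) (ks : seq nat) (e : R) : 0 < e ->
  exists n, (forall c, c \in s -> `|cdf n c - G c| < e) /\
    (forall k, k \in ks -> `|L n (fun y => y ^+ k) - mo k| < e).
Proof.
move=> e0; have [n0 hn0] : exists n0, forall n, (n0 <= n)%N -> forall k, k \in ks ->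
    `|L n (fun y => y ^+ k) - mo k| < e.
  elim: ks => [|k ks [n0 IH]]; first by exists 0%N.
  have [n1 _ h1] := @L_cvg k e e0; exists (maxn n0 n1) => n; rewrite geq_max => /andP[h2 h3] j.
  by rewrite inE => /orP[/eqP ->|/(IH n h2)//]; apply: h1.
by have [n n0n hn] := G_cluster s n0 e0; exists n; split=> //; exact: hn0.
Qed.

Let G_nd : {homo G : a b / a <= b}.
Proof.
move=> a b ab; apply/ler_addgt0Pr => e e0.
have [n [h _]] := @select [:: a; b] [::] (e / 2) (divr_gt0 e0 (ltr0Sn _ 1)).
have := h a; have := h b; rewrite !inE !eqxx orbT => /(_ isT) hb /(_ isT) ha.
have hab := atom_cdf_nd (x n) (@w_ge0 n) ab.
by move: ha hb hab; rewrite !ltr_norml /cdf; lra.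
Qed.

Let G_ge0 c : 0 <= G c.
Proof.
apply/ler_addgt0Pr => e e0; have [n [h _]] := @select [:: c] [::] e e0.
have := h c; rewrite inE eqxx => /(_ isT); rewrite ltr_norml.
by have := @atom_cdf_ge0 _ _ (w n) (x n) (@w_ge0 n) c; rewrite -/(cdf n c); lra.
Qed.

Let G_le1 c : G c <= 1.
Proof.
apply/ler_addgt0Pr => e e0.
have [n [h /(_ 0%N)]] := @select [:: c] [:: 0%N] (e / 2) (divr_gt0 e0 (ltr0Sn _ 1)).
have := h c; rewrite !inE !eqxx mo0 => /(_ isT) h1 /(_ isT) h2.
by move: h1 h2; rewrite !ltr_norml; have := cdf_le n c; lra.
Qed.

Let G_tail c : 0 < c -> 1 - mo 2 / c ^+ 2 <= G c /\ G (- c) <= mo 2 / c ^+ 2.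
Proof.
move=> c0; have c20 : 0 < c ^+ 2 by rewrite exprn_gt0.
have main (e : R) : 0 < e -> 1 - mo 2 / c ^+ 2 <= G c + (2 + c ^- 2) * e /\
    G (- c) <= mo 2 / c ^+ 2 + (2 + c ^- 2) * e.
  move=> e0; have [n [h h']] := @select [:: c; - c] [:: 0; 2]%N e e0.
  have := h c; have := h (- c); have := h' 0%N; have := h' 2%N.
  rewrite !inE !eqxx !orbT mo0 => /(_ isT) h1 /(_ isT) h2 /(_ isT) h3 /(_ isT) h4.
  have hL2 : L n (fun y => y ^+ 2) / c ^+ 2 <= (mo 2 + e) / c ^+ 2.
    by rewrite ler_wpM2r ?invr_ge0 ?(ltW c20) //; move: h1; rewrite ltr_norml; lra.
  have hL0 := cdf_le n c.
  have t1 : L n (fun y => y ^+ 0) - cdf n c <= L n (fun y => y ^+ 2) / c ^+ 2.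
    rewrite lerBlDr mulrC -atom_sumZ -atom_sumD; apply: atom_sum_le => // y /=.
    rewrite expr0; case: (lerP y c) => yc /=.
      by rewrite lerDr mulr_ge0 ?invr_ge0 ?sqr_ge0 // ltW.
    rewrite addr0 mulrC ler_pdivlMr // mul1r.
    by rewrite lerXn2r ?nnegrE ?ltW // (lt_trans c0 yc).
  have t2 : cdf n (- c) <= L n (fun y => y ^+ 2) / c ^+ 2.
    rewrite mulrC -atom_sumZ; apply: atom_sum_le => // y /=.
    case: (lerP y (- c)) => yc /=; last by rewrite mulr_ge0 ?invr_ge0 ?sqr_ge0 // ltW.
    rewrite mulrC ler_pdivlMr // mul1r -[y ^+ 2]sqrrN.
    by rewrite lerXn2r ?nnegrE ?(ltW c0) //; lra.
  have ce : 0 <= c ^- 2 * e by rewrite mulr_ge0 ?invr_ge0 ?ltW.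
  move: h2 h3 h4 t1 t2 hL2; rewrite !ltr_norml mulrDl [e / _]mulrC mulrDl.
  move: (mo 2 / c ^+ 2) (c ^- 2 * e) ce => A D ce.
  by split; lra.
have pos : 0 < 2 + c ^- 2 by rewrite addr_gt0 // invr_gt0.
have eE e : (2 + c ^- 2) * (e / (2 + c ^- 2)) = e by rewrite mulrCA divff ?mulr1 ?gt_eqF.
by split; apply/ler_addgt0Pr => e e0; have [h1 h2] := main _ (divr_gt0 e0 pos);
  move: h1 h2; rewrite eE.
Qed.

Let F := right_inf G.

Let F_tail c : 1 < c -> `|1 - F c| <= mo 2 / c /\ `|F (- c)| <= 4 * mo 2 / c.
Proof.
move=> c1; have c0 : 0 < c by apply: lt_trans c1.
have m2 := even_moment_ge0 1.
have d2 (d : R) : 0 < d -> d ^+ 2 / d ^+ 2 = 1 by move=> d0; rewrite divff // expf_neq0 ?gt_eqF.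
have div2 : mo 2 / c ^+ 2 <= mo 2 / c.
  by rewrite ler_wpM2l // lef_pV2 ?posrE ?exprn_gt0 // expr2 ler_peMr // ltW.
split.
  have [h _] := G_tail c0; rewrite ger0_norm; last first.
    by rewrite subr_ge0; apply: le_trans (G_le1 (c + 1)); apply: right_inf_le => //; rewrite ltrDl.
  have := right_inf_ge G_nd c; rewrite -/F; move: h div2; lra.
rewrite ger0_norm; last by apply: le_trans (right_inf_ge G_nd _); exact: G_ge0.
have c2 : 0 < c / 2 by rewrite divr_gt0.
have [_ h] := G_tail c2; have lt : - c < - (c / 2) by lra.
apply: le_trans (right_inf_le G_nd lt) _; apply: le_trans h _.
rewrite expr_div_n invf_div (_ : 2 ^+ 2 = 4); last by rewrite expr2; lra.
by move: div2; rewrite mulrA [mo 2 * 4]mulrC -!mulrA; lra.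
Qed.

(** No mass escapes to infinity, since the second moments are bounded. *)
Lemma cluster_measure : exists P : probability (measurableTypeR R) R,
  forall a b, a <= b -> P `]a, b]%classic = (F b - F a)%:E.
Proof.
have m2 := even_moment_ge0 1.
apply: cdf_measure; [exact: right_inf_nd|exact: right_inf_rc| |].
- apply/cvgrPdist_lt => e e0; near=> z; rewrite sub0r normrN -[z]opprK.
  have z1 : 1 < - z by rewrite ltrNr; near: z; exact: nbhs_ninfty_lt.
  have [_ h] := F_tail z1; apply: le_lt_trans h _.
  rewrite ltr_pdivrMr ?(lt_trans ltr01) // [e * _]mulrC -ltr_pdivrMr // ltrNr.
  by near: z; apply: nbhs_ninfty_lt; rewrite num_real.
- apply/cvgrPdist_lt => e e0; near=> z.
  have z1 : 1 < z by near: z; exact: nbhs_pinfty_gt.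
  have [h _] := F_tail z1; apply: le_lt_trans h _.
  rewrite ltr_pdivrMr ?(lt_trans ltr01) // [e * _]mulrC -ltr_pdivrMr //.
  by near: z; apply: nbhs_pinfty_gt; rewrite num_real.
Unshelve. all: by end_near.
Qed.

Section Moments.
Variable P : probability (measurableTypeR R) R.
Hypothesis hP : forall a b, a <= b -> P `]a, b]%classic = (F b - F a)%:E.

Let inside (a b y : R) : R := (a < y <= b)%R%:R.

(* Both sides are compared with a common Riemann sum, whose nodes are
   continuity points of [G], where the distribution functions converge. *)
Let interval_moment k (K : nat) (ks : seq nat) (e : R) : 0 < e ->
  exists a b n, [/\ a <= - K%:R, K%:R <= b,
    `|\int[P]_(y in `]a, b]) (y ^+ k) - L n (fun y => y ^+ k * inside a b y)| <= e
    & forall j, j \in ks -> `|L n (fun y => y ^+ j) - mo j| < e].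
Proof.
move=> e0; pose K1 : R := K.+1%:R; pose lip : R := k%:R * K1 ^+ k.-1.
have K10 : 0 < K1 by rewrite ltr0n.
have lip0 : 0 <= lip by rewrite mulr_ge0 // exprn_ge0 // ltW.
pose r := Num.truncn (12 * lip / e).
pose d : R := r.+1%:R^-1.
have d0 : 0 < d by rewrite invr_gt0 ltr0n.
have d1 : d <= 1 by rewrite invf_le1 ?ltr0n // ler1n.
have lipd : lip * (2 * d) * 3 <= e / 2.
  have : 12 * lip / e < r.+1%:R by exact: truncnS_gt.
  rewrite ltr_pdivrMr // => h; have : 12 * lip * d < e.
    by rewrite /d ltr_pdivrMr ?ltr0n // [e * _]mulrC.
  lra.
pose p := ((K.+1).*2 * r.+1).-1.
have pE : p.+1%:R * d = 2 * K1.
  rewrite /p prednK ?muln_gt0 // natrM -muln2 natrM /d -mulrA divff ?pnatr_eq0 //.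
  by rewrite mulr1 mulrC.
have [c hc] : {c : nat -> R & forall i,
    (- K1 + i%:R * d < c i < - K1 + i.+1%:R * d) /\ ~ discontinuity G (c i)}.
  apply: (@boolp.choice nat R (fun i ci => (- K1 + i%:R * d < ci < - K1 + i.+1%:R * d) /\ ~ discontinuity G ci)) => i; have lt : - K1 + i%:R * d < - K1 + i.+1%:R * d.
    by rewrite ltrD2l ltr_pM2r // ltr_nat.
  by have [c h1 h2] := discontinuity_free_point lt G_nd; exists c.
have cnd i : c i <= c i.+1.
  have [/andP[_ h1] _] := hc i; have [/andP[h2 _] _] := hc i.+1.
  by apply: ltW; apply: lt_trans h1 h2.
have cnd' i j : (i <= j)%N -> c i <= c j.
  by move=> /subnK <-; elim: (j - i)%N => // n ih; exact: le_trans ih (cnd _).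
have Sd i : i.+1%:R * d = i%:R * d + d by rewrite -natr1 mulrDl mul1r.
have cell i y : (i < p)%N -> c i < y <= c i.+1 -> `|y ^+ k - c i.+1 ^+ k| <= lip * (2 * d).
  move=> ip /andP[y1 y2]; have [/andP[h1 _] _] := hc i; have [/andP[h2 h3] _] := hc i.+1.
  have id0 : 0 <= i%:R * d by rewrite mulr_ge0 // ltW.
  have ipd : i.+2%:R * d <= 2 * K1 by rewrite -pE ler_wpM2r ?(ltW d0) // ler_nat ltnS.
  rewrite !Sd in h2 h3 ipd.
  have yK : `|y| <= K1 by rewrite ler_norml; lra.
  have cK : `|c i.+1| <= K1 by rewrite ler_norml; lra.
  apply: le_trans (exprn_lipschitz k yK cK) _; rewrite ler_wpM2l // ler_norml; lra.
have a_le : c 0%N <= - K%:R.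
  by have [/andP[_ h1] _] := hc 0%N; move: h1; rewrite mul1r /K1 -natr1; lra.
have b_ge : K%:R <= c p.
  have [/andP[h1 _] _] := hc p; move: h1 pE; rewrite Sd /K1 -natr1; lra.
pose e' := Num.min 1 (Num.min e (e / (4 * (p%:R * K1 ^+ k + 1)))).
have B0 : 0 <= p%:R * K1 ^+ k by rewrite mulr_ge0 // exprn_ge0 // ltW.
have B1 : 0 < 4 * (p%:R * K1 ^+ k + 1) by lra.
have e'0 : 0 < e' by rewrite !lt_min ltr01 e0 divr_gt0.
have [e'1 e'e e'2] : [/\ e' <= 1, e' <= e & e' <= e / (4 * (p%:R * K1 ^+ k + 1))].
  by rewrite !ge_min !lexx !orbT.
have [n [hcdf hmo]] := @select [seq c i | i <- iota 0 p.+1] (0%N :: ks) e' e'0.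
exists (c 0%N), (c p), n; split=> //; last first.
  by move=> j jks; apply: lt_le_trans (hmo j _) e'e; rewrite inE jks orbT.
have FG i : F (c i) = G (c i) by apply: right_inf_id => //; case: (hc i).
have Pc i j : (i <= j)%N -> fine (P `]c i, c j]%classic) = G (c j) - G (c i).
  by move=> ij; rewrite hP /= ?FG // cnd'.
have cont_k : continuous (fun y : R => y ^+ k) by exact: exprn_continuous.
have h1 := @Rintegral_step _ P _ cont_k c p _ cnd cell.
have h2 := @atom_step _ _ (w n) (x n) (@w_ge0 n) (fun y => y ^+ k) c p _ cnd cell.
have h3 : `|\sum_(i < p) c i.+1 ^+ k * fine (P `]c i, c i.+1]%classic) -
    \sum_(i < p) c i.+1 ^+ k * (cdf n (c i.+1) - cdf n (c i))| <= e / 2.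
  rewrite -sumrB; apply: le_trans (ler_norm_sum _ _ _) _.
  apply: (@le_trans _ _ (\sum_(i < p) K1 ^+ k * (2 * e'))).
    apply: ler_sum => i _; rewrite Pc // -mulrBr normrM normrX; apply: ler_pM => //.
      rewrite lerXn2r ?nnegrE ?(ltW K10) //.
      have [/andP[h4 _] _] := hc i.+1; have [/andP[_ h5] _] := hc i.+1.
      have ipd : i.+2%:R * d <= 2 * K1 by rewrite -pE ler_wpM2r ?(ltW d0) // ler_nat ltnS.
      have id0 : 0 <= i.+1%:R * d by rewrite mulr_ge0 // ltW.
      rewrite ler_norml; lra.
    have m1 : c i.+1 \in [seq c i | i <- iota 0 p.+1].
      by apply: map_f; rewrite mem_iota /= add0n ltnS.
    have m2 : c i \in [seq c i | i <- iota 0 p.+1].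
      by apply: map_f; rewrite mem_iota /= add0n ltnS ltnW.
    have := hcdf _ m1; have := hcdf _ m2; rewrite !ltr_norml ler_norml; lra.
  rewrite sumr_const card_ord -mulr_natl mulrA.
  move: e'2; rewrite ler_pdivlMr // => h; nra.
have cdf2 : cdf n (c p) - cdf n (c 0%N) <= 2.
  have := hmo 0%N; rewrite inE eqxx mo0 => /(_ isT); rewrite ltr_norml.
  have := cdf_le n (c p); have := @atom_cdf_ge0 _ _ (w n) (x n) (@w_ge0 n) (c 0%N).
  by rewrite -/(cdf n (c 0%N)); move: e'1; lra.
have P1 : fine (P `]c 0%N, c p]%classic) <= 1.
  by rewrite -lee_fin fineK ?fin_num_measure // probability_le1.
have w0 : 0 <= lip * (2 * d) by rewrite mulr_ge0 // mulr_ge0 // ltW.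
have h1' := le_trans h1 (ler_wpM2l w0 P1).
have h2' := le_trans h2 (ler_wpM2l w0 cdf2).
move: h1' h2' h3 lipd; rewrite /cdf /L /inside.
rewrite ![_ * 2 as X in _ <= X]mulrC !ler_norml mulr1.
move: (\int[P]_(y in _) _) (atom_sum _ _ _) => I1 I2.
move: (\sum_(i < p) _ * fine _) (\sum_(i < p) _ * (_ - _)) => S1 S2.
by move: (lip * (2 * d)) => W; lra.
Qed.

Let even_interval k (K : nat) :
  (\int[P]_(y in `](- (K%:R : R))%R, K%:R%R]) ((y : R) ^+ k.*2)%:E <= (mo k.*2)%:E)%E.
Proof.
apply/lee_addgt0Pr => e e0; have e20 : 0 < e / 2 by rewrite divr_gt0.
have [a [b [n [aK Kb h1 h2]]]] := interval_moment k.*2 K [:: k.*2] e20.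
apply: (@le_trans _ _ (\int[P]_(y in `]a, b]) ((y : R) ^+ k.*2)%:E)%E).
  apply: ge0_subset_integral => //.
  - by apply/measurable_EFinP; exact: measurable_expr.
  - by move=> y _; rewrite lee_fin expr_even_ge0.
  - by move=> y /=; rewrite !in_itv /= => /andP[y1 y2]; rewrite (le_lt_trans aK y1) (le_trans y2 Kb).
have ck : continuous (fun y : R => y ^+ k.*2) by exact: exprn_continuous.
have mI : measurable (`]a, b]%classic : set (measurableTypeR R)) by [].
have fin := integrable_fin_num mI (integrable_bounded_itv P ck a b).
rewrite -(fineK fin) -EFinD lee_fin.
have le1 : L n (fun y => y ^+ k.*2 * inside a b y) <= L n (fun y => y ^+ k.*2).
  by apply: atom_sum_le => // y; rewrite ler_piMr ?expr_even_ge0 // /inside lern1 leq_b1.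
have := h2 k.*2; rewrite inE eqxx => /(_ isT).
by move: h1; rewrite /Rintegral ltr_norml ler_norml; lra.
Qed.

Let atom_tail n k a b (K : R) : 1 <= K -> a <= - K -> K <= b ->
  `|L n (fun y => y ^+ k * inside a b y) - L n (fun y => y ^+ k)| <=
  K^-1 * L n (fun y => y ^+ k.+1.*2).
Proof.
move=> K1 aK Kb; rewrite -atom_sumZ.
have out y : `|y ^+ k * inside a b y - y ^+ k| <= K^-1 * y ^+ k.+1.*2.
  rewrite /inside; case: (boolP (a < y <= b)) => hy.
    by rewrite mulr1 subrr normr0 mulr_ge0 ?expr_even_ge0 // invr_ge0 (le_trans _ K1).
  rewrite mulr0 sub0r normrN mulrC; apply: expr_tail => //.
  rewrite leNgt ltr_norml; apply: contra hy => /andP[y1 y2].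
  by rewrite (le_lt_trans aK y1) (le_trans (ltW y2) Kb).
pose f1 y := K^-1 * y ^+ k.+1.*2; pose f2 y := y ^+ k * inside a b y; pose f3 (y : R) := y ^+ k.
have h1 : L n f3 <= atom_sum (w n) (x n) (f1 \+ f2).
  by apply: atom_sum_le => // y /=; have := out y; rewrite ler_norml /f1 /f2 /f3; lra.
have h2 : L n f2 <= atom_sum (w n) (x n) (f1 \+ f3).
  by apply: atom_sum_le => // y /=; have := out y; rewrite ler_norml /f1 /f2 /f3; lra.
move: h1 h2; rewrite !atom_sumD -/f1 -/f2 -/f3 -!/(L n _).
by move: (L n f1) (L n f2) (L n f3) => X Y Z; rewrite ler_norml; lra.
Qed.

Let limit_moments : has_moments P /\ forall k, moment P k = mo k.
Proof.
have [hm le2] := even_moments_le even_interval; split=> // k.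
apply/eqP; rewrite -subr_eq0 -normr_le0; apply/ler_addgt0Pr => e e0; rewrite add0r.
pose e1 := e / 4; have e10 : 0 < e1 by rewrite divr_gt0.
pose B := 2 * mo k.+1.*2 + e1.
have B0 : 0 <= B by rewrite addr_ge0 ?(ltW e10) // mulr_ge0 // even_moment_ge0.
pose K := (Num.truncn (B / e1)).+1.
have K1 : 1 <= K%:R :> R by rewrite ler1n.
have K0 : 0 < K%:R :> R by rewrite ltr0n.
have BK : B / K%:R <= e1.
  rewrite ler_pdivrMr // [e1 * _]mulrC -ler_pdivrMr //.
  by apply: ltW; exact: truncnS_gt.
have [a [b [n [aK Kb h1 h2]]]] := interval_moment k K [:: k; k.+1.*2] e10.
have h3 := moment_tail k hm K1 aK Kb.
have h4 := @atom_tail n k a b K%:R K1 aK Kb.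
have := h2 k; have := h2 k.+1.*2; rewrite !inE !eqxx !orbT => /(_ isT) h5 /(_ isT) h6.
have h7 : moment P k.+1.*2 / K%:R <= mo k.+1.*2 / K%:R.
  by rewrite ler_wpM2r ?le2 // invr_ge0 ltW.
have h8 : K%:R^-1 * L n (fun y => y ^+ k.+1.*2) <= K%:R^-1 * (mo k.+1.*2 + e1).
  by rewrite ler_wpM2l ?invr_ge0 ?(ltW K0) //; move: h5; rewrite ltr_norml; lra.
have h9 : mo k.+1.*2 / K%:R + K%:R^-1 * (mo k.+1.*2 + e1) <= e1.
  by apply: le_trans BK; rewrite /B; lra.
have eE : e = 4 * e1 by rewrite /e1; lra.
move: h1 h3 h4 h6 h7 h8 h9; rewrite eE !ler_norml ltr_norml /=.
move: (L n (fun y => y ^+ k.+1.*2)) (K%:R^-1 * L n _) => X Y.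
move: (_ / _) (K%:R^-1 * _) (moment P k.+1.*2 / K%:R) => Z T U.
by move: (\int[P]_(y in _) _) (L n _) (L n _) => I1 I2 I3; lra.
Qed.

Lemma cluster_moments : has_moments P /\ forall k, moment P k = mo k.
Proof. exact: limit_moments. Qed.

End Moments.
End Limit.

Lemma atoms_hamburger : exists P : probability (measurableTypeR R) R,
  has_moments P /\ forall k, moment P k = mo k.
Proof.
have [G hG] := pointwise_cluster cdf_bounded.
by have [P hP] := cluster_measure hG; exists P; exact: cluster_moments hP.
Qed.

End Atoms.

(** Quadrature gives atomic measures whose moments converge; their
    distribution functions have a pointwise cluster function, whose
    regularisation is the distribution function of a law. Tails being
    controlled by moments of higher order, moments pass to the limit. *)
Theorem hamburger : exists P : probability (measurableTypeR R) R,
  has_moments P /\ forall k, moment P k = mo k.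
Proof.
by have [w [x [w0 wx]]] := approximate_quadrature mo_psd; exact: atoms_hamburger w0 wx.
Qed.

End Hamburger.

(** * Determinacy under Gaussian growth of the moments *)

Section CosTaylor.
Variable R : realType.

Lemma is_derive_nondecreasing (f f' : R -> R) (a b : R) : a <= b ->
  (forall x : R, is_derive x (1 : R) f (f' x)) -> (forall x, a <= x <= b -> 0 <= f' x) -> f a <= f b.
Proof.
move=> ab df f'0; have d x : derivable f x 1 by have [] := df x.
apply: (@ger0_derive1_ndecr _ f a b) => //.
- move=> x; rewrite in_itv /= => /andP[xa xb].
  have h := df x; rewrite derive1E derive_val; apply: f'0.
  by rewrite (ltW xa) (ltW xb).
- by apply: derivable_within_continuous => x _.
Qed.

(** Taylor polynomial in [x] of [cos (th + s * x)]: the [k]-th derivative of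
    cosine is its translate by [k * (pi / 2)]. *)
Definition cos_poly n (th s : R) : {poly R} :=
  \poly_(k < n) (cos (th + k%:R * (pi / 2)) * s ^+ k / k`!%:R).

Lemma deriv_cos_poly n th s :
  (cos_poly n.+1 th s)^`() = s *: cos_poly n (th + pi / 2) s.
Proof.
apply/polyP => k; rewrite coef_deriv coefZ !coef_poly ltnS.
case: ifP => _; last by rewrite mul0rn mulr0.
have -> : th + k.+1%:R * (pi / 2) = th + pi / 2 + k%:R * (pi / 2) by rewrite -natr1; ring.
rewrite -[LHS]mulr_natr factS natrM exprS -[k.+1%:R]natr1.
have : k`!%:R != 0 :> R by rewrite pnatr_eq0 -lt0n fact_gt0.
have : k%:R + 1 != 0 :> R by rewrite natr1 pnatr_eq0.
set c := cos _; move: c (k`!%:R) (k%:R) (s ^+ k) => c f m z h1 h2.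
by field; rewrite h1 h2.
Qed.

(** Induction on [n] for all phases at once, since deriving shifts the phase by
    [pi / 2]. *)
Lemma cos_taylor_ge0 n (th s y : R) : `|s| <= 1 -> 0 <= y ->
  `|cos (th + s * y) - (cos_poly n th s).[y]| <= y ^+ n / n`!%:R.
Proof.
move=> s1; elim: n th y => [|n IH] th y y0.
  have -> : cos_poly 0 th s = 0 by apply/polyP => k; rewrite coef_poly coef0.
  by rewrite horner0 subr0 expr0 fact0 divr1 cos_max.
pose g (y : R) := cos (th + s * y) - (cos_poly n.+1 th s).[y].
pose g' (y : R) := s * (cos ((th + pi / 2) + s * y) - (cos_poly n (th + pi / 2) s).[y]).
have dg (x : R) : is_derive x (1 : R) g (g' x).
  have d1 : is_derive x (1 : R) (fun y : R => th + s * y) s.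
    have := is_deriveD (is_derive_cst th x 1) (is_deriveZ s (is_derive_id x (1 : R))).
    by rewrite add0r scaler1.
  have d2 := @is_derive1_comp R cos (fun y : R => th + s * y) x _ _ (is_derive_cos (th + s * x)) d1.
  have d3 := is_derive_poly (cos_poly n.+1 th s) x.
  have d4 := is_deriveB d2 d3; apply: (is_derive_eq d4).
  by rewrite deriv_cos_poly hornerZ /g' [th + pi / 2 + _]addrAC cosDpihalf mulrBr mulrC.
pose p (y : R) := y ^+ n.+1 / n.+1`!%:R.
have dp (x : R) : is_derive x (1 : R) p (x ^+ n / n`!%:R).
  have pE : p = n.+1`!%:R^-1 \*: horner ('X^(n.+1) : {poly R}).
    by apply/funext => z; rewrite /p /= hornerXn mulrC.
  rewrite pE; apply: (is_derive_eq (is_deriveZ _ (is_derive_poly ('X^(n.+1)) x))).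
  rewrite derivXn hornerMn hornerXn factS natrM /GRing.scale /= -[_ ^+ _ *+ _]mulr_natl.
  have : n.+1%:R != 0 :> R by rewrite pnatr_eq0.
  have : n`!%:R != 0 :> R by rewrite pnatr_eq0 -lt0n fact_gt0.
  by move: (n`!%:R) (n.+1%:R) => f m h1 h2; field; rewrite h1 h2.
have g0 : g 0 = 0.
  rewrite /g mulr0 addr0 horner_coef0 coef_poly /= mul0r addr0 expr0 fact0.
  by rewrite mulr1 divr1 subrr.
have p0 : p 0 = 0 by rewrite /p expr0n mul0r.
have bd x : 0 <= x -> `|g' x| <= x ^+ n / n`!%:R.
  by move=> x0; rewrite normrM; apply: le_trans (IH (th + pi / 2) _ x0); rewrite ler_piMl.
have up : (p - g) 0 <= (p - g) y.
  apply: (is_derive_nondecreasing y0 (fun x => is_deriveB (dp x) (dg x))) => x /andP[x0 _].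
  by rewrite subr_ge0; apply: le_trans (bd x x0); exact: ler_norm.
have lo : (p + g) 0 <= (p + g) y.
  apply: (is_derive_nondecreasing y0 (fun x => is_deriveD (dp x) (dg x))) => x /andP[x0 _].
  by have := bd x x0; rewrite ler_norml; lra.
move: up lo; rewrite !fctE g0 p0 /p -/(g y) ler_norml; lra.
Qed.

Lemma cos_taylor n (th t x : R) :
  `|cos (th + t * x) - (cos_poly n.*2 th t).[x]| <= (t * x) ^+ n.*2 / n.*2`!%:R.
Proof.
have [s [s1 sE]] : exists s : R, `|s| <= 1 /\ t * x = s * `|t * x|.
  exists (Num.sg (t * x)); split; last by rewrite -numEsg.
  by rewrite normr_sg lern1 leq_b1.
have := @cos_taylor_ge0 n.*2 th s `|t * x| s1 (normr_ge0 _).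
rewrite -sE -normrX (ger0_norm (expr_even_ge0 _ _)).
rewrite (_ : (cos_poly _ _ _).[_] = (cos_poly n.*2 th t).[x]) //.
rewrite !horner_poly; apply: eq_bigr => k _.
have : (s * `|t * x|) ^+ k = (t * x) ^+ k by rewrite -sE.
rewrite !exprMn; set c := cos _.
move: c (k`!%:R^-1) (s ^+ k) (`|t * x| ^+ k) (t ^+ k) (x ^+ k) => c f a b d e h.
by transitivity (c * f * (a * b)); [ring|rewrite h; ring].
Qed.

End CosTaylor.

Section Bernstein.
Variable R : realType.

(** Polynomials in [u] converging on [0, 1], except at [u = 1/2], to the
    indicator of [u < 1/2]: Bernoulli's inequality bounds them on both sides, as
    in a classical proof of the Weierstrass theorem. *)
Definition soft_step n (u : R) : R := (1 - u ^+ n) ^+ (2 ^ n).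

Lemma bernoulli_lower (a : R) k : 0 <= a <= 1 -> 1 - k%:R * a <= (1 - a) ^+ k.
Proof.
move=> /andP[a0 a1]; elim: k => [|k IH]; first by rewrite mul0r subr0 expr0.
have b0 : 0 <= 1 - a by rewrite subr_ge0.
rewrite exprS; apply: le_trans (ler_wpM2l b0 IH); rewrite -natr1.
have : 0 <= k%:R * a * a by rewrite !mulr_ge0.
by nra.
Qed.

Lemma bernoulli_upper (a : R) k : 0 <= a <= 1 -> (1 - a) ^+ k * (1 + k%:R * a) <= 1.
Proof.
move=> /andP[a0 a1]; elim: k => [|k IH]; first by rewrite mul0r addr0 mul1r.
have b0 : 0 <= (1 - a) ^+ k by rewrite exprn_ge0 // subr_ge0.
apply: le_trans IH; rewrite exprSr -mulrA; apply: ler_wpM2l => //; rewrite -natr1.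
have : 0 <= k%:R * a * a by rewrite !mulr_ge0.
have : 0 <= a * a by rewrite mulr_ge0.
by nra.
Qed.

Lemma expr_itv (u : R) n : 0 <= u <= 1 -> 0 <= u ^+ n <= 1.
Proof. by move=> /andP[u0 u1]; rewrite exprn_ge0 // exprn_ile1. Qed.

Lemma soft_step_itv n u : 0 <= u <= 1 -> 0 <= soft_step n u <= 1.
Proof.
move=> /expr_itv-/(_ n) /andP[a0 a1]; apply: expr_itv.
by rewrite subr_ge0 a1 lerBlDr lerDl.
Qed.

Lemma soft_step_lo u : 0 <= u < 1 / 2 -> soft_step ^~ u @ \oo --> (1 : R).
Proof.
move=> /andP[u0 u1]; have u01 : 0 <= u <= 1 by lra.
apply: (@squeeze_cvgr _ _ _ _ (fun n => 1 - (2 * u) ^+ n) (cst 1)).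
- near=> n; have /andP[_ ->] := soft_step_itv n u01; rewrite andbT.
  by have := bernoulli_lower (2 ^ n) (expr_itv n u01); rewrite natrX -exprMn.
- rewrite -[X in _ --> X](subr0 1); apply: cvgB; first exact: cvg_cst.
  by apply: cvg_expr; rewrite ger0_norm; lra.
- exact: cvg_cst.
Unshelve. all: by end_near.
Qed.

Lemma soft_step_hi u : 1 / 2 < u <= 1 -> soft_step ^~ u @ \oo --> (0 : R).
Proof.
move=> /andP[u0 u1]; have u01 : 0 <= u <= 1 by lra.
apply: (@squeeze_cvgr _ _ _ _ (cst 0) (fun n => ((2 * u)^-1) ^+ n)).
- near=> n; have /andP[-> _] := soft_step_itv n u01 => /=.
  have := bernoulli_upper (2 ^ n) (expr_itv n u01); rewrite natrX -exprMn.
  have pos : 0 < (2 * u) ^+ n by rewrite exprn_gt0 //; lra.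
  rewrite -/(soft_step n u) exprVn -[_^-1]mul1r ler_pdivlMr //; apply: le_trans.
  rewrite ler_wpM2l //; last by rewrite lerDr.
  by have /andP[] := soft_step_itv n u01.
- exact: cvg_cst.
- apply: cvg_expr; rewrite ger0_norm ?invr_ge0; last lra.
  by rewrite invf_lt1; lra.
Unshelve. all: by end_near.
Qed.

(** Antisymmetrising removes the limit value at the threshold. *)
Lemma soft_sign (s : R) : `|s| <= 1 ->
  (fun n => soft_step n (2^-1 + - 2^-1 * s) - soft_step n (2^-1 + 2^-1 * s)) @ \oo --> Num.sg s.
Proof.
rewrite ler_norml => /andP[s0 s1]; have [sN|sP|s_0] := ltgtP s 0.
- rewrite ltr0_sg // -[X in _ --> X]sub0r; apply: cvgB.
    by apply: soft_step_hi; lra.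
  by apply: soft_step_lo; lra.
- rewrite gtr0_sg // -[X in _ --> X]subr0; apply: cvgB.
    by apply: soft_step_lo; lra.
  by apply: soft_step_hi; lra.
- rewrite s_0 sgr0 !mulr0; under eq_fun do rewrite subrr; exact: cvg_cst.
Qed.

End Bernstein.

Section Determinacy.
Variables (R : realType) (mu nu : probability (measurableTypeR R) R).

Definition same_integral (f : R -> R) : Prop :=
  [/\ measurable_fun setT (f : measurableTypeR R -> R),
      exists M, forall x, `|f x| <= M
    & Rintegral mu setT f = Rintegral nu setT f].

Lemma bounded_integrable (P : probability (measurableTypeR R) R) (f : R -> R) :
  measurable_fun setT (f : measurableTypeR R -> R) -> (exists M, forall x, `|f x| <= M) ->
  P.-integrable setT (EFin \o f).
Proof.
move=> mf [M hM]; apply: measurable_bounded_integrable => //.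
  by rewrite (le_lt_trans (probability_le1 _ _)) ?ltry.
by exists M; split=> [|y My x _]; [exact: num_real|apply: le_trans (hM x) (ltW My)].
Qed.

Lemma same_integralD f g : same_integral f -> same_integral g -> same_integral (fun x => f x + g x).
Proof.
move=> [mf [M bf] ef] [mg [M' bg] eg]; split.
- exact: measurable_funD.
- by exists (M + M') => x; apply: le_trans (ler_normD _ _) _; exact: lerD.
- rewrite !RintegralD // ?ef ?eg //; apply: bounded_integrable => //; by [exists M|exists M'].
Qed.

Lemma same_integralZ c f : same_integral f -> same_integral (fun x => c * f x).
Proof.
move=> [mf [M bf] ef]; split.
- exact: measurable_funM.
- by exists (`|c| * M) => x; rewrite normrM ler_wpM2l.
- by rewrite !RintegralZl // ?ef //; apply: bounded_integrable => //; exists M.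
Qed.

(** Dominated convergence. *)
Lemma same_integral_lim (f : nat -> R -> R) g M : (forall n, same_integral (f n)) ->
  (forall n x, `|f n x| <= M) -> (forall x, f ^~ x @ \oo --> g x) -> same_integral g.
Proof.
move=> hf fM fg.
have mg : measurable_fun setT (g : measurableTypeR R -> R).
  by apply: (@measurable_fun_cvg _ _ _ _ f) => [m|x _]; [have [] := hf m|exact: fg].
have bg x : `|g x| <= M.
  have h : (fun n => `|f n x|) @ \oo --> `|g x| by apply: cvg_norm; exact: fg.
  rewrite -(cvg_lim _ h) //; apply: limr_le; first by apply/cvg_ex; exists `|g x|.
  by near=> n; exact: fM.
split=> //; first by exists M.
have lim (P : probability (measurableTypeR R) R) :
    (fun n => Rintegral P setT (f n)) @ \oo --> Rintegral P setT g.
  have [] := @dominated_convergence _ _ R P setT measurableT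
    (fun n => EFin \o f n) (EFin \o g) (EFin \o cst M).
  - by move=> n; apply/measurable_EFinP; have [] := hf n.
  - by apply/measurable_EFinP.
  - by apply: aeW => x _; apply: cvg_EFin; [near=> n|exact: fg].
  - by apply: finite_measure_integrable_cst.
  - by apply: aeW => x n _; rewrite lee_fin fM.
  move=> ig _ h; apply: fine_cvg; rewrite fineK //.
  by apply: integrable_fin_num ig.
have := lim mu; have -> : (fun n => Rintegral mu setT (f n)) = (fun n => Rintegral nu setT (f n)).
  by apply/funext => n; have [_ _] := hf n.
by move=> h; apply: (cvg_unique _ h (lim nu)).
Unshelve. all: by end_near.
Qed.

(** Being stable under multiplication by cosines, unlike having the same
    integral, makes the class closed under products with trigonometric
    polynomials. *)
Definition trig_stable (f : R -> R) : Prop :=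
  forall th t : R, same_integral (fun x => f x * cos (th + t * x)).

Lemma trig_stable_same f : trig_stable f -> same_integral f.
Proof.
move=> /(_ 0 0); congr same_integral; apply/funext => x.
by rewrite mul0r addr0 cos0 mulr1.
Qed.

Lemma trig_stableD f g : trig_stable f -> trig_stable g -> trig_stable (fun x => f x + g x).
Proof.
move=> hf hg th t; have := same_integralD (hf th t) (hg th t).
by congr same_integral; apply/funext => x; rewrite mulrDl.
Qed.

Lemma trig_stableZ c f : trig_stable f -> trig_stable (fun x => c * f x).
Proof.
move=> hf th t; have := same_integralZ c (hf th t).
by congr same_integral; apply/funext => x; rewrite mulrA.
Qed.

Lemma trig_stable_cos f ph s : trig_stable f -> trig_stable (fun x => f x * cos (ph + s * x)).
Proof.
move=> hf th t.
have := same_integralZ 2^-1 (same_integralD (hf (ph + th) (s + t)) (hf (ph - th) (s - t))).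
congr same_integral; apply/funext => x.
have -> : ph + th + (s + t) * x = (ph + s * x) + (th + t * x) by ring.
have -> : ph - th + (s - t) * x = (ph + s * x) - (th + t * x) by ring.
move: (ph + s * x) (th + t * x) (f x) => a b y; rewrite cosD cosB.
by move: (cos a) (sin a) (cos b) (sin b) => p1 p2 p3 p4; field.
Qed.

Section Polynomials.
Variables ph s c d : R.
Let u x := c + d * cos (ph + s * x).

Lemma trig_stable_u f n : trig_stable f -> trig_stable (fun x => f x * u x ^+ n).
Proof.
elim: n f => [|n IH] f hf.
  by move: hf; congr trig_stable; apply/funext => x; rewrite expr0 mulr1.
have := IH _ (trig_stableD (trig_stableZ c hf) (trig_stableZ d (trig_stable_cos ph s hf))).
by congr trig_stable; apply/funext => x; rewrite exprS /u; ring.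
Qed.

Lemma trig_stable_soft_step n : trig_stable (cst 1) -> trig_stable (fun x => soft_step n (u x)).
Proof.
rewrite /soft_step; move: (2 ^ n)%N => k h1; elim: k => [|k IH].
  by move: h1; congr trig_stable; apply/funext => x; rewrite expr0.
have := trig_stableD IH (trig_stableZ (-1) (trig_stable_u n IH)).
by congr trig_stable; apply/funext => x; rewrite [in RHS]exprS; ring.
Qed.

End Polynomials.

Hypothesis trig1 : trig_stable (cst 1).

Lemma same_sign_sin t b : same_integral (fun x => Num.sg (sin (t * (x - b)))).
Proof.
have E x : cos (- (t * b) - pi / 2 + t * x) = sin (t * (x - b)).
  by rewrite -cosBpihalf; congr cos; ring.
apply: (@same_integral_lim (fun n x => soft_step n (2^-1 + - 2^-1 * sin (t * (x - b)))
   - soft_step n (2^-1 + 2^-1 * sin (t * (x - b)))) _ 1).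
- move=> n; apply: trig_stable_same.
  have h e := trig_stable_soft_step (- (t * b) - pi / 2) t 2^-1 e n trig1.
  have := trig_stableD (h (- 2^-1)) (trig_stableZ (-1) (h 2^-1)).
  by congr trig_stable; apply/funext => x; rewrite !E mulN1r.
- move=> n x; have := sin_max (t * (x - b)); rewrite ler_norml => /andP[s0 s1].
  have /andP[a1 a2] : 0 <= soft_step n (2^-1 + - 2^-1 * sin (t * (x - b))) <= 1.
    by apply: soft_step_itv; lra.
  have /andP[b1 b2] : 0 <= soft_step n (2^-1 + 2^-1 * sin (t * (x - b))) <= 1.
    by apply: soft_step_itv; lra.
  rewrite ler_norml; move: a1 a2 b1 b2.
  by move: (soft_step _ _) (soft_step _ _) => p1 p2 *; lra.
- by move=> x; apply: soft_sign; exact: sin_max.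
Qed.

Lemma normr_sg_le1 (z : R) : `|Num.sg z| <= 1.
Proof. by rewrite normr_sg lern1 leq_b1. Qed.

(** The square wave [sg (sin (t * (x - b)))] converges to [sg (x - b)] as its
    period grows. *)
Lemma same_sign b : same_integral (fun x => Num.sg (x - b)).
Proof.
apply: (@same_integral_lim (fun n x => Num.sg (sin (n.+1%:R^-1 * (x - b)))) _ 1).
- by move=> n; exact: same_sign_sin.
- by move=> n x; exact: normr_sg_le1.
- move=> x; apply: cvg_near_cst; near=> n.
  have n0 : 0 < n.+1%:R :> R by rewrite ltr0n.
  have npi : `|x - b| < n.+1%:R * pi.
    rewrite -ltr_pdivrMr ?pi_gt0 //; apply: (lt_trans (truncnS_gt _)).
    by rewrite ltr_nat ltnS; near: n; exact: nbhs_infty_gt.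
  have [xN|xP|x_0] := ltgtP (x - b) 0.
  + rewrite (ltr0_sg xN) -[x - b]opprK mulrN sinN; apply: ltr0_sg.
    rewrite oppr_lt0; apply: sin_gt0_pi; rewrite mulr_gt0 ?invr_gt0 ?oppr_gt0 //=.
    by rewrite mulrC ltr_pdivrMr // mulrC -ltr0_norm.
  + rewrite (gtr0_sg xP); apply: gtr0_sg.
    apply: sin_gt0_pi; rewrite mulr_gt0 ?invr_gt0 //=.
    by rewrite mulrC ltr_pdivrMr // mulrC -(gtr0_norm xP).
  + by rewrite x_0 mulr0 sin0.
Unshelve. all: by end_near.
Qed.

(** Approaching [b] from the right turns the sign into a step that includes
    [b]. *)
Lemma same_ray b : same_integral (fun x => if x <= b then -1 else 1).
Proof.
apply: (@same_integral_lim (fun n x => Num.sg (x - (b + n.+1%:R^-1))) _ 1).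
- by move=> n; exact: same_sign.
- by move=> n x; exact: normr_sg_le1.
- move=> x; apply: cvg_near_cst; near=> n.
  have n0 : 0 < n.+1%:R :> R by rewrite ltr0n.
  case: (lerP x b) => xb.
    apply: ltr0_sg; have : 0 < n.+1%:R^-1 :> R by rewrite invr_gt0.
    by move: (n.+1%:R^-1) => z; lra.
  apply: gtr0_sg; have : n.+1%:R^-1 < x - b; last by move: (n.+1%:R^-1) => z; lra.
  rewrite invf_plt ?posrE ?subr_gt0 //; apply: lt_trans (truncnS_gt _) _.
  by rewrite ltr_nat ltnS; near: n; exact: nbhs_infty_gt.
Unshelve. all: by end_near.
Qed.

(** Indicators of the intervals ]a, b] are differences of steps, and these
    intervals generate the Borel sets. *)
Lemma same_measure (D : set (measurableTypeR R)) : measurable D -> nu D = mu D.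
Proof.
apply: (@measure_unique _ R (measurableTypeR R) (@ocitv R) (fun k => `](- k%:R), k%:R]%classic)
  _ _ _ _ nu mu) => //.
- by move=> A B; exact: ocitvI.
- by move=> k; exact: is_ocitv.
- by apply/seteqP; split=> // y _; exists (Num.truncn `|y|).+1 => //=;
    have := truncnS_gt `|y|; rewrite in_itv /= ltr_norml => /andP[-> /ltW ->].
- move=> A [[a b] _ <-] /=.
  have [ab|ba] := lerP a b; last by rewrite set_itv_ge ?measure0 // bnd_simp -leNgt ltW.
  have [_ _ e] := same_integralZ 2^-1 (same_integralD (same_ray a) (same_integralZ (-1) (same_ray b))).
  have indE (P : probability (measurableTypeR R) R) : P `]a, b]%classic = (Rintegral P setT (fun x =>
      2^-1 * ((if x <= a then -1 else 1) + -1 * (if x <= b then -1 else 1))))%:E.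
    rewrite (_ : (fun x => _) = \1_(`]a, b]%classic)).
      by rewrite /Rintegral integral_indic // setIT fineK // fin_num_measure.
    apply/funext => x; rewrite indicE mem_setE in_itv /= ltNge.
    case: (lerP x a) => xa /=; first by rewrite (le_trans xa ab); lra.
    by case: (lerP x b) => xb /=; lra.
  by rewrite !indE e.
- by move=> k; rewrite (le_lt_trans (probability_le1 _ _)) ?ltry.
Qed.

End Determinacy.

Section Growth.
Variable R : realType.
Implicit Type P : probability (measurableTypeR R) R.

Lemma integral_poly P (p : {poly R}) : has_moments P ->
  P.-integrable setT (EFin \o horner p) /\
  Rintegral P setT (horner p) = \sum_(k < size p) p`_k * moment P k.
Proof.
move=> hP; have -> : horner p = (fun x : R => \sum_(k < size p) p`_k * x ^+ k).
  by apply/funext => x; rewrite horner_coef.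
elim: (size p) => [|n [IH1 IH2]].
  have -> : (fun x : R => \sum_(k < 0) p`_k * x ^+ k) = cst 0.
    by apply/funext => x; rewrite big_ord0.
  rewrite big_ord0; split; first by apply: finite_measure_integrable_cst.
  by rewrite (Rintegral_cst P measurableT) mul0r.
have -> : (fun x : R => \sum_(k < n.+1) p`_k * x ^+ k) =
    (fun x => \sum_(k < n) p`_k * x ^+ k + p`_n * x ^+ n).
  by apply/funext => x; rewrite big_ord_recr.
have i2 : P.-integrable setT (EFin \o (fun x : R => p`_n * x ^+ n)).
  by rewrite /comp; under eq_fun do rewrite EFinM; apply: integrableZl => //; exact: hP.
rewrite RintegralD // big_ord_recr IH2 /=; split; last by rewrite RintegralZl //; exact: hP.
by have := integrableD measurableT IH1 i2; apply: eq_integrable => // y _; rewrite /= EFinD.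
Qed.

Lemma measurable_cos_affine (th t : R) :
  measurable_fun setT ((fun x => cos (th + t * x)) : measurableTypeR R -> R).
Proof.
apply: measurable_realfun.continuous_measurable_fun => x.
apply: (@continuous_comp _ _ _ (fun x : R => th + t * x) cos); last exact: continuous_cos.
by apply: cvgD; [exact: cvg_cst|apply: cvgM; [exact: cvg_cst|exact: cvg_id]].
Qed.

(** The remainder of order [2n] of the Taylor expansion is bounded by an even
    power, whose integral is a moment. *)
Lemma cos_moments P (th t : R) n : has_moments P ->
  `|Rintegral P setT (fun x => cos (th + t * x)) -
    \sum_(k < size (cos_poly n.*2 th t)) (cos_poly n.*2 th t)`_k * moment P k|
  <= t ^+ n.*2 * moment P n.*2 / n.*2`!%:R.
Proof.
move=> hP; have [ip <-] := integral_poly (cos_poly n.*2 th t) hP.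
have ic : P.-integrable setT (EFin \o (fun x : R => cos (th + t * x))).
  by apply: bounded_integrable; [exact: measurable_cos_affine|exists 1 => x; exact: cos_max].
rewrite -RintegralB //.
have id : P.-integrable setT (EFin \o (fun x : R => cos (th + t * x) - (cos_poly n.*2 th t).[x])).
  by have := integrableB measurableT ic ip; apply: eq_integrable => // y _; rewrite /= EFinB.
apply: le_trans (le_normr_Rintegral measurableT id) _.
rewrite mulrAC -RintegralZl //; last exact: hP.
apply: le_Rintegral => //.
- exact: integrable_norm id.
- by rewrite /comp; under eq_fun do rewrite EFinM; apply: integrableZl => //; exact: hP.
- by move=> x _; apply: le_trans (cos_taylor n th t x) _; rewrite exprMn mulrAC.
Qed.

(** The Taylor remainders of [cos (th + t * x)] have integrals at most
    [(t ^ 2 * B) ^ n / n!], a vanishing sequence; hence two laws with these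
    moments give the same integrals to cosines. *)
Theorem moment_determined_growth P (B : R) : has_moments P ->
  (forall n, moment P n.*2 * n`!%:R <= B ^+ n * n.*2`!%:R) -> moment_determined P.
Proof.
move=> hP growth nu hnu hmo D mD; apply: same_measure mD => th t.
have -> : (fun x : R => cst 1 x * cos (th + t * x)) = (fun x : R => cos (th + t * x)).
  by apply/funext => x; rewrite mul1r.
split; [exact: measurable_cos_affine|by exists 1 => x; exact: cos_max|].
apply/eqP; rewrite -subr_eq0 -normr_le0; apply/ler_addgt0Pr => e e0; rewrite add0r.
have small : (fun n => 2 * exp_coeff (t ^+ 2 * B) n) @ \oo --> (0 : R).
  rewrite -(mulr0 2); apply: cvgMr; apply: cvg_series_cvg_0; exact: is_cvg_series_exp_coeff.
have /cvgrPdist_lt/(_ e e0) [n _ /(_ n (leqnn n))] := small.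
rewrite sub0r normrN => /ltW hn; apply: le_trans hn; apply: le_trans (ler_norm _).
have h1 := cos_moments th t n hP; have h2 := cos_moments th t n hnu.
have bd : t ^+ n.*2 * moment P n.*2 / n.*2`!%:R <= exp_coeff (t ^+ 2 * B) n.
  rewrite /exp_coeff /= [(t ^+ 2 * B) ^+ n]exprMn ler_pdivrMr ?ltr0n ?fact_gt0 //.
  rewrite [leRHS]mulrAC ler_pdivlMr ?ltr0n ?fact_gt0 // -exprM mul2n -!mulrA.
  by rewrite ler_wpM2l ?expr_even_ge0.
move: h2; rewrite hmo; under eq_bigr do rewrite hmo.
move: h1; set S := \sum_(k < _) _; move: S (Rintegral P _ _) (Rintegral nu _ _) => S I1 I2.
by move: bd; move: (exp_coeff _ n) (_ / _) => E T; rewrite !ler_norml; lra.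
Qed.

End Growth.

(** * Moments of the normal and semicircle laws *)

Section Density.
Variable R : realType.
Local Notation lambda := (@lebesgue_measure R).

Lemma ftc_itv (F f : R -> R) (a b : R) : a < b -> continuous f -> continuous F ->
  (forall x : R, a < x < b -> is_derive x (1 : R) F (f x)) ->
  \int[lambda]_(x in `]a, b]) f x = F b - F a.
Proof.
move=> ab cf cF dF; have wf : {within `[a, b], continuous f} by exact: continuous_subspaceT.
have dFd : derivable_oo_LRcontinuous F a b.
  split.
  - by move=> x; rewrite in_itv /= => /dF [].
  - by apply: cvg_at_right_filter; exact: cF.
  - by apply: cvg_at_left_filter; exact: cF.
have dFE : {in `]a, b[, F^`()%classic =1 f}.
  by move=> x; rewrite in_itv /= => /dF h; rewrite derive1E derive_val.
rewrite Rintegral_itv_obnd_cbnd.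
  by rewrite /Rintegral (continuous_FTC2 ab wf dFd dFE).
apply: (@integrableS _ _ _ lambda `[a, b]%classic) => //.
  by move=> x /=; rewrite !in_itv /= => /andP[/ltW -> ->].
by apply: continuous_compact_integrable => //; exact: segment_compact.
Qed.

Section Prob.
Variables (P : probability (measurableTypeR R) R) (p : R -> R).
Hypothesis p_meas : measurable_fun setT (p : measurableTypeR R -> R).
Hypothesis p_ge0 : forall x, 0 <= p x.
Hypothesis pE : forall D : set (measurableTypeR R), measurable D ->
  P D = (\int[lambda]_(x in D) (p x)%:E)%E.

(** The density is the Radon-Nikodym derivative. *)
Lemma density_integral U (f : measurableTypeR R -> R) : measurable U ->
  P.-integrable U (EFin \o f) ->
  \int[P]_(x in U) f x = \int[lambda]_(x in U) (f x * p x).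
Proof.
move=> mU fi; have dom : P `<< lambda.
  apply/null_content_dominatesP => D mD D0.
  rewrite [LHS]pE //; apply: null_set_integral => //.
  by apply/measurable_EFinP; exact: measurable_funTS.
have mf := measurable_int _ fi.
rewrite /Rintegral; congr fine; rewrite -(Radon_Nikodym_change_of_variables dom) //=.
apply: ae_eq_integral => //.
- apply: emeasurable_funM => //; apply: (measurable_int lambda).
  apply: (integrableS _ _ (@subsetT _ _)) => //=.
  by apply: Radon_Nikodym_integrable.
- apply/measurable_EFinP; apply: measurable_funM; last exact: measurable_funTS.
  exact/measurable_EFinP.
- rewrite (_ : (fun x => (f x * p x)%:E) = (fun x => (f x)%:E * (p x)%:E)%E); last first.
    by apply/funext => x; rewrite EFinM.
  apply: ae_eqe_mul2l => /=.
  rewrite Radon_NikodymE //=; case: cid => /= h [h1 h2 h3].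
  apply: integral_ae_eq => //=.
  + exact: integrableS h2.
  + by apply/measurable_EFinP; exact: measurable_funTS.
  + by move=> E EU mE; rewrite -h3 //= pE.
Qed.

End Prob.

Lemma density_probability (p : R -> R) : measurable_fun setT (p : measurableTypeR R -> R) ->
  (forall x, 0 <= p x) -> (\int[lambda]_x (p x)%:E = 1)%E ->
  exists P : probability (measurableTypeR R) R, forall D : set (measurableTypeR R),
    measurable D -> P D = (\int[lambda]_(x in D) (p x)%:E)%E.
Proof.
move=> mp p0 p1; pose m := (fun D : set (measurableTypeR R) => \int[lambda]_(x in D) (p x)%:E)%E.
have m0 : m set0 = 0%E by rewrite /m integral_set0.
have m_ge0 D : (0 <= m D)%E by apply: integral_ge0 => x _; rewrite lee_fin.
have ms : semi_sigma_additive m.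
  apply: semi_sigma_additive_nng_induced; first by apply/measurable_EFinP.
  by move=> x; rewrite lee_fin.
pose M := HB.pack_for {measure set (measurableTypeR R) -> \bar R} m (isMeasure.Build _ _ _ m m0 m_ge0 ms).
pose P := HB.pack_for (probability (measurableTypeR R) R) m
  (isMeasure.Build _ _ _ m m0 m_ge0 ms) (Measure_isProbability.Build _ _ _ M p1).
by exists P.
Qed.

End Density.

Section NormalMoments.
Variable R : realType.

Lemma le0_archi (x C : R) : (forall K : nat, (0 < K)%N -> x <= C / K%:R) -> x <= 0.
Proof.
move=> h; apply/ler_addgt0Pr => e e0; rewrite add0r.
apply: le_trans (h (Num.truncn (`|C| / e)).+1 (ltn0Sn _)) _.
rewrite ler_pdivrMr ?ltr0n // [e * _]mulrC -ler_pdivrMr //.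
apply: le_trans (ltW (truncnS_gt _)); by rewrite ler_wpM2r ?invr_ge0 ?ler_norm // ltW.
Qed.

(** From [1 + z <= expR z] at [z = y / (n + 1)]. *)
Lemma expR_decay (y : R) n : 0 < y -> expR (- y) <= n.+1%:R ^+ n.+1 / y ^+ n.+1.
Proof.
move=> y0; have n0 : 0 < n.+1%:R :> R by rewrite ltr0n.
have -> : expR (- y) = (expR (y / n.+1%:R) ^+ n.+1)^-1.
  by rewrite -expRM_natl mulrCA divff ?mulr1 ?gt_eqF // expRN.
rewrite -expr_div_n -exprVn lerXn2r ?nnegrE ?invr_ge0 ?expR_ge0 ?divr_ge0 ?(ltW n0) ?(ltW y0) //.
rewrite -[leRHS]invf_div lef_pV2 ?posrE ?expR_gt0 ?divr_gt0 //.
by apply: le_trans (expR_ge1Dx _); rewrite lerDr.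
Qed.

Variable v : R.
Hypothesis v0 : 0 < v.
Let s := Num.sqrt v.
Let s0 : s != 0. Proof. by rewrite sqrtr_eq0 -ltNge. Qed.
Let s2 : s ^+ 2 = v. Proof. by rewrite sqr_sqrtr // ltW. Qed.
Let P : probability (measurableTypeR R) R := normal_prob 0 s.
Let p : R -> R := normal_pdf 0 s.
Let c := normal_peak s.

Let pE x : p x = c * expR (- (2 * v)^-1 * x ^+ 2).
Proof.
rewrite /p (normal_pdfE _ s0) /normal_fun subr0 s2 -mulr_natl; congr (_ * expR _).
by rewrite mulNr mulNr mulrC.
Qed.

Let c_ge0 : 0 <= c. Proof. exact: normal_peak_ge0. Qed.

Let dp (x : R) : is_derive x (1 : R) p (- (x / v) * p x).
Proof.
have -> : p = c \*: (expR \o horner (- (2 * v)^-1 *: 'X^2)).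
  by apply/funext => z; rewrite pE /= !hornerE.
have d1 := is_derive_poly (- (2 * v)^-1 *: 'X^2) x.
have d2 := is_derive1_comp (is_derive_expR _) d1.
apply: (is_derive_eq (is_deriveZ c d2)).
rewrite derivZ derivXn /= !hornerE /GRing.scale /= -mulr_natl.
move: (expR _) => E; have := v0 => /gt_eqF/negbT vN; field.
by rewrite vN.
Qed.

Let dF k (x : R) : is_derive x (1 : R) (fun x => - v * (x ^+ k.+1 * p x))
  ((x ^+ k.+2 - v * k.+1%:R * x ^+ k) * p x).
Proof.
have -> : (fun x => - v * (x ^+ k.+1 * p x)) = (- v) \*: (horner 'X^(k.+1) * p).
  by apply/funext => z; rewrite /= fctE hornerXn.
apply: (is_derive_eq (is_deriveZ _ (is_deriveM (is_derive_poly 'X^(k.+1) x) (dp x)))).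
rewrite derivXn /= hornerMn !hornerXn /GRing.scale /= -[_ ^+ _ *+ _]mulr_natl !exprS.
by have := v0 => /gt_eqF/negbT vN; field.
Qed.

Let cp : continuous p.
Proof. by move=> x; apply/differentiable_continuous/derivable1_diffP; have [] := dp x. Qed.

Let mp : measurable_fun setT (p : measurableTypeR R -> R).
Proof. exact: measurable_realfun.continuous_measurable_fun. Qed.

Let p_ge0 x : 0 <= p x.
Proof. exact: normal_pdf_ge0. Qed.

Let PE (D : set (measurableTypeR R)) : measurable D ->
  P D = (\int[lebesgue_measure]_(x in D) (p x)%:E)%E.
Proof. by []. Qed.

Let parts (F f : R -> R) (K : R) : 0 < K -> continuous f ->
  (forall x : R, is_derive x (1 : R) F (f x * p x)) ->
  \int[P]_(x in `](- K), K]) f x = F K - F (- K).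
Proof.
move=> K0 cf dFf; have mI : measurable (`](- K), K]%classic : set (measurableTypeR R)) by [].
rewrite (density_integral mp PE mI (integrable_bounded_itv P cf _ _)).
apply: ftc_itv => //; first by lra.
- by move=> x; apply: cvgM; [exact: cf|exact: cp].
- by move=> x; apply/differentiable_continuous/derivable1_diffP; have [] := dFf x.
Qed.

Let I k K := \int[P]_(x in `](- K), K]) (x ^+ k).

Let I_rec k K : 0 < K -> I k.+2 K - v * k.+1%:R * I k K =
   - v * (K ^+ k.+1 * p K) + v * ((- K) ^+ k.+1 * p K).
Proof.
move=> K0; have mI : measurable (`](- K), K]%classic : set (measurableTypeR R)) by [].
have cx j : continuous (fun y : R => y ^+ j) by exact: exprn_continuous.
have ix j := integrable_bounded_itv P (cx j) (- K) K.
have cz : continuous (fun x : R => v * k.+1%:R * x ^+ k).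
  by move=> x; apply: cvgM; [exact: cvg_cst|exact: cx].
have iz := integrable_bounded_itv P cz (- K) K.
rewrite /I -RintegralZl // -RintegralB //.
rewrite (parts K0 _ (dF k)); last first.
  by move=> x; apply: cvgB; [exact: cx|exact: cz].
by rewrite (_ : p (- K) = p K) ?opprK ?mulNr ?opprK // !pE sqrrN.
Qed.

Let e := fix e j := if j is i.+1 then v * (i.*2).+1%:R * e i else 1.

Let e_ge0 j : 0 <= e j.
Proof. by elim: j => //= j IH; rewrite !mulr_ge0 // ltW. Qed.

Let even_bound j (K : R) : 0 < K -> I j.*2 K <= e j.
Proof.
move=> K0; elim: j => [|j IH].
  rewrite /I /=; under eq_Rintegral do rewrite expr0.
  rewrite (Rintegral_cst P) // mul1r -lee_fin fineK ?fin_num_measure //.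
  exact: probability_le1.
have := I_rec j.*2 K0; rewrite exprNn -signr_odd /= odd_double /= expr1 mulN1r mulNr.
have h1 : 0 <= v * (K ^+ j.*2.+1 * p K) by rewrite !mulr_ge0 ?exprn_ge0 ?(ltW v0) ?(ltW K0).
have h2 : v * j.*2.+1%:R * I j.*2 K <= v * j.*2.+1%:R * e j by rewrite ler_wpM2l // mulr_ge0 // ltW.
by rewrite doubleS /= mulrN; lra.
Qed.

Let p_has_moments : has_moments P.
Proof.
suff h k K : (\int[P]_(y in `](- (K%:R : R))%R, K%:R%R]) ((y : R) ^+ k.*2)%:E <= (e k)%:E)%E.
  by have [] := even_moments_le h.
have ck : continuous (fun y : R => y ^+ k.*2) by exact: exprn_continuous.
have mI : measurable (`](- (K%:R : R)), K%:R]%classic : set (measurableTypeR R)) by [].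
have fin := integrable_fin_num mI (integrable_bounded_itv P ck _ _).
rewrite -(fineK fin) lee_fin.
case: K {mI fin} => [|K]; last by apply: even_bound; rewrite ltr0n.
by rewrite oppr0 set_itvoc0 integral_set0.
Qed.

Let p_decay k : exists C, forall K : nat, (0 < K)%N -> K%:R ^+ k.+1 * p K%:R <= C / K%:R.
Proof.
exists (c * (k.+1%:R ^+ k.+1 * (2 * v) ^+ k.+1)) => K K0; have KR : 1 <= K%:R :> R by rewrite ler1n.
have K1 : 0 < K%:R :> R by apply: lt_le_trans KR.
rewrite pE mulrCA -mulrA ler_wpM2l // mulNr.
have y0 : 0 < (2 * v)^-1 * K%:R ^+ 2 by rewrite mulr_gt0 ?invr_gt0 ?mulr_gt0 ?exprn_gt0.
have h := expR_decay k y0.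
have Kn : 0 <= K%:R ^+ k.+1 :> R by rewrite exprn_ge0 // ltW.
apply: le_trans (ler_wpM2l Kn h) _.
have -> : K%:R ^+ k.+1 * (k.+1%:R ^+ k.+1 / ((2 * v)^-1 * K%:R ^+ 2) ^+ k.+1) =
   k.+1%:R ^+ k.+1 * (2 * v) ^+ k.+1 / K%:R ^+ k.+1.
  rewrite exprMn -exprM mulnC exprM !exprVn expr2 !invfM invrK.
  have KnN : (K%:R : R) ^+ k.+1 != 0 by rewrite expf_neq0 ?gt_eqF.
  by move: (k.+1%:R ^+ _) ((2 * v) ^+ _) KnN; move: ((K%:R : R) ^+ k.+1) => a b d aN; field.
rewrite ler_wpM2l ?mulr_ge0 ?exprn_ge0 ?mulr_ge0 // ?(ltW v0) //.
rewrite lef_pV2 ?posrE ?exprn_gt0 // -{1}[K%:R]expr1; exact: ler_weXn2l.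
Qed.

Let norm_moment k (K : nat) : (0 < K)%N -> `|moment P k - I k K%:R| <= moment P k.+1.*2 / K%:R.
Proof. by move=> K0; apply: moment_tail => //; rewrite ler1n. Qed.

Lemma normal_moment1 : moment P 1 = 0.
Proof.
apply/eqP; rewrite -normr_le0; apply: (@le0_archi _ (moment P 2.*2)) => K K0.
have := @norm_moment 1 K K0; rewrite (_ : I 1 K%:R = 0) ?subr0 //.
have cx : continuous (fun y : R => y ^+ 1) by exact: exprn_continuous.
have dd (x : R) : is_derive x (1 : R) (fun x : R => - v * p x) (x ^+ 1 * p x).
  apply: (is_derive_eq (is_deriveZ _ (dp x))).
  by rewrite /GRing.scale /= expr1; have := v0 => /gt_eqF/negbT vN; field.
have K1 : 0 < K%:R :> R by rewrite ltr0n.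
by rewrite /I (parts K1 cx dd) (_ : p (- _) = p K%:R) ?subrr // !pE sqrrN.
Qed.

(** Integration by parts on [-K, K], the density [p] satisfying
    [p' x = - (x / v) * p x]; boundary terms vanish as [K] grows. *)
Lemma normal_moment_rec k : moment P k.+2 = v * k.+1%:R * moment P k.
Proof.
have [C hC] := p_decay k.
apply/eqP; rewrite -subr_eq0 -normr_le0.
apply: (@le0_archi _ (moment P k.+3.*2 + v * k.+1%:R * moment P k.+1.*2 + 2 * v * C)) => K K0.
have K1 : 0 < K%:R :> R by rewrite ltr0n.
have h1 := @norm_moment k.+2 K K0; have h2 := @norm_moment k K K0; have h3 := hC K K0.
have h4 := I_rec k K1.
have a0 : 0 <= v * k.+1%:R by rewrite mulr_ge0 // ltW.
have h5 : `|v * k.+1%:R * (moment P k - I k K%:R)| <= v * k.+1%:R * (moment P k.+1.*2 / K%:R).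
  by rewrite normrM (ger0_norm a0) ler_wpM2l.
have p0 : 0 <= K%:R ^+ k.+1 * p K%:R by rewrite mulr_ge0 ?exprn_ge0 ?(ltW K1).
have h6 : `|- v * (K%:R ^+ k.+1 * p K%:R) + v * ((- K%:R) ^+ k.+1 * p K%:R)| <= 2 * v * (C / K%:R).
  apply: le_trans (ler_normD _ _) _; rewrite !normrM normrN !normrX normrN.
  rewrite (ger0_norm (p_ge0 _)) (ger0_norm (ltW v0)) (ger0_norm (ltW K1)).
  have := ler_wpM2l (ltW v0) h3; lra.
have -> : moment P k.+2 - v * k.+1%:R * moment P k = (moment P k.+2 - I k.+2 K%:R) -
    v * k.+1%:R * (moment P k - I k K%:R) + (I k.+2 K%:R - v * k.+1%:R * I k K%:R) by ring.
rewrite h4 !mulrDl; apply: le_trans (ler_normD _ _) _; apply: lerD; last first.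
  by apply: le_trans h6 _; rewrite -!mulrDl -!mulrA.
apply: le_trans (ler_normB _ _) _; apply: lerD => //.
by apply: le_trans h5 _; rewrite mulrA.
Qed.

Lemma normal_has_moments : has_moments P. Proof. exact: p_has_moments. Qed.

End NormalMoments.

Section Semicircle.
Variables (R : realType) (v : R).
Hypothesis v0 : 0 < v.
Local Notation lambda := (@lebesgue_measure R).
Let r := 2 * Num.sqrt v.
Let r0 : 0 < r. Proof. by rewrite mulr_gt0 // sqrtr_gt0. Qed.
Let r2 : r ^+ 2 = 4 * v.
Proof. by rewrite exprMn sqr_sqrtr ?(ltW v0) // expr2; ring. Qed.
Let vN : v != 0. Proof. by rewrite gt_eqF. Qed.
Let piN : pi != 0 :> R. Proof. by rewrite gt_eqF // pi_gt0. Qed.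
Let s (x : R) : R := Num.sqrt (4 * v - x ^+ 2).
Let p := semicircle_pdf v.

Let p_ge0 x : 0 <= p x.
Proof. by rewrite divr_ge0 ?sqrtr_ge0 // !mulr_ge0 ?pi_ge0 // ltW. Qed.

Let cs : continuous s.
Proof.
move=> x; apply: (@continuous_comp _ _ _ (fun x : R => 4 * v - x ^+ 2) Num.sqrt).
  by apply: cvgB; [exact: cvg_cst|exact: exprn_continuous].
exact: sqrt_continuous.
Qed.

Let cp : continuous p.
Proof. by move=> x; apply: cvgM; [exact: cs|exact: cvg_cst]. Qed.

Let mp : measurable_fun setT (p : measurableTypeR R -> R).
Proof. exact: measurable_realfun.continuous_measurable_fun. Qed.

Let p_out x : x \notin `]- r, r] -> p x = 0.
Proof.
rewrite in_itv /= negb_and -!leNgt => h; rewrite /p /semicircle_pdf ler0_sqrtr ?mul0r //.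
rewrite subr_le0 -r2 -[x ^+ 2]real_normK ?num_real // lerXn2r ?nnegrE ?(ltW r0) //.
by case/orP: h => h; [rewrite lerNr in h; rewrite -normrN (le_trans h) ?ler_norm|
  rewrite (le_trans (ltW (_ : r < x))) ?ler_norm // ltNge].
Qed.

Let restrict_support (f : R -> R) :
  \int[lambda]_x (f x * p x) = \int[lambda]_(x in `]- r, r]) (f x * p x).
Proof.
rewrite [RHS]Rintegral_mkcond; apply: eq_Rintegral => x _.
by rewrite patchE mem_setE; case: ifPn => // /p_out ->; rewrite mulr0.
Qed.

Let s_pos (x : R) : - r < x < r -> 0 < 4 * v - x ^+ 2.
Proof.
move=> /andP[x1 x2]; rewrite -r2 subr_gt0 -[x ^+ 2]real_normK ?num_real //.
by rewrite ltrXn2r ?nnegrE ?(ltW r0) // ltr_norml x1.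
Qed.

Let ds (x : R) : - r < x < r -> is_derive x (1 : R) s (- x / s x).
Proof.
move=> hx; have pos := s_pos hx.
have d1 : is_derive x (1 : R) (horner ((4 * v)%:P - 'X^2 : {poly R})) (- (2 * x)).
  apply: (is_derive_eq (is_derive_poly _ x)).
  rewrite derivB derivC derivXn /= !hornerE /=; ring.
have pos' : 0 < ((4 * v)%:P - 'X^2 : {poly R}).[x] by rewrite !hornerE.
have d2 := is_derive1_comp (is_derive1_sqrt pos') d1.
rewrite (_ : s = Num.sqrt \o horner ((4 * v)%:P - 'X^2 : {poly R})); last first.
  by apply/funext => z; rewrite /s /= !hornerE.
apply: (is_derive_eq d2); rewrite /= !hornerE /=.
have : Num.sqrt (4 * v - x ^+ 2) != 0 by rewrite sqrtr_eq0 -ltNge.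
by move: (Num.sqrt _) => z zN; field.
Qed.

Let ss (x : R) : - r < x < r -> s x ^+ 2 = 4 * v - x ^+ 2 /\ s x != 0.
Proof. by move=> /s_pos h; rewrite sqr_sqrtr ?(ltW h) // sqrtr_eq0 -ltNge. Qed.

Let s_end : s r = 0 /\ s (- r) = 0.
Proof. by rewrite /s sqrrN r2 subrr sqrtr0. Qed.

(* The half-disc area, by the substitution x = r sin t. *)
Let total : (\int[lambda]_x (p x)%:E = 1)%E.
Proof.
pose F (t : R) := r * sin t.
have dF (t : R) : is_derive t (1 : R) F (r * cos t) by exact: is_deriveZ.
have FE : F^`()%classic = (fun t => r * cos t).
  by apply/funext => t; have h := dF t; rewrite derive1E derive_val.
have cF : continuous F.
  by move=> x; apply: cvgM; [exact: cvg_cst|exact: continuous_sin].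
have cF' : continuous (fun t : R => r * cos t).
  by move=> x; apply: cvgM; [exact: cvg_cst|exact: continuous_cos].
have Fb : F (pi / 2) = r by rewrite /F sin_pihalf mulr1.
have Fa : F (- (pi / 2)) = - r by rewrite /F sinN sin_pihalf mulrN1.
have ab : - (pi / 2) < pi / 2 :> R by rewrite gtrN // divr_gt0 // pi_gt0.
have -> : (\int[lambda]_x (p x)%:E = \int[lambda]_(x in `[F (- (pi / 2))%R, F (pi / 2)%R]) (p x)%:E)%E.
  rewrite Fa Fb [RHS]integral_mkcond; apply: eq_integral => x _.
  rewrite patchE mem_setE; case: ifPn => // h; rewrite p_out //.
  by apply: contra h; rewrite !in_itv /= => /andP[/ltW -> ->].
rewrite integration_by_substitution_increasing ?FE; first last.
- exact: continuous_subspaceT.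
- split; first by move=> x _; have [] := dF x.
  + by apply: cvg_at_right_filter; exact: cF.
  + by apply: cvg_at_left_filter; exact: cF.
- by apply/cvg_ex; exists (r * cos (pi / 2)); apply: cvg_at_left_filter; exact: cF'.
- by apply/cvg_ex; exists (r * cos (- (pi / 2))); apply: cvg_at_right_filter; exact: cF'.
- by move=> x _; exact: cF'.
- by move=> x y hx hy xy; rewrite /F ltr_pM2l // ltr_sin.
- exact: ltW.
pose f (t : R) := 2 / pi * (cos t * cos t).
pose G (t : R) := pi^-1 * (t + sin t * cos t).
have dG (t : R) : is_derive t (1 : R) G (f t).
  have d1 := is_deriveD (is_derive_id t (1 : R)) (is_deriveM (is_derive_sin t) (is_derive_cos t)).
  apply: (is_derive_eq (is_deriveZ pi^-1 d1)); rewrite /GRing.scale /= /f.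
  have := cos2Dsin2 t; rewrite !expr2 => h.
  rewrite -[X in pi^-1 * (X + _)]h.
  by move: (cos t) (sin t) (pi : R) piN => x y z zN; field.
have cf : continuous f.
  move=> x; apply: cvgM; first exact: cvg_cst.
  by apply: cvgM; exact: continuous_cos.
have cG : continuous G.
  by move=> x; apply/differentiable_continuous/derivable1_diffP; have [] := dG x.
have dGd : derivable_oo_LRcontinuous G (- (pi / 2)) (pi / 2).
  split; first by move=> x _; have [] := dG x.
  - by apply: cvg_at_right_filter; exact: cG.
  - by apply: cvg_at_left_filter; exact: cG.
have dGE : {in `](- (pi / 2)), (pi / 2)[, G^`()%classic =1 f}.
  by move=> x _; have h := dG x; rewrite derive1E derive_val.
have := continuous_FTC2 ab (continuous_subspaceT cf) dGd dGE.
rewrite /G cosN cos_pihalf !mulr0 !addr0 -EFinB mulrN opprK.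
rewrite (_ : pi^-1 * (pi / 2) + pi^-1 * (pi / 2) = 1); last by move: (pi : R) piN => z zN; field.
move=> <-; apply: eq_integral => t; rewrite inE /= in_itv /= => /andP[t1 t2].
congr EFin; rewrite fctE /= /p /semicircle_pdf /F exprMn r2.
have ct : 0 <= cos t by apply: cos_ge0_pihalf; rewrite t1 t2.
have -> : 4 * v - 4 * v * sin t ^+ 2 = (r * cos t) ^+ 2.
  by rewrite exprMn r2 sin2cos2; ring.
rewrite sqrtr_sqr ger0_norm ?mulr_ge0 ?(ltW r0) // /f.
have -> : r * cos t / (2 * pi * v) * (r * cos t) = r ^+ 2 * (cos t * cos t) / (2 * pi * v).
  by rewrite expr2; ring.
by rewrite r2; move: (cos t) (pi : R) piN vN => x z zN *; field; apply/andP.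
Qed.

Section Moments.
Variable P : probability (measurableTypeR R) R.
Hypothesis PE : forall D : set (measurableTypeR R), measurable D ->
  P D = (\int[lambda]_(x in D) (p x)%:E)%E.

Let p_moments : has_moments P.
Proof.
suff h k K : (\int[P]_(y in `](- (K%:R : R))%R, K%:R%R]) ((y : R) ^+ k.*2)%:E <= (r ^+ k.*2)%:E)%E.
  by have [] := even_moments_le h.
have ck : continuous (fun y : R => y ^+ k.*2) by exact: exprn_continuous.
have mI : measurable (`](- (K%:R : R)), K%:R]%classic : set (measurableTypeR R)) by [].
have ik := integrable_bounded_itv P ck (- (K%:R)) K%:R.
have fin := integrable_fin_num mI ik.
rewrite -(fineK fin) lee_fin; rewrite -/(Rintegral P _ _) (density_integral mp PE mI ik).
have cc : continuous (fun x : R => r ^+ k.*2) by move=> x; exact: cvg_cst.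
have ic := integrable_bounded_itv P cc (- (K%:R)) K%:R.
apply: (@le_trans _ _ (\int[P]_(x in `](- (K%:R : R)), K%:R]) (r ^+ k.*2))); last first.
  rewrite (Rintegral_cst P mI) ler_piMr ?expr_even_ge0 //.
  by rewrite -lee_fin fineK ?fin_num_measure // probability_le1.
rewrite (density_integral mp PE mI ic).
have iL (f : R -> R) : continuous f -> lambda.-integrable `](- (K%:R : R)), K%:R] (EFin \o (fun x => f x * p x)).
  move=> cf; apply: (@integrableS _ _ _ lambda `[- K%:R, K%:R]%classic) => //.
    by move=> x /=; rewrite !in_itv /= => /andP[/ltW -> ->].
  apply: continuous_compact_integrable; first exact: segment_compact.
  by apply: continuous_subspaceT => x; apply: cvgM; [exact: cf|exact: cp].
apply: le_Rintegral => //; [exact: iL|exact: iL|].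
move=> x _; case: (boolP (x \in `]- r, r])) => [|/p_out ->]; last by rewrite !mulr0.
rewrite in_itv /= => /andP[x1 x2]; rewrite ler_wpM2r //.
have -> : x ^+ k.*2 = `|x| ^+ k.*2 by rewrite -normrX ger0_norm // expr_even_ge0.
by rewrite lerXn2r ?nnegrE ?(ltW r0) // ler_norml (ltW x1).
Qed.

(* Integrals against P through an antiderivative vanishing at both ends of the support. *)
Let parts (q : {poly R}) (F : R -> R) : continuous F -> F r = 0 -> F (- r) = 0 ->
  (forall x : R, - r < x < r -> is_derive x (1 : R) F (q.[x] * p x)) ->
  \sum_(k < size q) q`_k * moment P k = 0.
Proof.
move=> cF F1 F2 dF; have [iq <-] := integral_poly q p_moments.
rewrite (density_integral mp PE measurableT iq) restrict_support.
rewrite (@ftc_itv _ F) ?F1 ?F2 ?subrr //; first by rewrite gtrN.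
by move=> x; apply: cvgM; [exact: continuous_horner|exact: cp].
Qed.

(* The antiderivative is a multiple of [x ^ k * (4 v - x ^ 2) ^ (3/2)], which
   vanishes at both ends of the support. *)
Let dP k (x : R) : - r < x < r -> is_derive x (1 : R)
  (fun x => - (2 * pi * v)^-1 * (x ^+ k * s x ^+ 3))
  (((k.+3)%:R * x ^+ k.+1 - 4 * v * k%:R * x ^+ k.-1) * p x).
Proof.
move=> hx; have [h1 h2] := ss hx.
have -> : (fun x => - (2 * pi * v)^-1 * (x ^+ k * s x ^+ 3)) =
    (- (2 * pi * v)^-1) \*: (horner 'X^k * (s * (s * s))).
  by apply/funext => z; rewrite /= fctE hornerXn !exprS expr0 mulr1.
have dss := ds hx.
apply: (is_derive_eq (is_deriveZ _ (is_deriveM (is_derive_poly 'X^k x) (is_deriveM dss (is_deriveM dss dss))))).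
rewrite derivXn /= hornerMn !hornerXn /GRing.scale /= /p /semicircle_pdf -/(s x) !fctE.
rewrite -[_ ^+ _ *+ _]mulr_natl -[k.+3%:R]natr1 -[k.+2%:R]natr1 -[k.+1%:R]natr1.
have -> : 4 * v = s x ^+ 2 + x ^+ 2 by rewrite h1; ring.
rewrite [x ^+ k.+1]exprS.
have [->|k0] := posnP k.
  by rewrite !expr0; move: (s x) h2 vN piN => z; move: (pi : R) => pi0 *; field; apply/and3P.
have -> : x ^+ k = x * x ^+ k.-1 by rewrite -exprS prednK.
move: (s x) (x ^+ k.-1) h2 vN piN => z y; move: (pi : R) (k%:R) => pi0 m *; field.
by apply/and3P.
Qed.

(** The antiderivative in [dP] vanishes at both ends of the support. *)
Lemma semicircle_moments : [/\ has_moments P, moment P 1 = 0 &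
  forall k, (k.+4)%:R * moment P k.+2 = 4 * v * k.+1%:R * moment P k].
Proof.
have cF (k : nat) : continuous (fun x : R => - (2 * pi * v)^-1 * (x ^+ k * s x ^+ 3)).
  move=> x; apply: cvgM; first exact: cvg_cst.
  apply: cvgM; first exact: exprn_continuous.
  by apply: (@continuous_comp _ _ _ s (fun z => z ^+ 3)); [exact: cs|exact: exprn_continuous].
have [e1 e2] := s_end.
have F0 k (x : R) : s x = 0 -> - (2 * pi * v)^-1 * (x ^+ k * s x ^+ 3) = 0.
  by move=> ->; rewrite expr0n mulr0 mulr0.
have main k (q : {poly R}) : (forall x, q.[x] = k.+3%:R * x ^+ k.+1 - 4 * v * k%:R * x ^+ k.-1) ->
    \sum_(k < size q) q`_k * moment P k = 0.
  move=> hq; apply: (parts (cF k)); [exact: F0|exact: F0|].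
  by move=> x hx; rewrite hq; exact: dP.
have sum_poly (q : {poly R}) n : (size q <= n)%N ->
    \sum_(k < size q) q`_k * moment P k = \sum_(k < n) q`_k * moment P k.
  move=> sn; rewrite (big_ord_widen n (fun k => q`_k * moment P k)) // big_mkcond.
  by apply: eq_bigr => i _; case: ltnP => // h; rewrite nth_default ?mul0r.
have two (a b : R) i j : (i < j)%N ->
    \sum_(k < size (a *: 'X^j - b *: 'X^i)) (a *: 'X^j - b *: 'X^i)`_k * moment P k =
    a * moment P j - b * moment P i.
  move=> ij; rewrite (@sum_poly _ j.+1); last first.
    rewrite (leq_trans (size_polyD _ _)) // size_polyN geq_max !(leq_trans (size_scale_leq _ _)) //.
      by rewrite size_polyXn ltnS ltnW.
    by rewrite size_polyXn.
  rewrite (bigD1 (Ordinal (ltnSn j))) //= (bigD1 (Ordinal (ltnW ij : (i < j.+1)%N))) /=; last first.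
    by rewrite -val_eqE /= ltn_eqF.
  rewrite big1 ?addr0 => [|k /andP[]]; last first.
    rewrite -!val_eqE /= => /negbTE h1 /negbTE h2.
    by rewrite coefB !coefZ !coefXn h1 h2 !mulr0 subrr mul0r.
  rewrite !coefB !coefZ !coefXn !eqxx (gtn_eqF ij) (ltn_eqF ij).
  by rewrite !mulr1 !mulr0 subr0 sub0r mulNr.
split=> //.
  have := main 0%N (3 *: 'X^1 - 0 *: 'X^0); rewrite two // mul0r subr0 => h.
  have /eqP : 3 * moment P 1 = 0.
    by apply: h => x; rewrite !hornerE /=; ring.
  by rewrite mulf_eq0 pnatr_eq0 /= => /eqP.
move=> k; apply/eqP; rewrite -subr_eq0; apply/eqP.
rewrite -(two (k.+4)%:R _ k k.+2) //; apply: (main k.+1) => x.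
by rewrite !hornerE.
Qed.

End Moments.

Lemma semicircle_probability : exists P : probability (measurableTypeR R) R,
  forall D : set (measurableTypeR R), measurable D ->
  P D = (\int[lambda]_(x in D) (semicircle_pdf v x)%:E)%E.
Proof. exact: density_probability total. Qed.

End Semicircle.

(** The two-term recursion of the semicircle moments against their convolution
    recursion. By symmetry, weighting the terms of the convolution [T m] by
    their index amounts to multiplying [T m] by [m / 2]; applying the two-term
    recursion inside the weighted sum then gives a recursion for [T] which is
    that of the moments. *)
Lemma catalan_recursion (R : realFieldType) (v : R) (a : nat -> R) : a 0%N = 1 -> a 1%N = 0 ->
  (forall k, (k.+4)%:R * a k.+2 = 4 * v * k.+1%:R * a k) ->
  forall m, a m.+2 = v * \sum_(j < m.+1) a j * a (m - j)%N.
Proof.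
move=> a0 a1 rec; pose T m := \sum_(j < m.+1) a j * a (m - j)%N.
have sym m : \sum_(j < m.+1) j%:R * (a j * a (m - j)%N) = m%:R / 2 * T m.
  have : \sum_(j < m.+1) j%:R * (a j * a (m - j)%N) =
         \sum_(j < m.+1) (m%:R - j%:R) * (a j * a (m - j)%N).
    rewrite (reindex_inj rev_ord_inj); apply: eq_bigr => j _ /=.
    by rewrite subSS natrB -1?ltnS // subKn -1?ltnS // [a j * _]mulrC.
  under [RHS]eq_bigr => j _ do rewrite mulrBl.
  by rewrite sumrB -mulr_sumr -/(T m) => h; lra.
have sumD m c : \sum_(j < m.+1) (j%:R + c) * (a j * a (m - j)%N) = (m%:R / 2 + c) * T m.
  under eq_bigr => j _ do rewrite mulrDl.
  by rewrite big_split /= sym -mulr_sumr -/(T m) mulrDl.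
have T2 m : (m%:R + 6) * T m.+2 = 4 * a m.+2 + 4 * v * (m%:R + 2) * T m.
  have h1 := sumD m.+2 2; rewrite big_ord_recl big_ord_recl /= a0 in h1.
  rewrite /bump /= a1 mul0r mulr0 subn0 in h1.
  have h2 : \sum_(i < m.+1) (i.+2%:R + 2) * (a i.+2 * a (m - i)%N) = 4 * v * ((m%:R / 2 + 1) * T m).
    rewrite -sumD mulr_sumr; apply: eq_bigr => i _.
    rewrite (_ : i.+2%:R + 2 = i.+4%:R :> R); last by rewrite -[2]/(2%:R) -natrD addn2.
    by rewrite mulrA rec -[i.+1%:R]natr1 !mulrA.
  have h3 : m.+2%:R = m%:R + 2 :> R by rewrite -[2]/(2%:R) -natrD addn2.
  move: h1; rewrite h3.
  rewrite (eq_bigr (fun i : 'I_m.+1 => (i.+2%:R + 2) * (a i.+2 * a (m - i)%N))) => [|i _]; last first.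
    by rewrite /bump /= ?add1n ?subSS.
  by rewrite h2; lra.
suff main : forall m, a m.+2 = v * T m /\ a m.+3 = v * T m.+1 by move=> m; have [] := main m.
have step m : a m.+2 = v * T m -> a m.+4 = v * T m.+2.
  move=> h; have m6 : m%:R + 6 != 0 :> R by rewrite -[6]/(6%:R) -natrD pnatr_eq0 addnS.
  apply: (mulfI m6); rewrite mulrCA T2.
  have := rec m.+2; rewrite (_ : m.+2.+4%:R = m%:R + 6); last by rewrite -[6]/(6%:R) -natrD !addnS addn0.
  rewrite (_ : m.+3%:R = m%:R + 3); last by rewrite -[3]/(3%:R) -natrD !addnS addn0.
  move=> ->; have := congr1 ( *%R (4 * v * (m%:R + 2))) h; lra.
elim=> [|m [IH1 IH2]]; last by split=> //; exact: step.
split.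
  have := rec 0%N; rewrite /T big_ord_recl big_ord0 a0; lra.
by have := rec 1%N; rewrite /T !big_ord_recl big_ord0 /= /bump /= a0 a1; lra.
Qed.

(** * Moments of the fluctuations and their limit *)

Section WordSum.
Variables (K : comNzRingType) (c : nat -> K) (d : nat).

(** Expansion of the [m]-th power of a linear combination of letters: the sum
    over the words of length [m] of a function of the word. *)
Fixpoint word_sum (m : nat) (f : seq nat -> K) : K :=
  if m is n.+1 then \sum_(k < d) c k.+1 * word_sum n (fun l => f (k.+1 :: l)) else f [::].

Definition letters_in (l : seq nat) := all (fun k => 0 < k <= d)%N l.

Lemma eq_word_sum m f g : (forall l, size l = m -> letters_in l -> f l = g l) ->
  word_sum m f = word_sum m g.
Proof.
elim: m f g => [|m IH] f g fg; first exact: fg.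
apply: eq_bigr => k _; congr (_ * _); apply: IH => l sl hl.
by apply: fg; rewrite /= ?sl // ltn_ord.
Qed.

Lemma word_sumZ m a f : word_sum m (fun l => a * f l) = a * word_sum m f.
Proof.
elim: m f => //= m IH f; rewrite mulr_sumr; apply: eq_bigr => k _.
by rewrite (IH (fun l => f _)) mulrCA.
Qed.

Lemma word_sum_sum m n (F : 'I_n -> seq nat -> K) :
  word_sum m (fun l => \sum_(j < n) F j l) = \sum_(j < n) word_sum m (F j).
Proof.
elim: m F => //= m IH F; rewrite exchange_big; apply: eq_bigr => k _ /=.
by rewrite (IH (fun j l => F j _)) mulr_sumr.
Qed.

Lemma word_sum_cat a b f :
  word_sum (a + b) f = word_sum a (fun l => word_sum b (fun l' => f (l ++ l'))).
Proof.
elim: a f => [|a IH] f; first by rewrite add0n.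
by rewrite addSn /=; apply: eq_bigr => k _; rewrite IH.
Qed.

(** The letter in position [j] is summed apart from those before and after. *)
Lemma word_sum_split m (j : 'I_m) (h : nat -> K) (g : seq nat -> seq nat -> K) :
  word_sum m (fun l => h (nth 0%N l j) * g (take j l) (drop j.+1 l)) =
  (\sum_(k < d) c k.+1 * h k.+1) * word_sum j (fun l => word_sum (m.-1 - j) (g l)).
Proof.
have mE : m = (j + (m.-1 - j).+1)%N.
  by rewrite addnS subnKC ?prednK //; case: m j => [[]|m] // [j /=]; rewrite ltnS.
rewrite {1}mE word_sum_cat -word_sumZ; apply: eq_word_sum => l sl _ /=.
rewrite mulr_suml; apply: eq_bigr => k _; rewrite -mulrA; congr (_ * _).
rewrite -word_sumZ; apply: eq_word_sum => l' _ _; rewrite nth_cat sl ltnn subnn /=.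
by rewrite take_size_cat // -cat_rcons drop_size_cat // size_rcons sl.
Qed.

End WordSum.

Lemma rmorph_word_sum (K L : comNzRingType) (phi : {rmorphism K -> L}) c d m f :
  phi (word_sum c d m f) = word_sum (fun k => phi (c k)) d m (fun l => phi (f l)).
Proof.
elim: m f => //= m IH f; rewrite rmorph_sum; apply: eq_bigr => k _.
by rewrite rmorphM IH.
Qed.

Lemma word_sum_le (R : realDomainType) (c : nat -> R) d m f b : 
  (forall l, size l = m -> letters_in d l -> `|f l| <= b) ->
  `|word_sum c d m f| <= (\sum_(k < d) `|c k.+1|) ^+ m * b.
Proof.
elim: m f => [|m IH] f fb; first by rewrite expr0 mul1r; exact: fb.
rewrite /= exprS -mulrA mulr_suml; apply: le_trans (ler_norm_sum _ _ _) _.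
apply: ler_sum => k _; rewrite normrM ler_wpM2l //; apply: IH => l sl hl.
by apply: fb; rewrite /= ?sl // ltn_ord.
Qed.

Local Open Scope complex_scope.

Lemma conj_realC (R : rcfType) (a : R) : Num.conj (a%:C : R[i]) = a%:C.
Proof. by apply/CrealP/complex_realP; exists a. Qed.

Section StarAlgebra.
Variables (R : realType) (A : ncProbSpace R).

Lemma star_sum (I : Type) (r : seq I) (F : I -> A) :
  star (\sum_(i <- r) F i) = \sum_(i <- r) star (F i).
Proof.
have s0 : star (0 : A) = 0.
  by have := starZ 0 (0 : A); rewrite scale0r rmorph0 scale0r.
exact: (big_morph _ (@starD R A) s0).
Qed.

Lemma star1 : star (1 : A) = 1.
Proof. by rewrite -[LHS]mulr1 -[X in _ * X](@starK R A) -starM mulr1 starK. Qed.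

Lemma starX (x : A) n : star x = x -> star (x ^+ n) = x ^+ n.
Proof.
by move=> sx; elim: n => [|n IH]; rewrite ?expr0 ?star1 // exprS starM IH sx -exprSr exprS.
Qed.

(** Both [tau ((1 + x) ^ 2)] and [tau (x ^ 2)] are nonnegative, hence real, and
    their difference is [1 + 2 tau x]. *)
Lemma tau_selfadjoint_real (x : A) : star x = x -> exists a, tau A x = a%:C.
Proof.
move=> sx; have h1 := tau_ge0 (1 + x); have h2 := tau_ge0 x.
move: h1 h2; rewrite starD star1 sx mulrDl mul1r mulrDr mulr1 !raddfD /= tau1 !lecE /=.
move=> /andP[/eqP i1 _] /andP[/eqP i2 _]; exists (complex.Re (tau A x)).
move: i1 i2; case: (tau A x) => a b /=; case: (tau A _) => a' b' /= i1 i2.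
by congr Complex; lra.
Qed.

Lemma star_center (x : A) : star x = x -> star (x - (tau A x)%:A) = x - (tau A x)%:A.
Proof.
move=> sx; have [a ha] := tau_selfadjoint_real sx.
have e : - a%:C = (- a)%:C :> R[i] by rewrite rmorphN.
by rewrite -scaleNr starD starZ star1 sx ha e conj_realC.
Qed.

(** A Hankel form of moments of [x] is the value of [tau] at the square of a
    self-adjoint polynomial in [x]. *)
Lemma hankel_moments_ge0 (x : A) (m : nat -> R) : star x = x ->
  (forall k, tau A (x ^+ k) = (m k)%:C) -> forall n (c : 'I_n -> R), 0 <= hankel_form m c.
Proof.
move=> sx hm n c; pose p : A := \sum_(i < n) (c i)%:C *: x ^+ i.
have sp : star p = p.
  by rewrite star_sum; apply: eq_bigr => i _; rewrite starZ conj_realC starX.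
have := tau_ge0 p; rewrite sp; suff -> : tau A (p * p) = (hankel_form m c)%:C by rewrite ler0c.
rewrite mulr_suml raddf_sum /hankel_form rmorph_sum; apply: eq_bigr => i _ /=.
rewrite mulr_sumr raddf_sum rmorph_sum; apply: eq_bigr => j _ /=.
by rewrite -scalerAl -scalerAr scalerA -exprD linearZ /= hm !rmorphM.
Qed.

End StarAlgebra.

Section CenteredTrace.
Variables (R : realType) (A : ncProbSpace R) (N M : nat) (X : 'M[A]_(M, N)) (Q : {poly R}).
Notation d := (size Q).-1.

Lemma star_wishart_entry k i j : star ((wishart X ^+ k) i j) = (wishart X ^+ k) j i.
Proof.
elim: k i j => [|k IH] i j.
  rewrite !expr0 !mxE [j == i]eq_sym; case: (i == j) => /=; first by rewrite star1.
  by have := starZ 0 (0 : A); rewrite scale0r rmorph0 scale0r.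
rewrite [in LHS]exprS [in RHS]exprSr !mxE star_sum; apply: eq_bigr => l _.
rewrite starM IH; congr (_ * _); rewrite !mxE star_sum; apply: eq_bigr => a _.
by rewrite !mxE starM starK.
Qed.

Lemma star_ctrace k : star (ctrace X k) = ctrace X k.
Proof.
apply: star_center; rewrite /wtrace /mxtrace star_sum; apply: eq_bigr => i _.
exact: star_wishart_entry.
Qed.

(** The trace of the identity is a scalar, so the constant term of [Q] cancels
    after centring. *)
Lemma ctrace0 : ctrace X 0 = 0.
Proof.
rewrite /ctrace /wtrace expr0 [\tr _](_ : _ = N%:R) ?mxtrace1 //.
by rewrite raddfMn /= tau1 scaler_nat subrr.
Qed.

Lemma centered_traceE : centered_trace Q (wishart X) =
  \sum_(k < d) (Q`_k.+1)%:C *: ctrace X k.+1.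
Proof.
rewrite /centered_trace /poly_mx.
have -> : \tr (\sum_(k < size Q) map_mx (fun a : A => (Q`_k)%:C *: a) (wishart X ^+ k)) =
    \sum_(k < size Q) (Q`_k)%:C *: wtrace X k.
  rewrite raddf_sum; apply: eq_bigr => k _; rewrite /wtrace /mxtrace scaler_sumr.
  by apply: eq_bigr => i _; rewrite mxE.
have -> : tau A (\sum_(k < size Q) (Q`_k)%:C *: wtrace X k) =
    \sum_(k < size Q) (Q`_k)%:C * tau A (wtrace X k).
  by rewrite raddf_sum; apply: eq_bigr => k _ /=; rewrite linearZ.
transitivity (\sum_(k < size Q) (Q`_k)%:C *: ctrace X k).
  by rewrite scaler_suml -sumrB; apply: eq_bigr => k _; rewrite /ctrace scalerBr scalerA.
case: (size Q) => [|n] /=; first by rewrite !big_ord0.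
by rewrite big_ord_recl ctrace0 scaler0 add0r.
Qed.

Lemma star_centered_trace : star (centered_trace Q (wishart X)) = centered_trace Q (wishart X).
Proof.
rewrite centered_traceE star_sum; apply: eq_bigr => k _.
by rewrite starZ conj_realC star_ctrace.
Qed.

(** The induction carries a left factor, as the centred traces do not
    commute. *)
Lemma tau_centered_trace_exp m : tau A (centered_trace Q (wishart X) ^+ m) =
  word_sum (fun k => (Q`_k)%:C) d m (list_moment X).
Proof.
suff h (Y : A) : tau A (Y * centered_trace Q (wishart X) ^+ m) =
    word_sum (fun k => (Q`_k)%:C) d m (fun l => tau A (Y * \prod_(k <- l) ctrace X k)).
  have := h 1; rewrite mul1r => ->; apply: eq_word_sum => l _ _.
  by rewrite mul1r.
elim: m Y => [|m IH] Y; first by rewrite /= big_nil expr0.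
rewrite exprS mulrA {1}centered_traceE mulr_sumr mulr_suml raddf_sum.
apply: eq_bigr => k _ /=; rewrite -scalerAr -scalerAl linearZ /= IH; congr (_ * _).
by apply: eq_word_sum => l _ _; rewrite big_cons mulrA.
Qed.

End CenteredTrace.

Local Open Scope ring_scope.

Lemma cvg_word_sum (R : realType) (c : nat -> R) d m (F : nat -> seq nat -> R) (f : seq nat -> R) :
  (forall l, size l = m -> letters_in d l -> (fun N => F N l) @ \oo --> f l) ->
  (fun N => word_sum c d m (F N)) @ \oo --> word_sum c d m f.
Proof.
elim: m F f => [|m IH] F f Ff; first by have h := Ff [::] erefl isT; exact: h.
apply: cvg_big => [|k _]; first by move=> x; exact: add_continuous.
apply: cvgMr; apply: (IH (fun N l => F N (k.+1 :: l)) (fun l => f (k.+1 :: l))) => l sl hl.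
by have h := Ff (k.+1 :: l); apply: h; rewrite /= ?sl // ltn_ord.
Qed.

Lemma cvg_real_complex (R : realType) (u : nat -> R) (a : R) : u @ \oo --> a ->
  (fun N => (u N)%:C : R[i]^o) @ \oo --> (a%:C : R[i]^o).
Proof.
move=> /cvgrPdist_lt ua; apply/cvgrPdist_lt => e e0.
have er : (complex.Re e)%:C = e by apply: RRe_real; exact: gtr0_real.
have e1 : 0 < complex.Re e by rewrite -ltcR er.
apply: filterS (ua _ e1) => N; rewrite -ltcR er.
by rewrite -rmorphB /= normc_def /= expr0n addr0 sqrtr_sqr.
Qed.

Section Limits.
Variables (R : realType) (q : R) (Q : {poly R}) (A : nat -> ncProbSpace R) (M : nat -> nat) (lambda : R).
Hypothesis hq : -1 <= q <= 1.
Hypothesis hM : (fun N : nat => (M N)%:R / N%:R : R) @ \oo --> lambda.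
Variable W : forall N : nat, 'M[A N]_N.
Hypothesis hW : forall N : nat, (0 < N)%N ->
  q_wishart q ((N%:R^-1)%:M : 'M[R]_N) (1%:M : 'M[R]_(M N)) (W N).
Notation d := (size Q).-1.
Notation L := (limit_moment q lambda).
Notation mN := (fun N => centered_moment q N (M N)).

(** Words in the exponents [1 .. d] expand the power of a centred trace; the
    constant coefficient disappears by centring. *)
Definition fluctuation_moment (m : nat) : R := word_sum (fun k => Q`_k) d m L.
Notation mo := fluctuation_moment.
Let moN N m := word_sum (fun k => Q`_k) d m (mN N).

Let letters_pos l : letters_in d l -> all (fun k => 0 < k)%N l.
Proof. by apply: sub_all => k /andP[]. Qed.

Let model N : (0 < N)%N -> exists X : 'M[A N]_(M N, N),
  [/\ W N = wishart X, q_gaussian q (fun ij : 'I_(M N) * 'I_N => X ij.1 ij.2) &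
    forall (i k : 'I_(M N)) (j m : 'I_N), tau (A N) (X i j * X k m) =
      ((1%:M : 'M[R]_(M N)) i k * ((N%:R^-1)%:M : 'M[R]_N) j m)%:C].
Proof. by move=> /hW [_ [_ [X [h1 h2 h3]]]]; exists X. Qed.

Let tau_moN N m : (0 < N)%N -> tau (A N) (centered_trace Q (W N) ^+ m) = (moN N m)%:C.
Proof.
move=> N0; have [X [-> hX hcov]] := model N0.
rewrite tau_centered_trace_exp /moN rmorph_word_sum; apply: eq_word_sum => l _ /letters_pos pl.
by rewrite (list_momentE hX hcov pl).
Qed.

Let near_pos : \forall N \near \oo, (0 < N)%N.
Proof. exact: nbhs_infty_gt. Qed.

Let cvg_mo m : moN ^~ m @ \oo --> mo m.
Proof.
apply: cvg_word_sum => l _ /letters_pos pl.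
by have h := cvg_centered_moment (q := q) hM pl; exact: h.
Qed.

Let mo_psd n (c : 'I_n -> R) : 0 <= hankel_form mo c.
Proof.
have h : (fun N => hankel_form (moN N) c) @ \oo --> hankel_form mo c.
  apply: cvg_big => [|i _]; first by move=> x; exact: add_continuous.
  apply: cvg_big => [|j _]; first by move=> x; exact: add_continuous.
  by apply: cvgMr; exact: cvg_mo.
rewrite -(cvg_lim _ h) //; apply: limr_ge; first by apply/cvg_ex; eexists; exact: h.
apply: filterS near_pos => N N0; have [X [WX _ _]] := model N0.
apply: (@hankel_moments_ge0 R (A N) (centered_trace Q (W N))).
  by rewrite WX star_centered_trace.
by move=> k; exact: tau_moN.
Qed.

(* Identities between the moments at every large N pass to the limit. *)
Let limit_eq (u w : nat -> R) (a b : R) : u @ \oo --> a -> w @ \oo --> b ->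
  (forall N, (0 < N)%N -> u N = w N) -> a = b.
Proof.
move=> ua wb uw; have ub : u @ \oo --> b.
  move: wb; apply: cvg_trans; apply: near_eq_cvg.
  by apply: filterS near_pos => N /uw ->.
by apply: (cvg_unique _ ua ub).
Qed.

Let cvgL l : all (fun k => 0 < k)%N l -> (fun N => mN N l) @ \oo --> L l.
Proof. by move=> pl; have h := cvg_centered_moment (q := q) hM pl; exact: h. Qed.

Let L_nil : L [::] = 1.
Proof.
have h := @cvgL [::] isT; apply: (limit_eq h (cvg_cst (1 : R))) => N N0.
have [X [_ hX hcov]] := model N0.
have := list_momentE hX hcov (isT : all (fun k => 0 < k)%N [::]).
by rewrite /list_moment big_nil tau1 => /(congr1 (@complex.Re R)).
Qed.

Let L_one k : (0 < k)%N -> L [:: k] = 0.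
Proof.
move=> k0; have pk : all (fun k => 0 < k)%N [:: k] by rewrite /= k0.
have h := cvgL pk; apply: (limit_eq h (cvg_cst (0 : R))) => N N0.
have [X [_ hX hcov]] := model N0; have := list_momentE hX hcov pk.
rewrite /list_moment big_seq1 /ctrace raddfB /= linearZ /= tau1 mulr1 subrr.
by move=> /(congr1 (@complex.Re R)).
Qed.

Let cvg_sumr n (F : nat -> 'I_n -> R) (f : 'I_n -> R) : (forall j, (fun N => F N j) @ \oo --> f j) ->
  (fun N => \sum_(j < n) F N j) @ \oo --> \sum_(j < n) f j.
Proof. by move=> h; apply: cvg_big => [|j _ //]; move=> x; exact: add_continuous. Qed.

Let pos_pair k l (j : 'I_(size l)) : all (fun k => 0 < k)%N (k :: l) ->
  all (fun k => 0 < k)%N [:: k; nth 0%N l j].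
Proof. by move=> /= /andP[-> /allP h]; rewrite andbT; apply: h; exact: mem_nth. Qed.

Let pos_take k l j : all (fun k => 0 < k)%N (k :: l) -> all (fun k => 0 < k)%N (take j l).
Proof. by move=> /= /andP[_ /allP h]; apply/allP => x /mem_take; exact: h. Qed.

Let pos_drop k l j : all (fun k => 0 < k)%N (k :: l) -> all (fun k => 0 < k)%N (drop j l).
Proof. by move=> /= /andP[_ /allP h]; apply/allP => x /mem_drop; exact: h. Qed.

Let L_rec1 k l : q = 1 -> all (fun k => 0 < k)%N (k :: l) ->
  L (k :: l) = \sum_(j < size l) L [:: k; nth 0%N l j] * L (take j l ++ drop j.+1 l).
Proof.
move=> q1 pkl; rewrite -[RHS]addr0.
have pj (j : 'I_(size l)) : all (fun k => 0 < k)%N (take j l ++ drop j.+1 l).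
  by rewrite all_cat (pos_take _ pkl) (pos_drop _ pkl).
apply: (limit_eq (cvgL pkl) (cvgD (cvg_sumr (fun j => cvgM (cvgL (pos_pair j pkl)) (cvgL (pj j))))
  (cvg_unpaired_moment q hM pkl))).
move=> N N0; have [X [_ hX hcov]] := model N0.
have := list_moment_rec1 N0 hX hcov pkl q1; rewrite (list_momentE hX hcov pkl).
rewrite (eq_bigr (fun j : 'I_(size l) => (mN N [:: k; nth 0%N l j] * mN N (take j l ++ drop j.+1 l))%:C)).
  by rewrite -rmorph_sum -rmorphD => /(congr1 (@complex.Re R)).
move=> j _; rewrite (list_momentE hX hcov (pos_pair j pkl)) (list_momentE hX hcov (pj j)).
by rewrite rmorphM.
Qed.

Let L_rec0 k l : q = 0 -> all (fun k => 0 < k)%N (k :: l) ->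
  L (k :: l) = \sum_(j < size l) L [:: k; nth 0%N l j] * (L (take j l) * L (drop j.+1 l)).
Proof.
move=> q0 pkl; rewrite -[RHS]addr0.
apply: (limit_eq (cvgL pkl) (cvgD (cvg_sumr (fun j => cvgM (cvgL (pos_pair j pkl))
  (cvgM (cvgL (pos_take j pkl)) (cvgL (pos_drop j.+1 pkl))))) (cvg_unpaired_moment q hM pkl))).
move=> N N0; have [X [_ hX hcov]] := model N0.
have := list_moment_rec0 N0 hX hcov pkl q0; rewrite (list_momentE hX hcov pkl).
rewrite (eq_bigr (fun j : 'I_(size l) => (mN N [:: k; nth 0%N l j] * (mN N (take j l) * mN N (drop j.+1 l)))%:C)).
  by rewrite -rmorph_sum -rmorphD => /(congr1 (@complex.Re R)).
move=> j _; rewrite (list_momentE hX hcov (pos_pair j pkl)).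
rewrite (list_momentE hX hcov (pos_take j pkl)) (list_momentE hX hcov (pos_drop j.+1 pkl)).
by rewrite !rmorphM mulrA.
Qed.

Let mo0 : mo 0 = 1. Proof. exact: L_nil. Qed.

Let mo1 : mo 1 = 0.
Proof. by apply: big1 => k _; rewrite /= L_one // mulr0. Qed.

Let mo2_ge0 : 0 <= mo 2. Proof. exact: (even_moment_ge0 mo_psd 1). Qed.

Let mo_rec (g : seq nat -> seq nat -> R) m :
  (forall k l, all (fun k => 0 < k)%N (k :: l) ->
    L (k :: l) = \sum_(j < size l) L [:: k; nth 0%N l j] * g (take j l) (drop j.+1 l)) ->
  mo m.+2 = mo 2 * \sum_(j < m.+1)
    word_sum (fun k => Q`_k) d j (fun l => word_sum (fun k => Q`_k) d (m - j) (g l)).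
Proof.
move=> rec; rewrite [mo m.+2](_ : _ = \sum_(k < d) Q`_k.+1 *
  word_sum (fun k => Q`_k) d m.+1 (fun l => L (k.+1 :: l))) //.
rewrite [mo 2](_ : _ = \sum_(k < d) Q`_k.+1 *
  word_sum (fun k => Q`_k) d 1 (fun l => L (k.+1 :: l))) // mulr_suml; apply: eq_bigr => k _.
rewrite -mulrA; congr (_ * _); rewrite mulr_sumr.
rewrite (@eq_word_sum _ _ _ _ _ (fun l => \sum_(j < m.+1)
   L [:: k.+1; nth 0%N l j] * g (take j l) (drop j.+1 l))); last first.
  by move=> l sl hl; rewrite rec /= ?sl // letters_pos.
rewrite word_sum_sum; apply: eq_bigr => j _.
by rewrite (word_sum_split _ _ j (fun x => L [:: k.+1; x]) g).
Qed.

Let mo_rec1 m : q = 1 -> mo m.+2 = mo 2 * m.+1%:R * mo m.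
Proof.
move=> q1; rewrite (mo_rec m (g := fun l l' => L (l ++ l'))); last by move=> k l; exact: L_rec1.
rewrite (eq_bigr (fun=> mo m)) => [|j _]; first by rewrite sumr_const card_ord -mulrA mulr_natl.
by rewrite -word_sum_cat subnKC // -ltnS.
Qed.

Let mo_rec0 m : q = 0 -> mo m.+2 = mo 2 * \sum_(j < m.+1) mo j * mo (m - j)%N.
Proof.
move=> q0; rewrite (mo_rec m (g := fun l l' => L l * L l')); last by move=> k l; exact: L_rec0.
congr (_ * _); apply: eq_bigr => j _; rewrite [RHS]mulrC -word_sumZ; apply: eq_word_sum => l _ _.
by rewrite word_sumZ mulrC.
Qed.

(* The factor [K ^ n * (2n)! / n!] counts the matchings of [2n] blocks of at
   most [d] corners. *)
Let mo_growth : exists B, forall n, mo n.*2 * n`!%:R <= B ^+ n * n.*2`!%:R.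
Proof.
pose C : R := \sum_(k < d) `|Q`_k.+1|; pose D := Num.max 1 `|lambda|.
pose K := (2 ^ 2 ^ (d.*2).*2)%N.
have C0 : 0 <= C by apply: sumr_ge0.
have D0 : 0 <= D by rewrite le_max ler01.
exists (C ^+ 2 * D ^+ d.*2 * K%:R) => n.
have h : `|mo n.*2| <= C ^+ n.*2 * (D ^+ (d * n.*2) * (matched_bound K n.*2)%:R).
  apply: word_sum_le => l sl hl; rewrite -sl; apply: limit_moment_le => //.
  by rewrite ler_norml.
apply: le_trans (ler_wpM2r (ler0n _ _) (le_trans (ler_norm _) h)) _.
rewrite !exprMn -!exprM -exprD addnn (_ : d.*2 * n = d * n.*2)%N; last first.
  by rewrite -!muln2 mulnAC -mulnA.
rewrite -!mulrA; do 2 (apply: ler_wpM2l; first exact: exprn_ge0).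
by rewrite -natrX -!natrM ler_nat; exact: matched_bound_le.
Qed.

Theorem limit_law : exists mu : probability (measurableTypeR R) R,
  cvg_in_distribution (fun N : nat => centered_trace Q (W N)) mu /\
  forall m, moment mu m = mo m.
Proof.
have [mu [hmu momu]] := hamburger mo_psd mo0; exists mu; split=> //.
have [B hB] := mo_growth; split=> //.
  by apply: (@moment_determined_growth _ _ B) => // n; rewrite momu.
move=> m _; rewrite momu.
have h := cvg_real_complex (@cvg_mo m); move: h; apply: cvg_trans; apply: near_eq_cvg.
by apply: filterS near_pos => N /(tau_moN m) ->.
Qed.

Lemma limit_gaussian : q = 1 -> forall m, mo m.+2 = mo 2 * m.+1%:R * mo m.
Proof. by move=> q1 m; exact: mo_rec1. Qed.

Lemma limit_catalan : q = 0 -> forall m, mo m.+2 = mo 2 * \sum_(j < m.+1) mo j * mo (m - j)%N.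
Proof. by move=> q0 m; exact: mo_rec0. Qed.

Lemma fluctuation_moment012 : [/\ mo 0 = 1, mo 1 = 0 & 0 <= mo 2].
Proof. by []. Qed.

End Limits.

Local Close Scope complex_scope.

(** * Identification of the limit laws *)

Section Laws.
Variable R : realType.

Lemma moment0 (P : probability (measurableTypeR R) R) : moment P 0 = 1.
Proof.
rewrite /moment; under eq_Rintegral do rewrite expr0.
rewrite (Rintegral_cst P measurableT) mul1r -[RHS]/(fine (1%:E : \bar R)).
by congr fine; exact: probability_setT.
Qed.

Lemma dirac0_moments : has_moments (dirac (0 : measurableTypeR R) : probability (measurableTypeR R) R) /\
  forall m, moment (dirac (0 : measurableTypeR R) : probability (measurableTypeR R) R) m = (m == 0%N)%:R.
Proof.
pose P : probability (measurableTypeR R) R := dirac (0 : measurableTypeR R).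
have mx (m : nat) : measurable_fun setT (EFin \o (fun x : measurableTypeR R => x ^+ m)).
  by apply/measurable_EFinP; exact: measurable_expr.
have PT : P [set: measurableTypeR R] = 1%E by exact: probability_setT.
have iE (m : nat) : (\int[P]_x (x ^+ m)%:E)%E = ((0 : R) ^+ m)%:E.
  by rewrite (integral_dirac _ measurableT (mx m)) -/(P _) PT mul1e.
have h k K : (\int[P]_(y in `](- (K%:R : R))%R, K%:R%R]) ((y : R) ^+ k.*2)%:E <= ((0 : R) ^+ k.*2)%:E)%E.
  rewrite -iE; apply: ge0_subset_integral => //; first exact: mx.
  by move=> y _; rewrite lee_fin expr_even_ge0.
split; first by have [] := even_moments_le h.
by move=> m; rewrite /moment /Rintegral iE /= expr0n.
Qed.

(** [rec m] may look at all the terms of index at most [m]: the convolution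
    recursion does. *)
Lemma eq_from_recursion (a b : nat -> R) (rec : nat -> (nat -> R) -> R) :
  (forall m f g, (forall j, (j <= m)%N -> f j = g j) -> rec m f = rec m g) ->
  a 0%N = b 0%N -> a 1%N = b 1%N -> (forall m, a m.+2 = rec m a) -> (forall m, b m.+2 = rec m b) ->
  a =1 b.
Proof.
move=> loc e0 e1 ra rb m; elim/ltn_ind: m => [[|[|m]]] IH //.
by rewrite ra rb; apply: loc => j jm; apply: IH; rewrite ltnS ltnW.
Qed.

(** For variance zero the recursion kills all the moments of positive order,
    which are those of the point mass. *)
Lemma normal_law_of_moments (P : probability (measurableTypeR R) R) : moment_determined P ->
  moment P 1 = 0 -> 0 <= moment P 2 ->
  (forall m, moment P m.+2 = moment P 2 * m.+1%:R * moment P m) -> normal_law (moment P 2) P.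
Proof.
move=> det m1 v0 rec D mD; case: eqP => [vE|/eqP vN].
  have [h1 h2] := dirac0_moments; rewrite -(det _ h1 _ D mD) // => m; rewrite h2.
  by case: m => [|[|m]]; rewrite ?moment0 ?m1 // rec vE !mul0r.
have vp : 0 < moment P 2 by rewrite lt_neqAle eq_sym vN.
rewrite -(det _ (normal_has_moments vp) _ D mD) //.
apply: (@eq_from_recursion _ _ (fun m f => moment P 2 * m.+1%:R * f m)) => //.
- by move=> m f g ->.
- by rewrite !moment0.
- by rewrite m1 normal_moment1.
- by move=> m; exact: normal_moment_rec.
Qed.

Lemma semicircle_law_of_moments (P : probability (measurableTypeR R) R) : moment_determined P ->
  moment P 1 = 0 -> 0 <= moment P 2 ->
  (forall m, moment P m.+2 = moment P 2 * \sum_(j < m.+1) moment P j * moment P (m - j)%N) ->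
  semicircle_law (moment P 2) P.
Proof.
move=> det m1 v0 rec D mD; case: eqP => [vE|/eqP vN].
  have [h1 h2] := dirac0_moments; rewrite -(det _ h1 _ D mD) // => m; rewrite h2.
  by case: m => [|[|m]]; rewrite ?moment0 ?m1 // rec vE !mul0r.
have vp : 0 < moment P 2 by rewrite lt_neqAle eq_sym vN.
have [S hS] := semicircle_probability vp; rewrite -hS //.
have [h1 h2 h3] := semicircle_moments vp hS.
rewrite -(det _ h1 _ D mD) //.
apply: (@eq_from_recursion _ _ (fun m f => moment P 2 * \sum_(j < m.+1) f j * f (m - j)%N)) => //.
- move=> m f g fg; congr (_ * _); apply: eq_bigr => j _.
  by rewrite !fg // ?leq_subr // -ltnS.
- by rewrite !moment0.
- by rewrite h2 m1.
- by apply: catalan_recursion => //; exact: moment0.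
Qed.

End Laws.

Theorem corollary1p8 (R : realType) (q : R) (hq : -1 <= q <= 1)
    (Q : {poly R}) (A : nat -> ncProbSpace R) (M : nat -> nat) (lambda : R)
    (hlambda : 0 <= lambda)
    (hM : (fun N : nat => (M N)%:R / N%:R : R) @ \oo --> lambda)
    (W : forall N : nat, 'M[A N]_N)
    (hW : forall N : nat, (0 < N)%N ->
       q_wishart q ((N%:R^-1)%:M : 'M[R]_N) (1%:M : 'M[R]_(M N)) (W N)) :
  exists mu : probability (measurableTypeR R) R,
    [/\ cvg_in_distribution (fun N : nat => centered_trace Q (W N)) mu,
        q = 1 -> exists2 v : R, 0 <= v & normal_law v mu
      & q = 0 -> exists2 v : R, 0 <= v & semicircle_law v mu].
Proof.
have [mu [hmu momu]] := limit_law Q hq hM hW; exists mu.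
have [m0 m1 m2] := fluctuation_moment012 Q hM hW.
have [_ det _] := hmu; split=> // [q1|q0]; exists (moment mu 2); rewrite ?momu //.
- rewrite -momu; apply: normal_law_of_moments; rewrite ?momu // => m.
  by rewrite !momu; apply: (limit_gaussian Q hM hW).
- rewrite -momu; apply: semicircle_law_of_moments; rewrite ?momu // => m.
  rewrite !momu (limit_catalan Q hM hW q0); congr (_ * _).
  by apply: eq_bigr => j _; rewrite !momu.
Qed.
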